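(* Under $P_N$, let $\#\Theta[-\alpha,\alpha]$ be the number of $k$ with $\arg(z_k)\in[-\alpha,\alpha]$ and $\#\mathcal{I}[a,b]$ the number of $k$ with $|z_k|\in[a,b]$. (i) Suppose that either $\alpha\in(0,\pi)$ is fixed, or $\alpha=\alpha(N)\downarrow0$ with $N\alpha\uparrow\infty$. Then, as $N\uparrow\infty$, $$\frac{\#\Theta[-\alpha,\alpha]-E_N[\#\Theta[-\alpha,\alpha]]}{\sqrt{\mathrm{Var}_N(\#\Theta[-\alpha,\alpha])}}$$ converges in distribution to a Gaussian random variable of mean zero and variance one. (ii) Suppose that either $a<b$ are fixed with $[a,b]\subset(0,1)$, or $a\in(0,1)$ is fixed and $b=b(N)>a$ with $(b-a)\downarrow0$ and $N(b-a)\uparrow\infty$. Then, as $N\uparrow\infty$, $$\frac{\#\mathcal{I}[a,b]-E_N[\#\mathcal{I}[a,b]]}{\sqrt{\mathrm{Var}_N(\#\mathcal{I}[a,b])}}$$ converges in distribution to a Gaussian random variable of mean zero and variance one.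
   Context: Ginibre's complex ensemble: $P_N$ is the probability measure on $\mathbb{C}^N$ given by $$dP_N(z_1,\dots,z_N)=\frac1{Z_N}\prod_{1\le \ell<k\le N}|z_\ell-z_k|^2\,\mu_N(dz_1)\cdots\mu_N(dz_N),\qquad \mu_N(dz)=e^{-N|z|^2}\,d\Re(z)\,d\Im(z),$$ with $Z_N$ the normalizing constant. $E_N$ and $\mathrm{Var}_N$ are mean and variance under $P_N$. Arguments are taken in $[-\pi,\pi]$. *)

(* Defs.v *)
From HB Require Import structures.
From mathcomp Require Import all_boot all_order all_algebra.
From mathcomp Require Import all_classical all_reals all_analysis.
From mathcomp Require Import measurable_realfun.

Set Implicit Arguments.
Unset Strict Implicit.
Unset Printing Implicit Defensive.
Import Order.TTheory GRing.Theory Num.Theory.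
Import numFieldNormedType.Exports.

Local Open Scope classical_set_scope.
Local Open Scope ring_scope.

Section density.
Local Open Scope ereal_scope.
Context d (T : measurableType d) (R : realType).
Variables (m : {measure set T -> \bar R}) (f : T -> R).
Hypotheses (mf : measurable_fun [set: T] f) (f0 : forall x, (0 <= f x)%R).

Lemma density_ge0 A : 0 <= \int[m]_(x in A) (f x)%:E.
Proof. by apply: integral_ge0 => x _; rewrite lee_fin. Qed.

Lemma density_semi_sigma_additive :
  semi_sigma_additive (fun A => \int[m]_(x in A) (f x)%:E).
Proof.
move=> /= F mF tF mUF; apply: cvg_toP.
  apply: ereal_nondecreasing_is_cvgn => i j ij.
  by apply: lee_sum_nneg_natr => // k _ _; exact: density_ge0.
rewrite ge0_integral_bigcup//=.
- exact/measurable_funTS/measurable_EFinP.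
- by move=> x _; rewrite lee_fin.
Qed.

End density.

Lemma product_sigma_finite d1 d2 (T1 : measurableType d1)
    (T2 : measurableType d2) (R : realType)
    (m1 : {sigma_finite_measure set T1 -> \bar R})
    (m2 : {sigma_finite_measure set T2 -> \bar R}) :
  sigma_finite [set: T1 * T2] (m1 \x m2)%E.
Proof.
have /sigma_finiteP[F [TF ndF Foo]] := sigma_finiteT m1.
have /sigma_finiteP[G [TG ndG Goo]] := sigma_finiteT m2.
exists (fun n => F n `*` G n).
  rewrite -setXTT TF TG predeqE => -[x y]; split.
    move=> [/= [n _ Fnx] [k _ Gky]]; exists (maxn n k) => //; split.
    - by move: x Fnx; exact/subsetPset/ndF/leq_maxl.
    - by move: y Gky; exact/subsetPset/ndG/leq_maxr.
  by move=> [n _ []/= ? ?]; split; exists n.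
move=> k; have [? ?] := Foo k; have [? ?] := Goo k.
split; first exact: measurableX.
by rewrite product_measure1E// lte_mul_pinfty// ge0_fin_numE.
Qed.

Section tuple_product_measure.
Local Open Scope ereal_scope.
Context d (T : measurableType d) (R : realType).
Variable m : {sigma_finite_measure set T -> \bar R}.

Definition cons_pair n (x : T * n.-tuple T) : n.+1.-tuple T :=
  [tuple of x.1 :: x.2].

(* m^{(x) n}, with T * n.-tuple T identified with n.+1.-tuple T *)
Fixpoint tuple_measure n : set (n.-tuple T) -> \bar R :=
  match n with
  | 0 => dirac [tuple]
  | n'.+1 => pushforward (m \x @tuple_measure n') (@cons_pair n')
  end.

Lemma measurable_cons_pair n :
  measurable_fun [set: T * n.-tuple T] (@cons_pair n).
Proof. exact: measurable_cons. Qed.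

Definition uncons_pair n (t : n.+1.-tuple T) : T * n.-tuple T :=
  (thead t, [tuple of behead t]).

Lemma measurable_uncons_pair n :
  measurable_fun [set: n.+1.-tuple T] (@uncons_pair n).
Proof.
apply: measurable_fun_pair; first exact: measurable_tnth.
exact: measurable_behead.
Qed.

Lemma cons_pairK n : cancel (@cons_pair n) (@uncons_pair n).
Proof.
by move=> [x t]; rewrite /uncons_pair/= theadE; congr pair; exact/val_inj.
Qed.

Lemma tuple_measureP n :
  exists mu : {sigma_finite_measure set (n.-tuple T) -> \bar R},
    mu = @tuple_measure n :> (set _ -> _).
Proof.
elim: n => [|n [mu muE]].
  by exists (@dirac _ (0.-tuple T) [tuple] R).
rewrite /= -muE.
have mc := @measurable_cons_pair n.
pose p := measure_function_pushforward__canonical__measure_function_Measure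
  (m \x mu)%E mc.
have sfp : sigma_finite setT p.
  have [F FT Foo] := product_sigma_finite m mu.
  exists (fun i => @uncons_pair n @^-1` F i).
    by rewrite -preimage_bigcup -FT preimage_setT.
  move=> i; have [mF Fi] := Foo i; split.
    by rewrite -[X in measurable X]setTI; exact: measurable_uncons_pair.
  rewrite /p/= /pushforward -comp_preimage.
  by rewrite (_ : _ \o _ = id) // funeqE => x /=; exact: cons_pairK.
pose p' : {measure set (n.+1.-tuple T) -> \bar R} := p.
pose sf := Measure_isSigmaFinite.Build _ _ _ p' sfp.
pose q : {sigma_finite_measure set (n.+1.-tuple T) -> \bar R} :=
  HB.pack (p' : set _ -> _) (Measure.class p') sf.
by exists q.
Qed.

Let tuple_measure0 n : @tuple_measure n set0 = 0.
Proof. by have [mu <-] := tuple_measureP n; exact: measure0. Qed.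

Let tuple_measure_ge0 n A : 0 <= @tuple_measure n A.
Proof. by have [mu <-] := tuple_measureP n; exact: measure_ge0. Qed.

Let tuple_measure_semi_sigma_additive n :
  semi_sigma_additive (@tuple_measure n).
Proof.
by have [mu <-] := tuple_measureP n; exact: measure_semi_sigma_additive.
Qed.

HB.instance Definition _ n := isMeasure.Build _ _ _ (@tuple_measure n)
  (@tuple_measure0 n) (@tuple_measure_ge0 n)
  (@tuple_measure_semi_sigma_additive n).

Let tuple_measure_sigma_finite n : sigma_finite setT (@tuple_measure n).
Proof. by have [mu <-] := tuple_measureP n; exact: sigma_finiteT. Qed.

HB.instance Definition _ n := Measure_isSigmaFinite.Build _ _ _
  (@tuple_measure n) (@tuple_measure_sigma_finite n).

End tuple_product_measure.

(* The complex plane, (x, y) standing for x + i y. The norm that the library puts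
   on a product is the sup norm; the complex modulus is cmod below.
   measurableTypeR R is R with the Borel structure carried by lebesgue_measure. *)
Notation plane R := (measurableTypeR R * measurableTypeR R)%type.

Section plane.
Context (R : realType).

Definition cmod (z : plane R) : R := Num.sqrt (z.1 ^+ 2 + z.2 ^+ 2).

(* Principal argument, in ]-pi, pi]; the value at the null set {0} is
   immaterial. *)
Definition carg (z : plane R) : R :=
  if 0 <= z.2 then acos (z.1 / cmod z) else - acos (z.1 / cmod z).

Lemma measurable_cmod : measurable_fun [set: plane R] cmod.
Proof.
apply: (@measurableT_comp _ _ _ _ _ _ (@Num.sqrt R)).
  by apply: continuous_measurable_fun; exact: sqrt_continuous.
by apply: measurable_funD; apply: measurable_funX.
Qed.

Lemma measurable_acos : measurable_fun [set: R] (@acos R).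
Proof.
have mI : measurable (`]-1, 1[%classic : set R) by [].
rewrite -(setUv (`]-1, 1[%classic : set R)).
apply/measurable_funU => //; first exact: measurableC.
split.
  apply: open_continuous_measurable_fun; first exact: interval_open.
  by move=> x; rewrite inE/= in_itv/= => /continuous_acos.
pose g (x : R) := if x == -1 then (pi : R) else 0.
apply: (@eq_measurable_fun _ _ _ _ _ g).
  move=> x; rewrite inE/= in_itv/= /g => xI.
  have [->|xN1] := eqVneq x (-1); first by rewrite acosN1.
  have [->|x1] := eqVneq x 1; first by rewrite acos1.
  rewrite unlock; case: xgetP => //= y _ [/andP[y0 ypi] cy].
  have xle : -1 <= x <= 1 by rewrite -cy cos_geN1 cos_le1.
  exfalso; apply: xI; case/andP: xle => a b.
  by rewrite !lt_neqAle a b x1 eq_sym xN1.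
apply: measurable_funTS; apply: measurable_fun_ifT => //.
exact: measurable_fun_eqr.
Qed.

Lemma measurable_carg : measurable_fun [set: plane R] carg.
Proof.
have mq : measurable_fun [set: plane R] (fun z => acos (z.1 / cmod z)).
  apply: (measurableT_comp measurable_acos); apply: measurable_funM => //.
  under eq_fun do rewrite -powR_inv1 ?sqrtr_ge0//.
  exact: (measurableT_comp (measurable_powR _) measurable_cmod).
apply: measurable_fun_ifT => //; last exact: measurableT_comp.
exact: measurable_fun_ler.
Qed.

Definition lebesgue_plane : {measure set plane R -> \bar R} :=
  (@lebesgue_measure R \x @lebesgue_measure R)%E.

(* mu_N(dz) = exp(- N |z|^2) dRe(z) dIm(z) *)
Definition gauss_weight (N : nat) : set (plane R) -> \bar R := fun A =>
  (\int[lebesgue_plane]_(z in A) (expR (- (N%:R * cmod z ^+ 2)))%:E)%E.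

Let measurable_gauss N :
  measurable_fun [set: plane R] (fun z => expR (- (N%:R * cmod z ^+ 2))).
Proof.
apply: measurableT_comp => //; apply: measurableT_comp => //.
by apply: measurable_funM => //; apply: measurable_funX; exact: measurable_cmod.
Qed.

Let gauss_weight0 N : gauss_weight N set0 = 0%E.
Proof. exact: integral_set0. Qed.

Let gauss_weight_ge0 N A : (0 <= gauss_weight N A)%E.
Proof. by apply: density_ge0 => z; exact: expR_ge0. Qed.

Let gauss_weight_semi_sigma_additive N :
  semi_sigma_additive (gauss_weight N).
Proof. by apply: density_semi_sigma_additive => // z; exact: expR_ge0. Qed.

HB.instance Definition _ N := isMeasure.Build _ _ _ (gauss_weight N)
  (@gauss_weight0 N) (@gauss_weight_ge0 N)
  (@gauss_weight_semi_sigma_additive N).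

Let gauss_weight_sigma_finite N : sigma_finite setT (gauss_weight N).
Proof.
have [F FT Foo] : sigma_finite setT lebesgue_plane.
  exact: product_sigma_finite.
exists F => // i; have [mF Fi] := Foo i; split=> //.
rewrite (le_lt_trans _ Fi)// -[leRHS]mul1e -integral_cst//.
apply: ge0_le_integral => //=.
- by apply/measurable_funTS; exact/measurable_EFinP.
- move=> z _; rewrite lee_fin -expR0 ler_expR oppr_le0 mulr_ge0//.
  exact: sqr_ge0.
Qed.

HB.instance Definition _ N := Measure_isSigmaFinite.Build _ _ _
  (gauss_weight N) (@gauss_weight_sigma_finite N).

Definition vandermonde_sq N (z : N.-tuple (plane R)) : R :=
  \prod_(k < N) \prod_(l < N | (l < k)%N) cmod (tnth z l - tnth z k) ^+ 2.

(* Its total mass is Z_N. *)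
Definition ginibre_weight N : set (N.-tuple (plane R)) -> \bar R := fun A =>
  (\int[tuple_measure (gauss_weight N) (n:=N)]_(z in A)
    (vandermonde_sq z)%:E)%E.

Let measurable_vandermonde_sq N :
  measurable_fun [set: N.-tuple (plane R)] (@vandermonde_sq N).
Proof.
have mtnth i : measurable_fun setT (fun z : N.-tuple (plane R) => tnth z i).
  exact: measurable_tnth.
apply: measurable_prod => k _.
have -> : (fun z : N.-tuple (plane R) =>
    \prod_(l < N | (l < k)%N) cmod (tnth z l - tnth z k) ^+ 2) =
  (fun z => \prod_(l <- [seq i <- index_enum 'I_N | (nat_of_ord i < k)%N])
    cmod (tnth z l - tnth z k) ^+ 2).
  by apply/funext => z; rewrite big_filter.
apply: measurable_prod => l _; apply: measurable_funX.
apply: (measurableT_comp measurable_cmod).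
apply/measurable_fun_pairP; split.
  by apply: measurable_funB; exact: measurableT_comp.
by apply: measurable_funB; exact: measurableT_comp.
Qed.

Let vandermonde_sq_ge0 N z : 0 <= @vandermonde_sq N z.
Proof. by apply: prodr_ge0 => k _; apply: prodr_ge0 => l _; exact: sqr_ge0. Qed.

Let ginibre_weight0 N : @ginibre_weight N set0 = 0%E.
Proof. exact: integral_set0. Qed.

Let ginibre_weight_ge0 N A : (0 <= @ginibre_weight N A)%E.
Proof. exact: density_ge0. Qed.

Let ginibre_weight_semi_sigma_additive N :
  semi_sigma_additive (@ginibre_weight N).
Proof.
apply: density_semi_sigma_additive => //; exact: measurable_vandermonde_sq.
Qed.

HB.instance Definition _ N := isMeasure.Build _ _ _ (@ginibre_weight N)
  (@ginibre_weight0 N) (@ginibre_weight_ge0 N)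
  (@ginibre_weight_semi_sigma_additive N).

(* P_N. The second argument of mnormalize is a default value for weights of total
   mass 0 or +oo; it plays no role here, since 0 < Z_N < +oo. *)
Definition ginibre N : probability (N.-tuple (plane R)) R :=
  mnormalize (@ginibre_weight N)
    (dirac ([tuple 0 | _ < N] : N.-tuple (plane R))).

Definition count_points N (p : pred (plane R)) (z : N.-tuple (plane R)) : R :=
  #|[pred k | p (tnth z k)]|%:R.

Lemma measurable_count_points N (p : pred (plane R)) :
  measurable_fun setT p -> measurable_fun setT (@count_points N p).
Proof.
move=> mp.
have -> : @count_points N p =
    fun z => \sum_(k < N) (if p (tnth z k) then 1 else 0 : R).
  apply/funext => z; rewrite /count_points -sum1_card natr_sum big_mkcond/=.
  by apply: eq_bigr => k _; rewrite inE; case: ifP.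
apply: measurable_sum => k; apply: measurable_fun_ifT => //.
by apply: (measurableT_comp mp); exact: measurable_tnth.
Qed.

(* #Theta[-alpha, alpha] *)
Definition count_sector N (alpha : R) : N.-tuple (plane R) -> R :=
  count_points (fun z => carg z \in `[- alpha, alpha]).

Let measurable_count_sector N alpha :
  measurable_fun setT (@count_sector N alpha).
Proof.
apply: measurable_count_points; under eq_fun do rewrite in_itv/=.
by apply: measurable_and; apply: measurable_fun_ler => //;
  exact: measurable_carg.
Qed.

HB.instance Definition _ N alpha := isMeasurableFun.Build _ _ _ _
  (@count_sector N alpha) (@measurable_count_sector N alpha).

(* #I[a, b] *)
Definition count_annulus N (a b : R) : N.-tuple (plane R) -> R :=
  count_points (fun z => cmod z \in `[a, b]).

Let measurable_count_annulus N a b :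
  measurable_fun setT (@count_annulus N a b).
Proof.
apply: measurable_count_points; under eq_fun do rewrite in_itv/=.
by apply: measurable_and; apply: measurable_fun_ler => //;
  exact: measurable_cmod.
Qed.

HB.instance Definition _ N a b := isMeasurableFun.Build _ _ _ _
  (@count_annulus N a b) (@measurable_count_annulus N a b).

End plane.

Section standardization.
Context d (T : measurableType d) (R : realType).
Variables (P : probability T R) (X : {RV P >-> R}).

Definition standardized : T -> R := fun w =>
  (X w - fine 'E_P[X]) / Num.sqrt (fine 'V_P[X]).

Let measurable_standardized : measurable_fun setT standardized.
Proof. by apply: measurable_funM => //; exact: measurable_funB. Qed.

HB.instance Definition _ := isMeasurableFun.Build _ _ _ _
  standardized measurable_standardized.

End standardization.
Arguments standardized {d T R} P X.

(* The X n may live on different probability spaces; only the law nu of the limit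
   matters. Convergence of the distribution functions is required at the
   continuity points of that of nu. *)
Definition cvg_in_distribution (R : realType) (d : nat -> measure_display)
    (T : forall n, measurableType (d n)) (P : forall n, probability (T n) R)
    (X : forall n, {RV (P n) >-> R})
    (nu : probability (measurableTypeR R) R) : Prop :=
  forall r : R, {for r, continuous (fun x : R => nu `]-oo, x]%classic)} ->
    cdf (X n) r @[n --> \oo] --> nu `]-oo, r]%classic.
Arguments cvg_in_distribution {R d T} P X nu.

(* Main.v *)
Require Import Defs.
From HB Require Import structures.
From mathcomp Require Import all_boot all_order all_algebra fingroup perm spectral sesquilinear complex.
From mathcomp Require Import all_classical all_reals all_analysis.
From mathcomp Require Import measurable_realfun.
From mathcomp Require Import ring lra.

Set Implicit Arguments.
Unset Strict Implicit.
Unset Printing Implicit Defensive.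
Import Order.TTheory GRing.Theory Num.Theory.
Import numFieldNormedType.Exports.

Local Open Scope classical_set_scope.
Local Open Scope ring_scope.

(** A count of points is a sum of independent Bernoulli variables in disguise.
    Up to a constant, the density of P_N is D times its conjugate, where D is
    the determinant of the phi_j(z_i) and phi_j is the monomial z^j normalized
    in L^2(mu_N). For a set p with indicator 1_p, the product of the
    1 + (x - 1) 1_p(z_i) is x to the power of the count, so the identity of
    Andreief (andreief) gives det(1 + (x - 1) M) for the generating function
    of the count, M being the Gram matrix of 1_p in the phi_j. M is a Hermitian
    contraction, so that the generating function is the product of the
    1 - l + l x over its eigenvalues l, all in [0, 1]
    (ginibre_count_spectrum): the count has the law of a sum of independent
    Bernoulli variables, of variance tr(M - M^2).

    Such a sum, centred and reduced, has a distribution function at distance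
    O(1/sigma) from the Gaussian one up to a shift of 1/sigma
    (bernoulli_std_cdf_lower, bernoulli_std_cdf_upper), by the method of Stein.
    Hence a central limit theorem holds as soon as the variance tends to
    infinity (counting_variable_clt), and two lower bounds of tr(M - M^2)
    remain to be found. Polar coordinates (ge0_integral_polar) give the entries
    of M.

    For the sector, M_jk = g_jk sin((j - k) alpha) / (pi (j - k)), where
    |g_jk| <= 1 by Cauchy-Schwarz and g_jj = 1. The trace of M is N alpha / pi
    exactly, and alpha / pi bounds from above the sum over |m| <= N of the
    squared Fourier coefficients sin(m alpha) / (pi m) of the indicator of
    [-alpha, alpha], by the inequality of Bessel (sector_bessel). Summed over
    the N rows, the squared coefficients at places j - k = m outside the
    N x N square leave at least (2 / pi^2) sum_(1 <= m <= N) sin(m alpha)^2 / m,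
    which grows at least like log(N alpha) (sector_variance_lower,
    sector_sum_lower).

    For the annulus, M is diagonal. Its k-th entry is the probability that
    N a^2 <= X <= N b^2 for X of law Gamma(k + 1). For the roughly sqrt N
    integers k between N a^2 and N a^2 + sqrt N, the bound of Stirling shows
    that the entry is at least c sqrt N min(b - a, 1 / sqrt N) and its
    complement to 1 at least c, so the variance is at least
    c' min(N (b - a), sqrt N) (annulus_variance_lower). *)

(** * Derivatives of explicit functions *)

Section pointwise_derivation.
Context {R : realType}.
Implicit Types (f g : R -> R) (x a b c : R).

(** The rules are stated for functions in expanded form, with the argument visible,
    so that the tactic derive_body can choose the rule by the head of the body. *)
Lemma derive_rule_cst c x : is_derive x 1 (fun _ : R => c) 0.
Proof. exact: is_derive_cst. Qed.

Lemma derive_rule_id x : is_derive x 1 (fun y : R => y) 1.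
Proof. exact: is_derive_id. Qed.

Lemma derive_ruleD f g x a b : is_derive x 1 f a -> is_derive x 1 g b ->
  is_derive x 1 (fun y => f y + g y) (a + b).
Proof. exact: is_deriveD. Qed.

Lemma derive_ruleN f x a : is_derive x 1 f a ->
  is_derive x 1 (fun y => - f y) (- a).
Proof. exact: is_deriveN. Qed.

Lemma derive_ruleM f g x a b : is_derive x 1 f a -> is_derive x 1 g b ->
  is_derive x 1 (fun y => f y * g y) (f x * b + g x * a).
Proof. exact: is_deriveM. Qed.

Lemma derive_ruleX f n x a : is_derive x 1 f a ->
  is_derive x 1 (fun y => f y ^+ n) (n%:R * f x ^+ n.-1 * a).
Proof.
move=> df; have -> : (fun y => f y ^+ n) = f ^+ n.
  by apply/funext => y; rewrite exprfctE.
exact: is_deriveX.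
Qed.

Lemma derive_rule_comp f g x a b : is_derive (g x) 1 f a -> is_derive x 1 g b ->
  is_derive x 1 (fun y => f (g y)) (a * b).
Proof. exact: is_derive1_comp. Qed.

Lemma derive_rule_exp g x b : is_derive x 1 g b ->
  is_derive x 1 (fun y => expR (g y)) (expR (g x) * b).
Proof. by apply: derive_rule_comp; exact: is_derive_expR. Qed.

Lemma derive_rule_sin g x b : is_derive x 1 g b ->
  is_derive x 1 (fun y => sin (g y)) (cos (g x) * b).
Proof. by apply: derive_rule_comp; exact: is_derive_sin. Qed.

Lemma derive_rule_cos g x b : is_derive x 1 g b ->
  is_derive x 1 (fun y => cos (g y)) (- sin (g x) * b).
Proof. by apply: derive_rule_comp; exact: is_derive_cos. Qed.

Lemma derive_ruleV f x a : f x != 0 -> is_derive x 1 f a ->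
  is_derive x 1 (fun y => (f y)^-1) (- (f x ^- 2) * a).
Proof.
move=> fx0 df; apply: DeriveDef.
  by apply: derivableV => //; exact: ex_derive.
by rewrite deriveV//= derive_val.
Qed.

Lemma derive_rule_sum (I : Type) (r : seq I) (h : I -> R -> R) x (d : I -> R) :
  (forall i, is_derive x 1 (h i) (d i)) ->
  is_derive x 1 (fun y => \sum_(i <- r) h i y) (\sum_(i <- r) d i).
Proof.
move=> hd; elim: r => [|i r IH].
  under eq_fun do rewrite big_nil; rewrite big_nil; exact: derive_rule_cst.
under eq_fun do rewrite big_cons; rewrite big_cons; exact: derive_ruleD.
Qed.

Lemma derive_rule_eq f x a b : is_derive x 1 f a -> a = b -> is_derive x 1 f b.
Proof. by move=> ? <-. Qed.

End pointwise_derivation.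

(** The non-zero denominators and the derivatives of unknown functions are left
    over. *)
Ltac derive_body := lazymatch goal with
  | |- is_derive _ _ (fun y => y) _ => exact: derive_rule_id
  | |- is_derive _ _ (fun _ => ?c) _ => exact: derive_rule_cst
  | |- is_derive _ _ (fun y => @?f y + @?g y) _ =>
      notypeclasses refine (@derive_ruleD _ f g _ _ _ _ _); derive_body
  | |- is_derive _ _ (fun y => @?f y * @?g y) _ =>
      notypeclasses refine (@derive_ruleM _ f g _ _ _ _ _); derive_body
  | |- is_derive _ _ (fun y => - (@?f y)) _ =>
      notypeclasses refine (@derive_ruleN _ f _ _ _); derive_body
  | |- is_derive _ _ (fun y => (@?f y) ^+ ?n) _ =>
      notypeclasses refine (@derive_ruleX _ f n _ _ _); derive_body
  | |- is_derive _ _ (fun y => (@?f y)^-1) _ =>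
      notypeclasses refine (@derive_ruleV _ f _ _ _ _); [|derive_body]
  | |- is_derive _ _ (fun y => expR (@?f y)) _ =>
      notypeclasses refine (@derive_rule_exp _ f _ _ _); derive_body
  | |- is_derive _ _ (fun y => sin (@?f y)) _ =>
      notypeclasses refine (@derive_rule_sin _ f _ _ _); derive_body
  | |- is_derive _ _ (fun y => cos (@?f y)) _ =>
      notypeclasses refine (@derive_rule_cos _ f _ _ _); derive_body
  | |- is_derive _ _ (fun y => \sum_(i <- ?r) @?h y i) _ =>
      notypeclasses refine (@derive_rule_sum _ _ r (fun i y => h y i) _ _ (fun _ => _)); derive_body
  | |- _ => try eassumption
  end.
Ltac derive_fun := notypeclasses refine (derive_rule_eq _ _); [derive_body|rewrite /=].

Lemma MVT_is_derive (R : realType) (f df : R -> R) (a b : R) : a <= b ->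
  (forall x, x \in `[a, b] -> is_derive x 1 f (df x)) ->
  exists2 c, a <= c <= b & f b - f a = df c * (b - a).
Proof.
move=> ab fdf.
have h1 x : x \in `]a, b[ -> is_derive x 1 f (df x).
  by move=> xab; apply: fdf; apply: subset_itv_oo_cc xab.
have h := @MVT_segment R f df a b ab h1.
have [|c cab e] := h; last by exists c.
apply: derivable_within_continuous => x xab.
exact: (@ex_derive _ _ _ _ _ _ _ (fdf x xab)).
Qed.

(** * The Stein equation of the Gaussian law *)

Section stein_solution.
Context {R : realType}.
Implicit Types x y z a b w : R.

Definition gauss_pdf : R -> R := normal_pdf 0 1.
Definition gauss_cdf x : R := fine (normal_prob 0 1 `]-oo, x]%classic).
Local Notation phi := gauss_pdf.
Local Notation Phi := gauss_cdf.

Lemma gauss_pdfE x : phi x = normal_peak 1 * expR (- (x ^+ 2 / 2)).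
Proof.
rewrite /phi normal_pdfE ?oner_neq0// /normal_fun subr0 expr1n.
by rewrite mulNr.
Qed.

Lemma gauss_pdf_gt0 x : 0 < phi x.
Proof. by rewrite gauss_pdfE mulr_gt0 ?expR_gt0// normal_peak_gt0. Qed.

Lemma is_derive_gauss_pdf x : is_derive x 1 phi (- x * phi x).
Proof.
have -> : phi = fun y => normal_peak 1 * expR (- (y ^+ 2 / 2)).
  by apply/funext => y; rewrite gauss_pdfE.
by derive_fun; field.
Qed.

Lemma is_derive_gauss_cdf x : is_derive x 1 Phi (phi x).
Proof.
have [||||dF F'] := @continuous_FTC1 R phi -oo%O x (x + 1).
- by rewrite ltrDl.
- by apply: (integrableS _ _ (subsetT _)) => //; exact: integrable_normal_pdf.
- by rewrite /= ltNyr.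
- by apply: continuous_normal_pdf; exact: oner_neq0.
- by apply: DeriveDef => //; rewrite -derive1E.
Qed.

Lemma gauss_cdf_ge0 x : 0 <= Phi x.
Proof. by rewrite fine_ge0. Qed.

Lemma gauss_cdf_le1 x : Phi x <= 1.
Proof.
rewrite -lee_fin fineK ?fin_num_measure//; exact: probability_le1.
Qed.

Lemma gauss_cdf_nd x y : x <= y -> Phi x <= Phi y.
Proof.
move=> xy; rewrite fine_le ?fin_num_measure//.
by rewrite le_measure ?inE//; apply: subset_itvl; rewrite bnd_simp.
Qed.

Let idTR : measurableTypeR R -> R := idfun.

#[local] HB.instance Definition _ :=
  @isMeasurableFun.Build _ _ _ _ idTR (@measurable_id _ _ setT).

Let cdf_idE : Phi = fine \o cdf (idTR : {RV (normal_prob 0 1) >-> R}).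
Proof. by []. Qed.

Lemma gauss_cdf_cvgy : Phi x @[x --> +oo] --> (1 : R).
Proof. by rewrite cdf_idE; exact/fine_cvg/cvg_cdfy1. Qed.

Lemma gauss_cdf_cvgNy : Phi x @[x --> -oo] --> (0 : R).
Proof. by rewrite cdf_idE; exact/fine_cvg/cvg_cdfNy0. Qed.

(** Its derivative is negative on both half-lines; its limits 1 at +oo and 0 at
    -oo give the two Mills bounds. *)
Let mills_fun x := phi x / x + Phi x.

Let is_derive_mills x : x != 0 -> is_derive x 1 mills_fun (- (phi x / x ^+ 2)).
Proof.
move=> x0; have := is_derive_gauss_pdf x; have := is_derive_gauss_cdf x => dP dp.
rewrite /mills_fun; derive_fun => //; field.
by [].
Qed.

Lemma mills_ratio x : 0 < x -> x * (1 - Phi x) <= phi x.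
Proof.
move=> x0.
suff : 1 <= mills_fun x.
  rewrite /mills_fun -(ler_pM2l x0) mulrDr mulrCA divff ?gt_eqF//; lra.
apply: (cvgr_to_le gauss_cdf_cvgy).
near=> y; have xy : x <= y by near: y; apply: nbhs_pinfty_ge; rewrite num_real.
have y0 : 0 < y by exact: lt_le_trans xy.
have [|c /andP[xc cy] e] := @MVT_is_derive R mills_fun (fun t => - (phi t / t ^+ 2)) x y xy.
  move=> t /itvP tI; apply: is_derive_mills.
  by rewrite gt_eqF// (lt_le_trans x0)// tI.
apply: (@le_trans _ _ (mills_fun y)).
  by rewrite /mills_fun lerDr divr_ge0// ltW// gauss_pdf_gt0.
rewrite -subr_le0 e mulNr oppr_le0 mulr_ge0 ?subr_ge0//.
by rewrite divr_ge0 ?sqr_ge0// ltW// gauss_pdf_gt0.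
Unshelve. all: by end_near.
Qed.

Lemma mills_ratioN x : x < 0 -> - x * Phi x <= phi x.
Proof.
move=> x0.
suff : mills_fun x <= 0.
  by rewrite /mills_fun -(ler_nM2l x0) mulr0 mulrDr mulrCA divff ?lt_eqF//; lra.
apply: (cvgr_to_ge gauss_cdf_cvgNy).
near=> y; have xy : y <= x by near: y; apply: nbhs_ninfty_le; rewrite num_real.
have y0 : y < 0 by exact: le_lt_trans x0.
have [|c /andP[xc cy] e] := @MVT_is_derive R mills_fun (fun t => - (phi t / t ^+ 2)) y x xy.
  move=> t /itvP tI; apply: is_derive_mills.
  by rewrite lt_eqF// (le_lt_trans _ x0)// tI.
apply: (@le_trans _ _ (mills_fun y)); last first.
  by rewrite /mills_fun gerDr nmulr_lle0 ?invr_lt0//; exact/ltW/gauss_pdf_gt0.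
rewrite -subr_le0 e mulNr oppr_le0 mulr_ge0 ?subr_ge0//.
by rewrite divr_ge0 ?sqr_ge0// ltW// gauss_pdf_gt0.
Unshelve. all: by end_near.
Qed.

(** stein z is the bounded solution of f'(x) = x f(x) + 1_(x <= z) - Phi z; each
    branch solves the equation on its side of z. *)
Definition stein_left z x := Phi x * (1 - Phi z) / phi x.
Definition stein_right z x := (1 - Phi x) * Phi z / phi x.
Definition stein z x := if x <= z then stein_left z x else stein_right z x.

Lemma stein_diag z : stein_left z z = stein_right z z.
Proof. by rewrite /stein_left /stein_right (mulrC (Phi z)). Qed.

Lemma is_derive_stein_left z x :
  is_derive x 1 (stein_left z) (x * stein_left z x + (1 - Phi z)).
Proof.
have := is_derive_gauss_pdf x; have := is_derive_gauss_cdf x => dP dp.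
have p0 : phi x != 0 by rewrite gt_eqF// gauss_pdf_gt0.
by rewrite /stein_left; derive_fun => //; field.
Qed.

Lemma is_derive_stein_right z x :
  is_derive x 1 (stein_right z) (x * stein_right z x - Phi z).
Proof.
have := is_derive_gauss_pdf x; have := is_derive_gauss_cdf x => dP dp.
have p0 : phi x != 0 by rewrite gt_eqF// gauss_pdf_gt0.
by rewrite /stein_right; derive_fun => //; field.
Qed.

Lemma stein_ge0 z x : 0 <= stein z x.
Proof.
have p0 := ltW (gauss_pdf_gt0 x).
rewrite /stein; case: ifP => _; apply: divr_ge0 => //; apply: mulr_ge0;
  rewrite ?subr_ge0 ?gauss_cdf_ge0 ?gauss_cdf_le1//.
Qed.

Let steinE z x : stein z x = (Num.min (Phi x) (Phi z)) *
  (1 - Num.max (Phi x) (Phi z)) / phi x.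
Proof.
rewrite /stein; case: leP => [xz|/ltW xz].
  by rewrite min_l ?max_r ?gauss_cdf_nd.
by rewrite min_r ?max_l ?gauss_cdf_nd// /stein_right (mulrC (Phi z)).
Qed.

Let stein_leP z x : stein z x * phi x <= Num.min (Phi x) (1 - Phi x).
Proof.
rewrite steinE divfK ?gt_eqF ?gauss_pdf_gt0//.
have := gauss_cdf_ge0 x; have := gauss_cdf_le1 x.
have := gauss_cdf_ge0 z; have := gauss_cdf_le1 z.
move: (Phi x) (Phi z) => p q q1 q0 p1 p0.
by rewrite le_min; case: (leP p q) => pq; apply/andP; split; nra.
Qed.

(** stein z x * phi x is below both Gaussian tails at x, which the Mills ratio
    compares with phi x / |x|. *)
Lemma stein_mulr_le1 z x : `|x * stein z x| <= 1.
Proof.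
have p0 := gauss_pdf_gt0 x.
rewrite -(ler_pM2r p0) mul1r -{1}(gtr0_norm p0) -normrM -mulrA.
have := stein_leP z x; rewrite le_min => /andP[h1 h2].
rewrite normrM (ger0_norm (_ : 0 <= stein z x * phi x)); last first.
  by rewrite mulr_ge0 ?stein_ge0// ltW.
have [x0|x0|->] := ltgtP x 0.
- apply: le_trans (mills_ratioN x0); rewrite ltr0_norm// ler_wpM2l// oppr_ge0.
  exact: ltW.
- apply: le_trans (mills_ratio x0); rewrite gtr0_norm// ler_wpM2l//.
  exact: ltW.
- by rewrite normr0 mul0r ltW// gauss_pdf_gt0.
Qed.

Definition stein_bound : R := 1 + (phi 1)^-1.

Lemma stein_bound_ge1 : 1 <= stein_bound.
Proof. by rewrite lerDl invr_ge0 ltW// gauss_pdf_gt0. Qed.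

(** Inside [-1, 1] the density is at least phi 1; outside, stein z x is below
    |x stein z x|. *)
Lemma stein_le z x : stein z x <= stein_bound.
Proof.
have p0 := gauss_pdf_gt0 x.
have [x1|x1] := leP `|x| 1.
  apply: (@le_trans _ _ (phi 1)^-1); last by rewrite lerDr.
  apply: (@le_trans _ _ (phi x)^-1).
    rewrite -(ler_pM2r p0) mulVf ?gt_eqF//; apply: le_trans (stein_leP z x) _.
    by rewrite ge_min gauss_cdf_le1.
  rewrite lef_pV2 ?posrE ?gauss_pdf_gt0// !gauss_pdfE ler_pM2l ?normal_peak_gt0//.
  rewrite ler_expR lerN2 ler_pM2r ?invr_gt0// -(@real_normK _ x) ?num_real//.
  by rewrite ler_pXn2r// nnegrE.
apply: le_trans stein_bound_ge1.
have := stein_mulr_le1 z x; rewrite normrM (ger0_norm (stein_ge0 _ _)).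
by apply: le_trans; rewrite ler_peMl ?stein_ge0// ltW.
Qed.

(** The derivative of stein z jumps at z, so the mean value theorem is used on
    each side; s is the proportion of [a, b] on the left of z. *)
Lemma stein_slope z a b : a <= b -> exists s c c' : R,
  [/\ 0 <= s <= 1, (b <= z -> s = 1), (z < a -> s = 0),
      a <= c <= b /\ a <= c' <= b &
      stein z b - stein z a = (b - a) *
        (s * (c * stein z c) + (1 - s) * (c' * stein z c') + s - Phi z)].
Proof.
move=> ab; have [bz|zb] := leP b z.
  have [c /andP[ac cb] e] := @MVT_is_derive R (stein_left z) _ a b ab
    (fun x _ => is_derive_stein_left z x).
  exists 1, c, c; split=> //; rewrite ?lexx ?ler01 ?ac//.
    by move=> za; move: bz; rewrite leNgt (lt_le_trans za ab).
  rewrite {1}/stein bz {1}/stein (le_trans ab bz) e /stein (le_trans cb bz); ring.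
have [za|az] := ltP z a.
  have [c /andP[ac cb] e] := @MVT_is_derive R (stein_right z) _ a b ab
    (fun x _ => is_derive_stein_right z x).
  exists 0, c, c; split=> //; rewrite ?lexx ?ler01 ?ac//.
  rewrite {1}/stein leNgt zb {1}/stein leNgt za e /stein leNgt (lt_le_trans za ac)/=.
  ring.
have [c /andP[ac cz] e] := @MVT_is_derive R (stein_left z) _ a z az
    (fun x _ => is_derive_stein_left z x).
have [c' /andP[zc' c'b] e'] := @MVT_is_derive R (stein_right z) _ z b (ltW zb)
    (fun x _ => is_derive_stein_right z x).
have ba : b - a != 0 by rewrite subr_eq0 gt_eqF// (le_lt_trans az).
exists ((z - a) / (b - a)), c, c'; split.
- rewrite divr_ge0 ?subr_ge0//= ler_pdivrMr ?subr_gt0 ?(le_lt_trans az)//.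
  by rewrite mul1r lerD2r ltW.
- by [].
- by [].
- by rewrite ac (le_trans az zc') c'b (le_trans cz (ltW zb)).
have -> : stein z b - stein z a =
    (stein_right z b - stein_right z z) + (stein_left z z - stein_left z a).
  by rewrite stein_diag /stein az leNgt zb/=; ring.
have c'E : c' * stein z c' = c' * stein_right z c'.
  rewrite /stein; case: leP => // c'z.
  by rewrite (le_anti (introT andP (conj c'z zc'))) stein_diag.
rewrite e e' c'E /stein cz; field.
by [].
Qed.

Lemma stein_lipschitz z x y : `|stein z x - stein z y| <= 2 * `|x - y|.
Proof.
wlog xy : x y / y <= x.
  by move=> h; have [/h//|/ltW /h] := leP y x; rewrite distrC (distrC y).
have [s [c [c' [/andP[s0 s1] _ _ _ ->]]]] := stein_slope z xy.
rewrite normrM mulrC ler_wpM2r//.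
have := stein_mulr_le1 z c; have := stein_mulr_le1 z c'.
have := gauss_cdf_ge0 z; have := gauss_cdf_le1 z; rewrite !ler_norml; nra.
Qed.

Lemma stein_mulr_near z x y d : `|x - y| <= d ->
  `|x * stein z x - y * stein z y| <= (stein_bound + 2) * d * (1 + `|y|).
Proof.
move=> xyd.
have -> : x * stein z x - y * stein z y =
  (x - y) * stein z x + y * (stein z x - stein z y) by ring.
apply: (le_trans (ler_normD _ _)); rewrite !normrM (ger0_norm (stein_ge0 _ _)).
have L := stein_lipschitz z x y; have S := stein_le z x; have S0 := stein_ge0 z x.
have B := stein_bound_ge1.
have d0 : 0 <= d by exact: le_trans xyd.
apply: (@le_trans _ _ (d * stein_bound + `|y| * (2 * d))).
  apply: lerD; first exact: ler_pM.
  by rewrite ler_wpM2l// (le_trans L)// ler_wpM2l.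
have : 0 <= d * `|y| by rewrite mulr_ge0.
have : 0 <= d * `|y| * stein_bound by rewrite !mulr_ge0// (le_trans _ B).
nra.
Qed.

(** The Stein equation along a step from a to b, read at any point w of the step.
    A step that crosses z has an s strictly between 0 and 1, whence the shift of
    the threshold by the length of the step. *)
Lemma stein_increment z a b w K : K = (stein_bound + 2) * (b - a) * (1 + `|w|) ->
  a <= w <= b ->
  (b - a) * (w * stein z w - K + (w <= z - (b - a))%R%:R - Phi z)
    <= stein z b - stein z a <=
  (b - a) * (w * stein z w + K + (w <= z + (b - a))%R%:R - Phi z).
Proof.
move=> KE /andP[aw wb]; have ab := le_trans aw wb.
have [s [c [c' [/andP[s0 s1] sz zs [/andP[ac cb] /andP[ac' c'b]] ->]]]] :=
  stein_slope z ab.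
have cw : `|c - w| <= b - a by rewrite ler_norml; lra.
have c'w : `|c' - w| <= b - a by rewrite ler_norml; lra.
have := stein_mulr_near z cw; have := stein_mulr_near z c'w; rewrite -KE.
rewrite !ler_norml => /andP[h1 h2] /andP[h3 h4].
have hs : (w <= z - (b - a))%R%:R <= s :> R.
  by case: (leP w (z - (b - a))) => // wz; rewrite sz//; lra.
have hs' : s <= (w <= z + (b - a))%R%:R.
  by case: (leP w (z + (b - a))) => // wz; rewrite zs//; lra.
by apply/andP; split; rewrite ler_wpM2l ?subr_ge0//; nra.
Qed.

End stein_solution.

(** * Sums of independent Bernoulli variables *)

Section bernoulli_sum.
Context {R : realType}.
Implicit Types (s : seq R) (F G H : nat -> R) (l c : R).

(** The mean of F(W) for a sum W of independent Bernoulli variables of parameters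
    s, computed by conditioning on them one after the other. *)
Fixpoint bernoulli_mean s F : R :=
  if s is l :: s' then
    (1 - l) * bernoulli_mean s' F + l * bernoulli_mean s' (F \o S)
  else F 0%N.
Local Notation E := bernoulli_mean.

Definition probabilities s := all (fun l => 0 <= l <= 1) s.
Definition bernoulli_center s : R := \sum_(l <- s) l.
Definition bernoulli_var s : R := \sum_(l <- s) l * (1 - l).

Lemma bernoulli_meanD s F G : E s (fun k => F k + G k) = E s F + E s G.
Proof.
elim: s F G => [//|l s IH] F G /=.
rewrite IH (_ : _ \o S = fun k => (F \o S) k + (G \o S) k)// IH; ring.
Qed.

Lemma bernoulli_meanZ s c F : E s (fun k => c * F k) = c * E s F.
Proof.
elim: s F => [//|l s IH] F /=.
rewrite IH (_ : _ \o S = fun k => c * (F \o S) k)// IH; ring.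
Qed.

Lemma bernoulli_mean_cst s c : E s (fun=> c) = c.
Proof. by elim: s => [//|l s IH] /=; rewrite (_ : _ \o S = fun=> c)// IH; ring. Qed.

Lemma bernoulli_mean_le s F G : probabilities s -> (forall k, F k <= G k) ->
  E s F <= E s G.
Proof.
elim: s F G => [|l s IH] F G /=; first by move=> _; exact.
move=> /andP[/andP[l0 l1] ps] FG; apply: lerD; apply: ler_wpM2l => //.
- by rewrite subr_ge0.
- exact: IH.
- by apply: IH => // k; exact: FG.
Qed.

Lemma eq_bernoulli_mean s F G :
  (forall k, (k <= size s)%N -> F k = G k) -> E s F = E s G.
Proof.
elim: s F G => [|l s IH] F G /= FG; first exact: FG.
congr (_ * _ + _ * _); apply: IH => k ks; apply: FG => //.
exact: leq_trans ks _.
Qed.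

(** With W_i the sum without its i-th variable, E[(W - EW) F(W)] is the sum of the
    l_i (1 - l_i) E[F(W_i + 1) - F(W_i)]. W is one of the two ends W_i and W_i + 1,
    so a function H that bounds the increments at both ends replaces W_i by W. *)
Lemma bernoulli_mean_stein s F H : probabilities s ->
  (forall k, F k.+1 - F k <= H k /\ F k.+1 - F k <= H k.+1) ->
  E s (fun k => (k%:R - bernoulli_center s) * F k) <= bernoulli_var s * E s H.
Proof.
elim: s F H => [|l s IH] F H.
  by rewrite /bernoulli_center /bernoulli_var !big_nil/= subrr !mul0r.
move=> /[dup] pls /= /andP[/andP[l0 l1] ps] FH.
rewrite /bernoulli_center /bernoulli_var !big_cons.
rewrite -/(bernoulli_center s) -/(bernoulli_var s).
set m := bernoulli_center s; set v := bernoulli_var s.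
have -> : E s (fun k => (k%:R - (l + m)) * F k) =
    E s (fun k => (k%:R - m) * F k) - l * E s F.
  rewrite -[X in _ = _ - X]opprK -mulNr -bernoulli_meanZ opprK -bernoulli_meanD.
  by apply: eq_bernoulli_mean => k _; ring.
have -> : E s ((fun k => (k%:R - (l + m)) * F k) \o S) =
    E s (fun k => (k%:R - m) * (F \o S) k) + (1 - l) * E s (F \o S).
  rewrite -bernoulli_meanZ -bernoulli_meanD.
  by apply: eq_bernoulli_mean => k _ /=; rewrite -natr1; ring.
have h1 := IH F H ps FH.
have h2 := IH (F \o S) (H \o S) ps (fun k => FH k.+1).
have h3 : E s (F \o S) - E s F <= (1 - l) * E s H + l * E s (H \o S).
  rewrite -[X in _ - X]mul1r -mulNr -!bernoulli_meanZ -!bernoulli_meanD.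
  apply: bernoulli_mean_le => // k /=; have [] := FH k; nra.
have h4 := ler_wpM2l (mulr_ge0 l0 (_ : 0 <= 1 - l)) h3.
have {}h1 := ler_wpM2l (_ : 0 <= 1 - l) h1; have {}h2 := ler_wpM2l l0 h2.
have l1' : 0 <= 1 - l by rewrite subr_ge0.
move: (h4 l1') (h1 l1') h2; rewrite -/m -/v.
move: (E s H) (E s (H \o S)) (E s F) (E s (F \o S))
  (E s (fun k => (k%:R - m) * F k)) (E s (fun k => (k%:R - m) * (F \o S) k)).
by move=> a b c d e f; nra.
Qed.

Lemma bernoulli_mean_steinN s F H : probabilities s ->
  (forall k, H k <= F k.+1 - F k /\ H k.+1 <= F k.+1 - F k) ->
  bernoulli_var s * E s H <= E s (fun k => (k%:R - bernoulli_center s) * F k).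
Proof.
move=> ps FH.
have := @bernoulli_mean_stein s (fun k => - 1 * F k) (fun k => - 1 * H k) ps.
rewrite bernoulli_meanZ.
have -> : E s (fun k => (k%:R - bernoulli_center s) * (-1 * F k)) =
    - 1 * E s (fun k => (k%:R - bernoulli_center s) * F k).
  by rewrite -bernoulli_meanZ; apply: eq_bernoulli_mean => k _; ring.
rewrite !mulN1r mulrN lerN2; apply => k.
by have [] := FH k; rewrite !mulN1r; split; lra.
Qed.

Lemma bernoulli_mean_center s : E s (fun k => k%:R) = bernoulli_center s.
Proof.
elim: s => [|l s IH]; rewrite /bernoulli_center ?big_nil//= big_cons.
rewrite -/(bernoulli_center s) IH.
have -> : E s ((fun k => k%:R) \o S) = bernoulli_center s + 1.
  rewrite -IH -[X in _ = _ + X](bernoulli_mean_cst s) -bernoulli_meanD.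
  by apply: eq_bernoulli_mean => k _ /=; rewrite natr1.
ring.
Qed.

(** The increments of k - EW are 1, so H = 1 serves in both directions. *)
Lemma bernoulli_mean_var s : probabilities s ->
  E s (fun k => (k%:R - bernoulli_center s) ^+ 2) = bernoulli_var s.
Proof.
move=> ps; rewrite -[RHS]mulr1 -[X in _ = _ * X](bernoulli_mean_cst s).
apply/eqP; rewrite eq_le; apply/andP; split.
  apply: bernoulli_mean_stein => // k.
  by rewrite opprD opprK -natr1; split; lra.
apply: bernoulli_mean_steinN => // k.
by rewrite opprD opprK -natr1; split; lra.
Qed.

Definition bernoulli_std_cdf s r : R :=
  E s (fun k =>
    ((k%:R - bernoulli_center s) / Num.sqrt (bernoulli_var s) <= r)%R%:R).

Section berry_esseen.
Variables (s : seq R).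
Hypotheses (ps : probabilities s) (v0 : 0 < bernoulli_var s).
Let m := bernoulli_center s.
Let sigma := Num.sqrt (bernoulli_var s).
Let d := sigma^-1.
Let W k := (k%:R - m) / sigma.
Let C : R := stein_bound + 2.

Let sigma_gt0 : 0 < sigma. Proof. by rewrite sqrtr_gt0. Qed.
Let d_gt0 : 0 < d. Proof. by rewrite invr_gt0. Qed.
Let sigma2 : sigma ^+ 2 = bernoulli_var s. Proof. by rewrite sqr_sqrtr// ltW. Qed.
Let sigma2d x : sigma ^+ 2 * (d * x) = sigma * x.
Proof. by rewrite /d; field; rewrite gt_eqF. Qed.
Let C_ge0 : 0 <= C. Proof. by rewrite addr_ge0// (le_trans _ stein_bound_ge1). Qed.

Let W_step k : W k.+1 - W k = d.
Proof. by rewrite /W -mulrBl -natr1 /d; field; rewrite gt_eqF. Qed.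

(** 1 + |w| <= 2 + w^2, and E[W^2] = 1. *)
Let mean_norm_W : E s (fun k => 1 + `|W k|) <= 3.
Proof.
have -> : 3 = E s (fun k => 2 + W k ^+ 2) :> R.
  rewrite bernoulli_meanD bernoulli_mean_cst.
  suff -> : E s (fun k => W k ^+ 2) = 1 by rewrite natr1.
  have -> : (fun k => W k ^+ 2) = (fun k => sigma ^- 2 * (k%:R - m) ^+ 2).
    by apply/funext => k; rewrite /W expr_div_n mulrC.
  by rewrite bernoulli_meanZ bernoulli_mean_var// sigma2 mulVf// gt_eqF.
apply: bernoulli_mean_le => // k.
have := sqr_ge0 (`|W k| - 1); rewrite sqrrB1 real_normK ?num_real//.
by have := normr_ge0 (W k); lra.
Qed.

Let mean_Wf z : E s (fun k => (k%:R - m) * stein z (W k)) =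
  sigma * E s (fun k => W k * stein z (W k)).
Proof.
rewrite -bernoulli_meanZ; apply: eq_bernoulli_mean => k _.
by rewrite /W; field; rewrite gt_eqF.
Qed.

(** W moves by steps of length d = 1 / sigma. In the Stein equation the terms
    E[W f(W)] cancel against the left-hand side, and C d E[1 + |W|] <= 3 C d
    remains. *)
Lemma bernoulli_std_cdf_lower z :
  gauss_cdf z <= bernoulli_std_cdf s (z + d) + 3 * C * d.
Proof.
pose H k : R := d * (W k * stein z (W k) + C * d * (1 + `|W k|)
  + (W k <= z + d)%R%:R + - gauss_cdf z).
have FH k : stein z (W k.+1) - stein z (W k) <= H k /\
            stein z (W k.+1) - stein z (W k) <= H k.+1.
  have Wk : W k <= W k.+1 by rewrite -subr_ge0 W_step ltW.
  have w1 : W k <= W k <= W k.+1 by rewrite lexx.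
  have w2 : W k <= W k.+1 <= W k.+1 by rewrite lexx andbT.
  have /andP[_] := stein_increment z erefl w1.
  have /andP[_] := stein_increment z erefl w2.
  by rewrite W_step => h2 h1.
have := @bernoulli_mean_stein s (stein z \o W) H ps FH; rewrite /= mean_Wf.
rewrite /H bernoulli_meanZ !bernoulli_meanD bernoulli_mean_cst bernoulli_meanZ.
rewrite -sigma2 sigma2d ler_pM2l//.
have : C * d * E s (fun k => 1 + `|W k|) <= C * d * 3.
  by rewrite ler_wpM2l// mulr_ge0// ltW.
rewrite /bernoulli_std_cdf -/sigma -/m -/(W _); lra.
Qed.

Lemma bernoulli_std_cdf_upper z :
  bernoulli_std_cdf s (z - d) - 3 * C * d <= gauss_cdf z.
Proof.
pose H k : R := d * (W k * stein z (W k) + - (C * d) * (1 + `|W k|)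
  + (W k <= z - d)%R%:R + - gauss_cdf z).
have FH k : H k <= stein z (W k.+1) - stein z (W k) /\
            H k.+1 <= stein z (W k.+1) - stein z (W k).
  have Wk : W k <= W k.+1 by rewrite -subr_ge0 W_step ltW.
  have w1 : W k <= W k <= W k.+1 by rewrite lexx.
  have w2 : W k <= W k.+1 <= W k.+1 by rewrite lexx andbT.
  have /andP[+ _] := stein_increment z erefl w1.
  have /andP[+ _] := stein_increment z erefl w2.
  by rewrite W_step -!(mulNr (C * d)) => h2 h1.
have := @bernoulli_mean_steinN s (stein z \o W) H ps FH; rewrite /= mean_Wf.
rewrite /H bernoulli_meanZ !bernoulli_meanD bernoulli_mean_cst bernoulli_meanZ.
rewrite -sigma2 sigma2d ler_pM2l//.
have : C * d * E s (fun k => 1 + `|W k|) <= C * d * 3.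
  by rewrite ler_wpM2l// mulr_ge0// ltW.
rewrite /bernoulli_std_cdf -/sigma -/m -/(W _); lra.
Qed.

End berry_esseen.

Lemma bernoulli_clt (s : nat -> seq R) r :
  (forall n, probabilities (s n)) ->
  bernoulli_var (s n) @[n --> \oo] --> +oo ->
  bernoulli_std_cdf (s n) r @[n --> \oo] --> gauss_cdf r.
Proof.
move=> ps voo.
pose d n := (Num.sqrt (bernoulli_var (s n)))^-1.
have d0 : d n @[n --> \oo] --> (0 : R).
  apply/cvgrPdist_le => e e0.
  have : \forall n \near \oo, (e^-1) ^+ 2 <= bernoulli_var (s n).
    by move/cvgryPge : voo; apply.
  apply: filterS => n h.
  have v0 : 0 < bernoulli_var (s n).
    by apply: lt_le_trans h; rewrite exprn_gt0// invr_gt0.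
  rewrite sub0r normrN ger0_norm ?invr_ge0 ?sqrtr_ge0//.
  rewrite -[leRHS]invrK lef_pV2 ?posrE ?invr_gt0 ?sqrtr_gt0//.
  have eV0 : 0 <= e^-1 by rewrite invr_ge0 ltW.
  by rewrite -(ger0_norm eV0) -sqrtr_sqr ler_wsqrtr.
have vn0 : \forall n \near \oo, 0 < bernoulli_var (s n).
  by move/cvgryPgt : voo; apply.
have cPhi : {for r, continuous (@gauss_cdf R)}.
  apply: differentiable_continuous; apply/derivable1_diffP.
  exact: (@ex_derive _ _ _ _ _ _ _ (is_derive_gauss_cdf r)).
pose K : R := 3 * (stein_bound + 2).
have lo : gauss_cdf (r - d n) - K * d n @[n --> \oo] --> gauss_cdf r.
  rewrite -[X in _ --> X]subr0 -(mulr0 K); apply: cvgB; last first.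
    by apply: cvgM => //; exact: cvg_cst.
  apply: continuous_cvg => //; rewrite -[X in _ --> X]subr0; apply: cvgB => //.
  exact: cvg_cst.
have hi : gauss_cdf (r + d n) + K * d n @[n --> \oo] --> gauss_cdf r.
  rewrite -[X in _ --> X]addr0 -(mulr0 K); apply: cvgD; last first.
    by apply: cvgM => //; exact: cvg_cst.
  apply: continuous_cvg => //; rewrite -[X in _ --> X]addr0; apply: cvgD => //.
  exact: cvg_cst.
apply: squeeze_cvgr lo hi; near=> n.
have v0 : 0 < bernoulli_var (s n) by near: n.
have := bernoulli_std_cdf_lower (ps n) v0 (r - d n); rewrite subrK.
have := bernoulli_std_cdf_upper (ps n) v0 (r + d n); rewrite addrK.
by rewrite -/(d n) -/K; lra.
Unshelve. all: by end_near.
Qed.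

End bernoulli_sum.

(** * Variables with the generating function of a Bernoulli sum *)

Section bernoulli_generating_function.
Context {R : realType}.
Implicit Types (s : seq R) (F p : nat -> R).

Lemma bernoulli_mean_sum (I : Type) (r : seq I) s (F : I -> nat -> R) :
  bernoulli_mean s (fun j => \sum_(i <- r) F i j) =
  \sum_(i <- r) bernoulli_mean s (F i).
Proof.
elim: r => [|i r IH].
  rewrite big_nil -[RHS](bernoulli_mean_cst s); apply: eq_bernoulli_mean => k _.
  by rewrite big_nil.
rewrite big_cons -IH -bernoulli_meanD; apply: eq_bernoulli_mean => k _.
by rewrite big_cons.
Qed.

Lemma bernoulli_mean_support s F : bernoulli_mean s F =
  \sum_(k < (size s).+1) F k * bernoulli_mean s (fun j => (j == k)%:R).
Proof.
under eq_bigr do rewrite -bernoulli_meanZ.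
rewrite -bernoulli_mean_sum; apply: eq_bernoulli_mean => j js.
have j' : (j < (size s).+1)%N by [].
rewrite (bigD1 (Ordinal j'))//= eqxx mulr1 big1 ?addr0// => k.
by rewrite -val_eqE/= eq_sym => /negPf ->; exact: mulr0.
Qed.

Lemma bernoulli_mean_exp s (x : R) :
  bernoulli_mean s (fun k => x ^+ k) = \prod_(l <- s) (1 - l + l * x).
Proof.
elim: s => [|l s IH]; first by rewrite big_nil /= expr0.
rewrite big_cons /= -IH [RHS]mulrDl -mulrA -(bernoulli_meanZ s x).
congr (_ + l * _); by apply: eq_bernoulli_mean => k _; rewrite /= exprS.
Qed.

Lemma poly_sum_inj n p (q : nat -> R) :
  (forall x : R, \sum_(k < n) p k * x ^+ k = \sum_(k < n) q k * x ^+ k) ->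
  forall k, (k < n)%N -> p k = q k.
Proof.
move=> pq k kn.
suff /(congr1 (fun u : {poly R} => u`_k)) :
    \poly_(i < n) p i = \poly_(i < n) q i.
  by rewrite !coef_poly kn.
apply/eqP; rewrite -subr_eq0; apply/eqP.
apply: (@roots_geq_poly_eq0 _ _ [seq j%:R | j <- iota 0 n]).
- apply/allP => _ /mapP[j _ ->].
  by rewrite /root hornerD hornerN !horner_poly pq subrr.
- by rewrite map_inj_uniq ?iota_uniq// => i j /eqP; rewrite eqr_nat => /eqP.
- rewrite size_map size_iota; apply: leq_trans (size_polyD _ _) _.
  by rewrite size_polyN geq_max !size_poly.
Qed.

(** A generating function determines the weights. *)
Lemma bernoulli_mean_pgf s p :
  (forall x, \sum_(k < (size s).+1) p k * x ^+ k = \prod_(l <- s) (1 - l + l * x)) ->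
  forall F, \sum_(k < (size s).+1) F k * p k = bernoulli_mean s F.
Proof.
move=> pgf F; rewrite bernoulli_mean_support; apply: eq_bigr => k _.
congr (_ * _).
apply: (@poly_sum_inj (size s).+1 p
  (fun k => bernoulli_mean s (fun j => (j == k)%:R))) => // x.
rewrite pgf -bernoulli_mean_exp bernoulli_mean_support.
by apply: eq_bigr => j _; exact: mulrC.
Qed.

End bernoulli_generating_function.

Section counting_variable.
Context d (T : measurableType d) (R : realType) (P : probability T R).
Variables (X : {RV P >-> R}) (n : nat).
Hypothesis Xn : forall w, exists2 k, (k <= n)%N & X w = k%:R.

Lemma counting_variable_integral (F : R -> R) :
  (\int[P]_w (F (X w))%:E = (\sum_(k < n.+1) F k%:R * pmf X k%:R)%:E)%E.
Proof.
have mX k : measurable (X @^-1` [set k%:R : R]) by exact: measurable_funPTI.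
transitivity (\int[P]_w (\sum_(k < n.+1) (F k%:R)%:E *
    (\1_(X @^-1` [set k%:R]) w)%:E))%E.
  apply: eq_integral => w _.
  have [j jn Xw] := Xn w; rewrite Xw.
  have j' : (j < n.+1)%N by [].
  rewrite (bigD1 (Ordinal j'))//= big1 ?adde0.
    by rewrite indicE/= mem_set ?mule1.
  move=> k; rewrite -val_eqE/= => kj.
  rewrite indicE/= memNset ?mule0//= Xw => /eqP.
  by rewrite eqr_nat eq_sym; exact/negP.
rewrite integral_sum//; last first.
  by move=> k; apply: integrableZl => //; exact: integrable_indic.
rewrite -sumEFin; apply: eq_bigr => k _.
rewrite integralZl//; last exact: integrable_indic.
by rewrite integral_indic// setIT EFinM /pmf fineK// fin_num_measure.
Qed.

Variable s : seq R.
Hypotheses (ps : probabilities s) (ss : size s = n).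
Hypothesis pgf : forall x : R,
  \sum_(k < n.+1) pmf X k%:R * x ^+ k = \prod_(l <- s) (1 - l + l * x).

Lemma counting_variable_mean (F : R -> R) :
  (\int[P]_w (F (X w))%:E = (bernoulli_mean s (fun k => F k%:R))%:E)%E.
Proof.
rewrite counting_variable_integral; congr _%:E.
move: pgf; rewrite -ss => h.
exact: (@bernoulli_mean_pgf R s (fun k => pmf X k%:R) h (fun k => F k%:R)).
Qed.

Lemma counting_variable_expectation : ('E_P[X] = (bernoulli_center s)%:E)%E.
Proof.
by rewrite expectation_def (counting_variable_mean id) bernoulli_mean_center.
Qed.

Lemma counting_variable_variance : ('V_P[X] = (bernoulli_var s)%:E)%E.
Proof.
rewrite /variance unlock counting_variable_expectation unlock /=.
rewrite -bernoulli_mean_var//.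
exact: (counting_variable_mean (fun x => (x - bernoulli_center s) ^+ 2)).
Qed.

Lemma counting_variable_cdf r :
  cdf (standardized P X : {RV P >-> R}) r = (bernoulli_std_cdf s r)%:E.
Proof.
have := counting_variable_mean (fun x =>
  ((x - bernoulli_center s) / Num.sqrt (bernoulli_var s) <= r)%R%:R).
move=> /= <-; rewrite /cdf /distribution /pushforward.
rewrite -[X in P X]setIT -integral_indic//; last exact: measurable_funPTI.
apply: eq_integral => w _; rewrite indicE /=; congr ((nat_of_bool _)%:R%:E).
rewrite /standardized counting_variable_expectation counting_variable_variance.
by apply/idP/idP => [/set_mem|h]; [rewrite /= in_itv|apply/mem_set; rewrite /= in_itv].
Qed.

End counting_variable.

(** The mean, the variance and the distribution function of X n depend on its law
    only, which is that of the Bernoulli sum of parameters s n. *)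
Lemma counting_variable_clt (R : realType) (d : nat -> measure_display)
    (T : forall n, measurableType (d n)) (P : forall n, probability (T n) R)
    (X : forall n, {RV (P n) >-> R}) (s : nat -> seq R) :
  (forall n w, exists2 k, (k <= n)%N & X n w = k%:R) ->
  (forall n, probabilities (s n)) -> (forall n, size (s n) = n) ->
  (forall n (x : R), \sum_(k < n.+1) pmf (X n) k%:R * x ^+ k =
                     \prod_(l <- s n) (1 - l + l * x)) ->
  bernoulli_var (s n) @[n --> \oo] --> +oo ->
  cvg_in_distribution P (fun n => standardized (P n) (X n)) (normal_prob 0 1).
Proof.
move=> Xn ps ss pgf voo r _.
rewrite -[X in _ --> X]fineK ?fin_num_measure// -/(gauss_cdf r).
under eq_fun do rewrite (counting_variable_cdf (Xn _) (ps _) (ss _) (pgf _)).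
apply: cvg_EFin; first by apply: nearW.
exact: bernoulli_clt.
Qed.

(** * Complex integrals *)

Section complex_parts.
Context {R : realType}.
Implicit Types x y : R[i].

Lemma complex_ReD x y : complex.Re (x + y) = complex.Re x + complex.Re y.
Proof. by case: x y => [a b] [c d]. Qed.

Lemma complex_ImD x y : complex.Im (x + y) = complex.Im x + complex.Im y.
Proof. by case: x y => [a b] [c d]. Qed.

Lemma complex_ReM x y : complex.Re (x * y) =
  complex.Re x * complex.Re y - complex.Im x * complex.Im y.
Proof. by case: x y => [a b] [c d]. Qed.

Lemma complex_ImM x y : complex.Im (x * y) =
  complex.Re x * complex.Im y + complex.Im x * complex.Re y.
Proof. by case: x y => [a b] [c d]. Qed.

Lemma complexP x y : complex.Re x = complex.Re y -> complex.Im x = complex.Im y ->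
  x = y.
Proof. by case: x y => [a b] [c d] /= -> ->. Qed.

End complex_parts.

Section complex_integral.
Context d (T : measurableType d) (R : realType).
Variable mu : {measure set T -> \bar R}.
Implicit Types (f g : T -> R[i]) (c : R[i]).

Definition cintegrable f :=
  mu.-integrable setT (fun x => (complex.Re (f x))%:E) /\
  mu.-integrable setT (fun x => (complex.Im (f x))%:E).

Definition cintegral f : R[i] :=
  Complex (\int[mu]_x complex.Re (f x)) (\int[mu]_x complex.Im (f x)).

Lemma Re_cintegral f : complex.Re (cintegral f) = \int[mu]_x complex.Re (f x).
Proof. by []. Qed.

Lemma Im_cintegral f : complex.Im (cintegral f) = \int[mu]_x complex.Im (f x).
Proof. by []. Qed.

Lemma cintegrable0 : cintegrable (fun=> 0).
Proof. by split; exact: integrable0. Qed.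

Lemma cintegral0 : cintegral (fun=> 0) = 0.
Proof. by apply: complexP; rewrite /= /Rintegral integral0. Qed.

Lemma cintegrableD f g : cintegrable f -> cintegrable g ->
  cintegrable (fun x => f x + g x).
Proof.
move=> [fr fi] [gr gi]; split.
- under eq_fun do rewrite complex_ReD EFinD; exact: integrableD.
- under eq_fun do rewrite complex_ImD EFinD; exact: integrableD.
Qed.

Lemma cintegralD f g : cintegrable f -> cintegrable g ->
  cintegral (fun x => f x + g x) = cintegral f + cintegral g.
Proof.
move=> [fr fi] [gr gi]; apply: complexP; rewrite ?complex_ReD ?complex_ImD/=.
- under eq_Rintegral do rewrite complex_ReD; exact: RintegralD.
- under eq_Rintegral do rewrite complex_ImD; exact: RintegralD.
Qed.

Lemma cintegrableZ c f : cintegrable f -> cintegrable (fun x => c * f x).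
Proof.
case: c => a b [fr fi]; split.
- under eq_fun do rewrite complex_ReM/= EFinB !EFinM.
  by apply: integrableB => //; exact: integrableZl.
- under eq_fun do rewrite complex_ImM/= EFinD !EFinM.
  by apply: integrableD => //; exact: integrableZl.
Qed.

Let integrableZ_EFin (h : T -> R) k : mu.-integrable setT (EFin \o h) ->
  mu.-integrable setT (fun x => (k * h x)%:E).
Proof. by move=> ih; under eq_fun do rewrite EFinM; exact: integrableZl. Qed.

Lemma cintegralZ c f : cintegrable f ->
  cintegral (fun x => c * f x) = c * cintegral f.
Proof.
case: c => a b [fr fi]; apply: complexP; rewrite ?complex_ReM ?complex_ImM/=.
- under eq_Rintegral do rewrite complex_ReM/=.
  by rewrite RintegralB ?RintegralZl//; exact: integrableZ_EFin.
- under eq_Rintegral do rewrite complex_ImM/=.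
  by rewrite RintegralD ?RintegralZl//; exact: integrableZ_EFin.
Qed.

Lemma cintegrable_sum (I : Type) (r : seq I) (F : I -> T -> R[i]) :
  (forall i, cintegrable (F i)) -> cintegrable (fun x => \sum_(i <- r) F i x).
Proof.
move=> iF; elim: r => [|i r IH].
  by under eq_fun do rewrite big_nil; exact: cintegrable0.
by under eq_fun do rewrite big_cons; exact: cintegrableD.
Qed.

Lemma cintegral_sum (I : Type) (r : seq I) (F : I -> T -> R[i]) :
  (forall i, cintegrable (F i)) ->
  cintegral (fun x => \sum_(i <- r) F i x) = \sum_(i <- r) cintegral (F i).
Proof.
move=> iF; elim: r => [|i r IH].
  by under eq_fun do rewrite big_nil; rewrite big_nil cintegral0.
under eq_fun do rewrite big_cons.
by rewrite big_cons cintegralD ?IH//; exact: cintegrable_sum.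
Qed.

Lemma cintegrable_real (h : T -> R) : mu.-integrable setT (EFin \o h) ->
  cintegrable (fun x => (h x)%:C%C).
Proof. by move=> ih; split => //=; exact: integrable0. Qed.

Lemma cintegral_real (h : T -> R) :
  cintegral (fun x => (h x)%:C%C) = (\int[mu]_x h x)%:C%C.
Proof. by apply: complexP => //=; rewrite /Rintegral integral0. Qed.

Lemma cintegral_conj f : cintegrable f ->
  cintegral (fun x => (f x)^*%C) = (cintegral f)^*%C.
Proof.
move=> [fr fi]; apply: complexP => /=.
  by apply: eq_Rintegral => x _; case: (f x).
rewrite -mulN1r -RintegralZl//; apply: eq_Rintegral => x _.
by case: (f x) => a b /=; rewrite mulN1r.
Qed.

End complex_integral.

Section complex_integral_product.
Context d1 d2 (T1 : measurableType d1) (T2 : measurableType d2) (R : realType).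
Variables (m1 : {sigma_finite_measure set T1 -> \bar R}).
Variables (m2 : {sigma_finite_measure set T2 -> \bar R}).

Lemma integrable_tensor (f : T1 -> R) (g : T2 -> R) :
  m1.-integrable setT (EFin \o f) -> m2.-integrable setT (EFin \o g) ->
  (m1 \x m2)%E.-integrable setT (fun z => (f z.1 * g z.2)%:E).
Proof.
move=> /integrableP[mf f1] /integrableP[mg g1].
apply/integrable12ltyP.
  apply/measurable_EFinP; apply: measurable_funM.
    by apply: measurableT_comp => //; exact/measurable_EFinP.
  by apply: measurableT_comp => //; exact/measurable_EFinP.
under eq_integral => x _.
  under eq_integral do rewrite /= normrM EFinM.
  rewrite ge0_integralZl//=; last first.
    by apply/measurable_EFinP; apply: measurableT_comp => //; exact/measurable_EFinP.
  over.
rewrite ge0_integralZr//=.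
- by rewrite lte_mul_pinfty ?ge0_fin_numE ?integral_ge0.
- by apply/measurable_EFinP; apply: measurableT_comp => //; exact/measurable_EFinP.
- exact: integral_ge0.
Qed.

Lemma Rintegral_tensor (f : T1 -> R) (g : T2 -> R) :
  m1.-integrable setT (EFin \o f) -> m2.-integrable setT (EFin \o g) ->
  \int[(m1 \x m2)%E]_z (f z.1 * g z.2) = (\int[m1]_x f x) * (\int[m2]_y g y).
Proof.
move=> fi gi; rewrite /Rintegral -(integral12_prod_meas1 (integrable_tensor fi gi)).
transitivity (fine (\int[m1]_x ((f x)%:E * \int[m2]_y (g y)%:E))%E).
  congr fine; apply: eq_integral => x _; rewrite -integralZl// /fubini_F.
rewrite -(fineK (integrable_fin_num _ gi))// integralZr//=.
by rewrite -{1}(fineK (integrable_fin_num _ fi)).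
Qed.

Lemma cintegrable_tensor (f : T1 -> R[i]) (g : T2 -> R[i]) :
  cintegrable m1 f -> cintegrable m2 g ->
  cintegrable (m1 \x m2)%E (fun z => f z.1 * g z.2).
Proof.
move=> [fr fi] [gr gi]; split.
- under eq_fun do rewrite complex_ReM EFinB.
  by apply: integrableB => //; [exact: (integrable_tensor fr gr)|
    exact: (integrable_tensor fi gi)].
- under eq_fun do rewrite complex_ImM EFinD.
  by apply: integrableD => //; [exact: (integrable_tensor fr gi)|
    exact: (integrable_tensor fi gr)].
Qed.

Lemma cintegral_tensor (f : T1 -> R[i]) (g : T2 -> R[i]) :
  cintegrable m1 f -> cintegrable m2 g ->
  cintegral (m1 \x m2)%E (fun z => f z.1 * g z.2) = cintegral m1 f * cintegral m2 g.
Proof.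
move=> [fr fi] [gr gi].
apply: complexP; rewrite ?complex_ReM ?complex_ImM ?Re_cintegral ?Im_cintegral.
- under eq_Rintegral do rewrite complex_ReM.
  rewrite RintegralB//; [|exact: (integrable_tensor fr gr)|
    exact: (integrable_tensor fi gi)].
  by rewrite (Rintegral_tensor fr gr) (Rintegral_tensor fi gi).
- under eq_Rintegral do rewrite complex_ImM.
  rewrite RintegralD//; [|exact: (integrable_tensor fr gi)|
    exact: (integrable_tensor fi gr)].
  by rewrite (Rintegral_tensor fr gi) (Rintegral_tensor fi gr).
Qed.

End complex_integral_product.

Section complex_integral_tuple.
Context d (T : measurableType d) (R : realType).
Variable m : {sigma_finite_measure set T -> \bar R}.

(** tuple_measure is an image measure under cons_pair; the inverse map uncons_pair
    transports the measurability of f. *)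
Lemma integral_tuple_cons n (f : n.+1.-tuple T -> R) :
  (m \x tuple_measure m (n := n))%E.-integrable setT
    (fun x => (f (cons_pair x))%:E) ->
  (tuple_measure m (n := n.+1)).-integrable setT (EFin \o f) /\
  \int[tuple_measure m (n := n.+1)]_z f z =
  \int[(m \x tuple_measure m (n := n))%E]_x f (cons_pair x).
Proof.
move=> fi.
have mf : measurable_fun setT (EFin \o f).
  have -> : EFin \o f = (fun x => (f (cons_pair x))%:E) \o @uncons_pair _ T n.
    apply/funext => t /=; congr ((f _)%:E); apply: val_inj => /=.
    by rewrite /thead; case/tupleP: t => x t; rewrite tnth0.
  apply: measurableT_comp; first by case/integrableP : fi.
  exact: measurable_uncons_pair.
have mc := @measurable_cons_pair _ T n.
split.
  exact: (@integrable_pushforward _ _ _ _ _ _ mc _ setT (EFin \o f) mf fi).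
congr fine.
exact: (@integral_pushforward _ _ _ _ _ _ mc _ setT (EFin \o f) mf fi).
Qed.

Lemma cintegral_tuple_cons n (f : n.+1.-tuple T -> R[i]) :
  cintegrable (m \x tuple_measure m (n := n))%E (f \o @cons_pair _ T n) ->
  cintegrable (tuple_measure m (n := n.+1)) f /\
  cintegral (tuple_measure m (n := n.+1)) f =
  cintegral (m \x tuple_measure m (n := n))%E (f \o @cons_pair _ T n).
Proof.
move=> [cr ci].
have [fr er] := @integral_tuple_cons n (fun z => complex.Re (f z)) cr.
have [fi ei] := @integral_tuple_cons n (fun z => complex.Im (f z)) ci.
by split => //; apply: complexP; rewrite ?Re_cintegral ?Im_cintegral.
Qed.

Lemma cintegral_prod_tuple n (g : 'I_n -> T -> R[i]) :
  (forall i, cintegrable m (g i)) ->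
  cintegrable (tuple_measure m (n := n)) (fun z => \prod_i g i (tnth z i)) /\
  cintegral (tuple_measure m (n := n)) (fun z => \prod_i g i (tnth z i)) =
  \prod_i cintegral m (g i).
Proof.
elim: n g => [|n IH] g gi.
  under eq_fun do rewrite big_ord0.
  split.
    apply: (cintegrable_real (h := fun=> 1)); apply/integrableP; split => //=.
      exact: measurable_cst.
    by rewrite integral_cst//= normr1 diracE in_setT mule1 ltry.
  rewrite big_ord0 (cintegral_real _ (fun=> 1)) /Rintegral.
  by rewrite integral_cst//= indicT mul1r.
have [fi e] := IH (fun i => g (lift ord0 i)) (fun i => gi _).
have E : (fun z : n.+1.-tuple T => \prod_i g i (tnth z i)) \o @cons_pair _ T n =
    (fun x => g ord0 x.1 * (\prod_i g (lift ord0 i) (tnth x.2 i))).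
  apply/funext => -[x t] /=; rewrite big_ord_recl /=; congr (_ * _).
  by apply: eq_bigr => i _; rewrite /cons_pair/= tnthS.
have [|ii ->] := @cintegral_tuple_cons n (fun z => \prod_i g i (tnth z i)).
  rewrite E; exact: (cintegrable_tensor (gi ord0) fi).
split => //; rewrite E (cintegral_tensor (gi ord0) fi) e big_ord_recl.
by [].
Qed.

End complex_integral_tuple.

(** * The identity of Andreief *)

Section andreief.
Context d (T : measurableType d) (R : realType).
Variable m : {sigma_finite_measure set T -> \bar R}.

(** For fixed s, the change of index t -> s * t makes the sum over t the Leibniz
    expansion of det G, whatever s. *)
Lemma sum_perm_det (K : comNzRingType) n (G : 'M[K]_n) :
  \sum_(s : 'S_n) \sum_(t : 'S_n) (-1) ^+ s * (-1) ^+ t * \prod_i G (s i) (t i)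
  = n`!%:R * \det G.
Proof.
transitivity (\sum_(s : 'S_n) \det G); last first.
  by rewrite sumr_const card_Sn mulr_natl.
apply: eq_bigr => s _; rewrite /determinant.
rewrite (reindex_inj (mulgI s))/=; apply: eq_bigr => t _.
rewrite odd_permM signr_addb mulrA -signr_addb addbb mul1r; congr (_ * _).
rewrite [RHS](reindex_inj (@perm_inj _ s))/=.
by apply: eq_bigr => i _; rewrite permM.
Qed.

(** Both determinants are expanded over permutations; each term is a product over
    the coordinates, which integrates factor by factor. *)
Lemma andreief n (f : 'I_n -> T -> R[i]) (u : T -> R[i]) :
  (forall j k, cintegrable m (fun z => f j z * (f k z)^*%C * u z)) ->
  let D z := \det (\matrix_(i < n, j < n) f j (tnth z i)) in
  let F z := D z * (D z)^*%C * \prod_i u (tnth z i) in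
  cintegrable (tuple_measure m (n := n)) F /\
  cintegral (tuple_measure m (n := n)) F = n`!%:R *
    \det (\matrix_(j < n, k < n) cintegral m (fun z => f j z * (f k z)^*%C * u z)).
Proof.
move=> fi D F.
pose P (s t : 'S_n) z :=
  \prod_i (f (s i) (tnth z i) * (f (t i) (tnth z i))^*%C * u (tnth z i)).
have FE : F = fun z => \sum_(s : 'S_n) \sum_(t : 'S_n)
    (-1) ^+ s * (-1) ^+ t * P s t z.
  apply/funext => z; rewrite /F.
  have -> : (D z)^*%C = \sum_(t : 'S_n) (-1) ^+ t * \prod_i (f (t i) (tnth z i))^*%C.
    rewrite /D /determinant rmorph_sum; apply: eq_bigr => t _.
    rewrite rmorphM rmorph_sign rmorph_prod; congr (_ * _).
    by apply: eq_bigr => i _; rewrite mxE.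
  rewrite /D /determinant big_distrlr mulr_suml; apply: eq_bigr => s _.
  rewrite mulr_suml; apply: eq_bigr => t _; rewrite /P !big_split/=.
  rewrite (eq_bigr (fun i => f (s i) (tnth z i))); last by move=> i _; rewrite mxE.
  rewrite mulrACA -!mulrA; congr (_ * (_ * _)).
have Pi (s t : 'S_n) := cintegral_prod_tuple
  (g := fun i z => f (s i) z * (f (t i) z)^*%C * u z) (fun i => fi _ _).
have iP (s t : 'S_n) : cintegrable (tuple_measure m (n := n))
    (fun z => (-1) ^+ s * (-1) ^+ t * P s t z).
  by apply: cintegrableZ; have [] := Pi s t.
rewrite FE; split.
  by apply: cintegrable_sum => s; apply: cintegrable_sum => t.
rewrite cintegral_sum; last by move=> s; exact: cintegrable_sum.
rewrite -sum_perm_det; apply: eq_bigr => s _.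
rewrite cintegral_sum//; apply: eq_bigr => t _.
have [? e] := Pi s t.
rewrite cintegralZ//; congr (_ * _).
by rewrite [LHS]e; apply: eq_bigr => i _; rewrite mxE.
Qed.

End andreief.

(** * Spectrum of a Hermitian contraction *)

Section contraction_spectrum.
Context {R : realType}.
Local Open Scope sesquilinear_scope.

Lemma real_of_complex_between (z : R[i]) : 0 <= z <= 1 ->
  z = (complex.Re z)%:C%C /\ 0 <= complex.Re z <= 1.
Proof.
rewrite !lecE /= => /andP[/andP[/eqP iz r0] /andP[_ r1]].
by rewrite r0 r1; split => //; apply: complexP.
Qed.

(** M is diagonal in an orthonormal basis, and the bounds of the quadratic form on
    the basis vectors are bounds of the eigenvalues. *)
Lemma contraction_spectrum n (M : 'M[R[i]]_n) : M ^t* = M ->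
  (forall v : 'rV_n, 0 <= (v *m M *m v ^t*) 0 0 <= (v *m v ^t*) 0 0) ->
  exists s : seq R, [/\ size s = n, probabilities s,
    forall x : R, \det (1%:M + (x - 1)%:C%C *: M) =
      (\prod_(l <- s) (1 - l + l * x))%:C%C &
    (bernoulli_var s)%:C%C = \tr M - \tr (M *m M)].
Proof.
move=> Mh Mc.
have Mn : M \is normalmx by apply/normalmxP; rewrite Mh.
have ME := orthomx_spectralP Mn.
set P := spectralmx M in ME; set D := spectral_diag M in ME.
have Pu : P \is unitarymx by exact: spectral_unitarymx.
have Pi : P \in unitmx by exact: spectral_unit.
have PM : P *m M *m P ^t* = diag_mx D.
  by rewrite {1}ME -invmx_unitary// !mulmxA mulmxV// mul1mx mulmxK.
have Dc i : 0 <= D 0 i <= 1.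
  have := Mc (row i P).
  have e A : (row i P *m A *m (row i P) ^t*) 0 0 = (P *m A *m P ^t*) i i.
    rewrite -!row_mul !mxE; apply: eq_bigr => j _; rewrite !mxE; congr (_ * _).
  rewrite e -[X in _ <= (X *m _) 0 0]mulmx1 e PM mulmx1 (unitarymxP Pu).
  by rewrite !mxE eqxx !mulr1n.
pose l i := complex.Re (D 0 i).
have Dl i : D 0 i = (l i)%:C%C by have [] := real_of_complex_between (Dc i).
exists [seq l i | i <- enum 'I_n]; split.
- by rewrite size_map size_enum_ord.
- by apply/allP => _ /mapP[i _ ->]; have [] := real_of_complex_between (Dc i).
- move=> x; rewrite big_map big_enum /=.
  have -> : 1%:M + (x - 1)%:C%C *: M =
      invmx P *m diag_mx (\row_i (1 - l i + l i * x)%:C%C) *m P.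
    have -> : diag_mx (\row_i (1 - l i + l i * x)%:C%C) =
        1%:M + (x - 1)%:C%C *: diag_mx D.
      apply/matrixP => i j; rewrite !mxE; case: eqVneq => [->|_].
        rewrite !mulr1n Dl -(rmorph1 (real_complex R)) -rmorphM -rmorphD.
        by congr (_%:C%C); ring.
      by rewrite !mulr0n mulr0 addr0.
    rewrite mulmxDr mulmxDl mulmx1 mulVmx// -scalemxAr -scalemxAl.
    by rewrite -ME.
  rewrite !det_mulmx mulrAC -det_mulmx mulVmx// det1 mul1r det_diag.
  by rewrite rmorph_prod; apply: eq_bigr => i _; rewrite mxE.
- rewrite /bernoulli_var big_map big_enum /=.
  have trD (A : 'M[R[i]]_n) : \tr (invmx P *m A *m P) = \tr A.
    by rewrite mxtrace_mulC mulKVmx.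
  have -> : M *m M = invmx P *m (diag_mx D *m diag_mx D) *m P.
    by rewrite {1 2}ME !mulmxA mulmxK.
  rewrite {1}ME !trD mulmx_diag !mxtrace_diag -sumrB rmorph_sum.
  apply: eq_bigr => i _; rewrite mxE Dl -rmorphM -rmorphB.
  by congr (_%:C%C); ring.
Qed.

End contraction_spectrum.

(** * Densities and changes of variable on the line *)

Section measure_with_density.
Context d (T : measurableType d) (R : realType).
Variables (mu : {measure set T -> \bar R}) (w : T -> R).
Hypotheses (mw : measurable_fun [set: T] w) (w0 : forall x, 0 <= w x).

(** The two properties of w are arguments so that the structure of measure can be
    attached to the function. *)
Definition density_measure of measurable_fun [set: T] w & (forall x, 0 <= w x) :
  set T -> \bar R := fun A => (\int[mu]_(x in A) (w x)%:E)%E.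

Let nu := density_measure mw w0.

Let nu0 : nu set0 = 0%E. Proof. exact: integral_set0. Qed.
Let nu_ge0 A : (0 <= nu A)%E. Proof. exact: density_ge0. Qed.
Let nu_sigma_additive : semi_sigma_additive nu.
Proof. exact: density_semi_sigma_additive. Qed.

HB.instance Definition _ := isMeasure.Build _ _ _ nu nu0 nu_ge0 nu_sigma_additive.

End measure_with_density.

Section integral_density.
Import HBNNSimple.
Local Open Scope ereal_scope.
Context d (T : measurableType d) (R : realType).
Variables (mu nu : {measure set T -> \bar R}) (w : T -> R).
Hypotheses (mw : measurable_fun [set: T] w) (w0 : forall x, (0 <= w x)%R).
Hypothesis nuE : forall A, measurable A -> nu A = \int[mu]_(x in A) (w x)%:E.

Let integral_density_indic (A : set T) : measurable A ->
  \int[nu]_x (\1_A x)%:E = \int[mu]_x ((\1_A x)%:E * (w x)%:E).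
Proof.
move=> mA; rewrite integral_indic// setIT nuE// integral_mkcond.
apply: eq_integral => x _; rewrite patchE indicE.
by case: ifP => xA; rewrite ?mul1e ?mul0e.
Qed.

Let integral_density_nnsfun (h : {nnsfun T >-> R}) :
  \int[nu]_x (h x)%:E = \int[mu]_x ((h x)%:E * (w x)%:E).
Proof.
under eq_integral do rewrite fimfunE -fsumEFin//.
rewrite ge0_integral_fsum//; last 2 first.
- by move=> r; exact/measurable_EFinP/measurableT_comp.
- by move=> n x _; rewrite EFinM nnfun_muleindic_ge0.
under [RHS]eq_integral => x _.
  rewrite fimfunE -fsumEFin// ge0_mule_fsuml; last first.
    by move=> r; rewrite EFinM nnfun_muleindic_ge0.
  over.
rewrite [RHS]ge0_integral_fsum//; last 2 first.
- move=> r; apply: emeasurable_funM => //; last exact/measurable_EFinP.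
  exact/measurable_EFinP/measurableT_comp.
- move=> n x _; rewrite mule_ge0// ?[X in (_ <= X)%E]EFinM.
    exact: nnfun_muleindic_ge0.
  by rewrite lee_fin.
apply: eq_fsbigr => r rh; rewrite integralZl_indic_nnsfun//.
rewrite integral_density_indic//.
under [RHS]eq_integral do rewrite EFinM -muleA.
have [r0|r0] := leP 0%R r.
  rewrite [RHS]ge0_integralZl//.
  apply: emeasurable_funM; last exact/measurable_EFinP.
  exact/measurable_EFinP.
  by move=> x _; rewrite mule_ge0// lee_fin.
rewrite preimage_nnfun0// !integral0_eq ?mule0// => x _;
  by rewrite indic0 mul0e ?mule0.
Qed.

(** True for indicators by nuE, then for simple functions, then for their monotone
    limits. *)
Lemma ge0_integral_density (f : T -> \bar R) :
  measurable_fun [set: T] f -> (forall x, 0 <= f x) ->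
  \int[nu]_x f x = \int[mu]_x (f x * (w x)%:E).
Proof.
move=> mf f0; pose f_ := nnsfun_approx measurableT mf.
transitivity (limn (fun n => \int[nu]_x (f_ n x)%:E)).
  rewrite -monotone_convergence//=.
  - apply: eq_integral => x _; apply/esym/cvg_lim => //=.
    exact: cvg_nnsfun_approx.
  - by move=> n; exact/measurable_EFinP/measurable_funTS.
  - by move=> n x _; rewrite lee_fin.
  - by move=> x _ a b ab; rewrite lee_fin; exact/lefP/nd_nnsfun_approx.
transitivity (limn (fun n => \int[mu]_x ((f_ n x)%:E * (w x)%:E))).
  by apply: congr_lim; apply/funext => n; exact: integral_density_nnsfun.
rewrite -monotone_convergence//=.
- apply: eq_integral => x _; apply/cvg_lim => //=.
  by apply: cvgeZr => //; exact: cvg_nnsfun_approx.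
- move=> n; apply: emeasurable_funM; last exact/measurable_EFinP.
  exact/measurable_EFinP/measurable_funTS.
- by move=> n x _; rewrite mule_ge0// lee_fin.
- move=> x _ a b ab; rewrite lee_wpmul2r ?lee_fin//.
  exact/lefP/nd_nnsfun_approx.
Qed.

End integral_density.

Section change_of_variable_line.
Local Open Scope ereal_scope.
Context {R : realType}.
Local Notation mu := (@lebesgue_measure R).

(** The image under u of the measure of density w gives intervals their length, so
    it is the Lebesgue measure. Where w vanishes, u is arbitrary. *)
Lemma ge0_change_of_variable (u w : R -> R) (g : R -> \bar R) :
  measurable_fun [set: R] u -> measurable_fun [set: R] w ->
  (forall x, (0 <= w x)%R) ->
  (forall a b, (a < b)%R ->
    \int[mu]_(x in u @^-1` `]a, b]%classic) (w x)%:E = (b - a)%:E) ->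
  measurable_fun [set: R] g -> (forall x, 0 <= g x) ->
  \int[mu]_y g y = \int[mu]_x (g (u x) * (w x)%:E).
Proof.
move=> mu_ mw w0 H mg g0.
pose nu : {measure set (measurableTypeR R) -> \bar R} := density_measure mu mw w0.
have mu' : measurable_fun [set: measurableTypeR R] (u : measurableTypeR R -> measurableTypeR R) := mu_.
pose kappa := measure_function_pushforward__canonical__measure_function_Measure nu mu'.
have E A : measurable A -> mu A = kappa A.
  apply: lebesgue_measure_unique => _ [[a b] _ <-] /=.
  rewrite /pushforward /nu /density_measure.
  have [ab|ba] := ltP a b.
    by rewrite H// lebesgue_measure_itv/= lte_fin ab EFinB.
  rewrite set_itv_ge ?bnd_simp -?leNgt// preimage_set0 integral_set0.
  by rewrite measure0.
transitivity (\int[kappa]_y g y).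
  by apply: eq_measure_integral => A mA _; exact: E.
rewrite /kappa/= (@ge0_integral_pushforward _ _ _ _ _ _ mu')//=.
by rewrite preimage_setT (@ge0_integral_density _ _ _ mu nu w)//; exact: measurableT_comp.
Qed.

End change_of_variable_line.

Section line_substitutions.
Local Open Scope ereal_scope.
Context {R : realType}.
Local Notation mu := (@lebesgue_measure R).
Implicit Types (g : R -> \bar R).

Lemma ge0_integral_scale (c : R) g : c != 0%R ->
  measurable_fun [set: R] g -> (forall x, 0 <= g x) ->
  \int[mu]_y g y = \int[mu]_x (g (c * x)%R * `|c|%:E).
Proof.
move=> c0 mg g0.
apply: (@ge0_change_of_variable R (fun x => c * x)%R (fun=> `|c|%R)) => //.
  exact: measurable_funM.
move=> a b ab; rewrite integral_cst; last first.
  rewrite -[X in measurable X]setTI; apply: measurable_funM => //.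
move: c0; rewrite neq_lt => /orP[c0|c0].
- have -> : (fun x => c * x)%R @^-1` `]a, b]%classic = `[(b / c)%R, (a / c)%R[%classic :> set R.
    apply/seteqP; split => x /=; rewrite !in_itv/= => /andP[h1 h2].
      by rewrite ler_ndivrMr// mulrC h2 ltr_ndivlMr// mulrC.
    by rewrite mulrC -ltr_ndivlMr// h2 -ler_ndivrMr.
  rewrite [X in _ * X]lebesgue_measure_itv/= lte_fin ltr_nM2r ?invr_lt0// ab -EFinB -EFinM.
  by rewrite -mulrBl ltr0_norm//; congr (_%:E); field; rewrite lt_eqF.
- have -> : (fun x => c * x)%R @^-1` `]a, b]%classic = `](a / c)%R, (b / c)%R]%classic :> set R.
    apply/seteqP; split => x /=; rewrite !in_itv/= => /andP[h1 h2].
      by rewrite ltr_pdivrMr// mulrC h1 ler_pdivlMr// mulrC.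
    by rewrite mulrC -ltr_pdivrMr// h1 -ler_pdivlMr.
  rewrite [X in _ * X]lebesgue_measure_itv/= lte_fin ltr_pM2r ?invr_gt0// ab -EFinB -EFinM.
  by rewrite -mulrBl gtr0_norm//; congr (_%:E); field; rewrite gt_eqF.
Qed.

Definition half_turn (x : R) : bool := (- (pi / 2) < x < pi / 2)%R.

Lemma measurable_half_turn : measurable_fun [set: R] half_turn.
Proof. by apply: measurable_and; apply: measurable_fun_ltr. Qed.

Lemma measurable_inv : measurable_fun [set: R] (fun x : R => x^-1)%R.
Proof.
have -> : (fun x : R => x^-1)%R = (fun x => x * (x ^+ 2) `^ (-1))%R.
  apply/funext => x; rewrite powR_inv1 ?sqr_ge0//.
  by have [->|x0] := eqVneq x 0%R; [rewrite invr0 mul0r|field].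
apply: measurable_funM => //; apply: (measurableT_comp (measurable_powR _)).
exact: measurable_funX.
Qed.

Lemma measurable_cos : measurable_fun [set: R] (@cos R).
Proof. by apply: continuous_measurable_fun; exact: continuous_cos. Qed.

Lemma measurable_sin : measurable_fun [set: R] (@sin R).
Proof. by apply: continuous_measurable_fun; exact: continuous_sin. Qed.

Lemma measurable_tan : measurable_fun [set: R] (@tan R).
Proof.
apply: measurable_funM; first exact: measurable_sin.
exact: (measurableT_comp measurable_inv measurable_cos).
Qed.

Lemma ge0_integral_tan g :
  measurable_fun [set: R] g -> (forall x, 0 <= g x) ->
  \int[mu]_y g y =
  \int[mu]_x (g (tan x) * (if half_turn x then ((cos x) ^- 2)%R else 0%R)%:E).
Proof.
apply: ge0_change_of_variable.
- exact: measurable_tan.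
- apply: measurable_fun_ifT => //; first exact: measurable_half_turn.
  apply: (measurableT_comp measurable_inv).
  by apply: measurable_funX; exact: measurable_cos.
- by move=> x; case: ifP => // _; rewrite invr_ge0 sqr_ge0.
move=> a b ab.
have atI (x : R) : half_turn (atan x) by rewrite /half_turn atan_gtNpi2 atan_ltpi2.
have cos_neq0 (x : R) : half_turn x -> cos x != 0%R.
  by move=> hx; rewrite gt_eqF// cos_gt0_pihalf.
have ab' : (atan a < atan b)%R by exact: lt_atan.
have cc x : x \in `[atan a, atan b] -> half_turn x.
  rewrite in_itv/= => /andP[ax xb]; rewrite /half_turn.
  by rewrite (lt_le_trans (atan_gtNpi2 a) ax) (le_lt_trans xb (atan_ltpi2 b)).
have cF : {within `[atan a, atan b], continuous (fun x : R => (cos x) ^- 2)%R}.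
  apply: continuous_in_subspaceT => x /set_mem/= /cc /cos_neq0 x0.
  apply: cvgV; first by rewrite expf_neq0.
  apply: (@cvg_comp _ _ _ (@cos R) (fun y => y ^+ 2)%R); first exact: continuous_cos.
  exact: exprn_continuous.
transitivity (\int[mu]_(x in `[atan a, atan b]) ((cos x) ^- 2)%:E).
  rewrite -integral_itv_obnd_cbnd; last first.
    apply/measurable_EFinP; apply: measurable_funTS.
    apply: (measurableT_comp measurable_inv).
    by apply: measurable_funX; exact: measurable_cos.
  rewrite integral_mkcond [RHS]integral_mkcond; apply: eq_integral => x _.
  have e1 : (x \in (@tan R) @^-1` `]a, b]%classic) = (a < tan x <= b)%R.
    by apply/idP/idP => [/set_mem|h]; [rewrite /= in_itv|apply/mem_set; rewrite /= in_itv].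
  have e2 : (x \in `]atan a, atan b]%classic) = (atan a < x <= atan b)%R.
    by apply/idP/idP => [/set_mem|h]; [rewrite /= in_itv|apply/mem_set; rewrite /= in_itv].
  have hI z : half_turn z -> z \in `](- (pi / 2))%R, (pi / 2)%R[ by rewrite in_itv.
  rewrite !patchE e1 e2; have [hx|hx] := boolP (half_turn x).
    congr (if _ then _ else _); rewrite -{1}(atanK a) -{1}(atanK b).
    by rewrite ltr_tan ?hI ?atI// leNgt ltr_tan ?hI ?atI// -leNgt.
  rewrite if_same; case: ifPn => // /andP[ax xb]; move: hx.
  by rewrite cc// in_itv/= (ltW ax).
rewrite (@continuous_FTC2 _ _ (@tan R) _ _ ab' cF); last 2 first.
- split.
  + move=> x xI; apply: derivable_tan; apply: cos_neq0; apply: cc.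
    exact: subset_itv_oo_cc.
  + apply: cvg_at_right_filter; apply: continuous_tan; exact/cos_neq0/atI.
  + apply: cvg_at_left_filter; apply: continuous_tan; exact/cos_neq0/atI.
- move=> x xI; rewrite derive1E; have x0 : cos x != 0%R.
    by apply: cos_neq0; apply: cc; exact: subset_itv_oo_cc.
  by have [_ ->] := is_derive_tan x0.
by rewrite !atanK EFinB.
Qed.

End line_substitutions.

(** * Polar coordinates *)

Section polar_coordinates.
Local Open Scope ereal_scope.
Context {R : realType}.
Local Notation mu := (@lebesgue_measure R).

Definition polar (p : plane R) : plane R := (p.1 * cos p.2, p.1 * sin p.2)%R.

Lemma measurable_polar : measurable_fun [set: plane R] polar.
Proof.
apply: measurable_fun_pair; apply: measurable_funM => //.
  exact: (measurableT_comp (@measurable_cos R)).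
exact: (measurableT_comp (@measurable_sin R)).
Qed.

Let w (t : R) : R := if half_turn t then ((cos t) ^- 2)%R else 0%R.

Let w_ge0 t : (0 <= w t)%R.
Proof. by rewrite /w; case: ifP => // _; rewrite invr_ge0 sqr_ge0. Qed.

Let mw : measurable_fun [set: R] w.
Proof.
apply: measurable_fun_ifT => //; first exact: measurable_half_turn.
apply: (measurableT_comp measurable_inv).
by apply: measurable_funX; exact: measurable_cos.
Qed.

(** At x != 0 fixed, substitute y = x t and then t = tan u; once the integrals are
    exchanged, substitute x = r cos u. The lines through 0 are described by the
    angles of half a turn and a radius r of any sign. *)
Lemma ge0_integral_polar_half (f : plane R -> \bar R) :
  measurable_fun [set: plane R] f -> (forall z, 0 <= f z) ->
  \int[lebesgue_plane R]_z f z =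
  \int[mu]_t \int[mu]_r
    (f (polar (r, t)) * (if half_turn t then `|r|%R else 0%R)%:E).
Proof.
move=> mf f0.
have mxy (u v : plane R -> R) : measurable_fun [set: plane R] u ->
    measurable_fun [set: plane R] v ->
    measurable_fun [set: plane R] (fun p => f (u p, v p)).
  move=> mu_ mv; apply: (measurableT_comp mf).
  exact: (measurable_fun_pair (f := u : _ -> measurableTypeR R)
    (g := v : _ -> measurableTypeR R)).
pose h (p : plane R) := f (p.1, p.1 * tan p.2)%R * `|p.1|%:E * (w p.2)%:E.
have h0 p : 0 <= h p by rewrite /h !mule_ge0// lee_fin.
have mh : measurable_fun [set: plane R] h.
  apply: emeasurable_funM; last first.
    by apply/measurable_EFinP; exact: (measurableT_comp mw).
  apply: emeasurable_funM; last by apply/measurable_EFinP; exact: measurableT_comp.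
  apply: mxy => //; apply: measurable_funM => //.
  exact: (measurableT_comp (@measurable_tan R)).
rewrite /lebesgue_plane (fubini_tonelli1 f)//.
transitivity (\int[mu]_x \int[mu]_t h (x, t)).
  apply: ge0_ae_eq_integral => //.
  - exact: (measurable_fun_fubini_tonelli_F f).
  - exact: (measurable_fun_fubini_tonelli_F h).
  - by move=> x _; apply: integral_ge0.
  - by move=> x _; apply: integral_ge0.
  exists [set 0%R]; split => //; first exact: lebesgue_measure_set1.
  move=> x /= H; apply: contrapT => x0; apply: H => _.
  have {}x0 : x != 0%R by apply/eqP.
  have mfx : measurable_fun [set: R] (fun y => f (x, y)).
    exact: (measurableT_comp mf (measurable_pair1 x)).
  rewrite /fubini_F (ge0_integral_scale x0 mfx)// ge0_integral_tan//.
    apply: emeasurable_funM => //; apply: (measurableT_comp mfx).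
    exact: measurable_funM.
  by move=> y; rewrite mule_ge0// lee_fin.
transitivity (\int[mu]_t \int[mu]_x h (x, t)).
  exact: (fubini_tonelli h mh h0).
apply: eq_integral => t _.
rewrite /h /w /polar /=.
have [ht|_] := ifPn.
  have c0 : (0 < cos t)%R by exact: cos_gt0_pihalf.
  rewrite (ge0_integral_scale (lt0r_neq0 c0)).
  - apply: eq_integral => r _; rewrite -!muleA; congr (f (_, _) * _).
    + exact: mulrC.
    + by rewrite /tan; field; rewrite gt_eqF.
    + rewrite -!EFinM; congr (_%:E); rewrite normrM !(gtr0_norm c0).
      by field; rewrite gt_eqF.
  - apply: emeasurable_funM => //; apply: emeasurable_funM.
      apply: (measurableT_comp mf); apply: (measurable_fun_pair
        (f := id : _ -> measurableTypeR R)
        (g := (fun r => r * tan t)%R : _ -> measurableTypeR R)) => //.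
      exact: measurable_funM.
    by apply/measurable_EFinP; exact: normr_measurable.
  - move=> x; apply: mule_ge0; first by apply: mule_ge0; rewrite ?lee_fin.
    by rewrite lee_fin invr_ge0 sqr_ge0.
by transitivity (0 : \bar R); [|symmetry]; apply: integral0_eq => r _; exact: mule0.
Qed.

Definition positive_part_weight (r : R) : R := if (0 < r)%R then r else 0%R.
Local Notation pos := positive_part_weight.

(** The angles of ]-pi, 0[ and ]0, pi[; the missing ones form a null set. *)
Definition upper_angle (t : R) : R := if (0 < t < pi)%R then 1%R else 0%R.
Definition angle (t : R) : R := (upper_angle t + upper_angle (t + pi))%R.

Definition polar_weight (p : plane R) : R := (pos p.1 * angle p.2)%R.

Let pos_ge0 r : (0 <= pos r)%R.
Proof. by rewrite /pos; case: ifP => // /ltW. Qed.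

Lemma measurable_pos : measurable_fun [set: R] pos.
Proof. by apply: measurable_fun_ifT => //; exact: measurable_fun_ltr. Qed.

Lemma measurable_upper_angle : measurable_fun [set: R] upper_angle.
Proof.
by apply: measurable_fun_ifT => //; apply: measurable_and; exact: measurable_fun_ltr.
Qed.

Let upper_ge0 t : (0 <= upper_angle t)%R.
Proof. by rewrite /upper_angle; case: ifP. Qed.

Let m_shift c : measurable_fun [set: R] (fun t : R => t + c)%R.
Proof. exact: measurable_funD. Qed.

Lemma measurable_angle : measurable_fun [set: R] angle.
Proof.
apply: measurable_funD; first exact: measurable_upper_angle.
exact: (measurableT_comp measurable_upper_angle (m_shift pi)).
Qed.

Lemma polar_weight_ge0 p : (0 <= polar_weight p)%R.
Proof. by rewrite mulr_ge0// addr_ge0. Qed.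

Lemma measurable_polar_weight : measurable_fun [set: plane R] polar_weight.
Proof.
apply: measurable_funM; first exact: (measurableT_comp measurable_pos).
exact: (measurableT_comp measurable_angle).
Qed.

Lemma ge0_integral_shift (c : R) (g : R -> \bar R) :
  measurable_fun [set: R] g -> (forall x, 0 <= g x) ->
  \int[mu]_x g x = \int[mu]_x g (x + c)%R.
Proof.
move=> mg g0; rewrite (@ge0_change_of_variable R (fun x => x + c)%R (fun=> 1%R))//.
  by apply: eq_integral => x _; rewrite mule1.
move=> a b ab.
have -> : (fun x => x + c)%R @^-1` `]a, b]%classic = `](a - c)%R, (b - c)%R]%classic :> set R.
  by apply/seteqP; split => x /=; rewrite !in_itv/= ltrBlDr lerBrDr.
rewrite integral_cst//= mul1e [LHS]lebesgue_measure_itv/= lte_fin ltrD2r ab.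
by rewrite -EFinB; congr (_%:E); ring.
Qed.

Lemma ge0_integral_reflect (c : R) (g : R -> \bar R) :
  measurable_fun [set: R] g -> (forall x, 0 <= g x) ->
  \int[mu]_x g x = \int[mu]_x g (c - x)%R.
Proof.
move=> mg g0; rewrite (@ge0_integral_scale R (-1)%R)//.
rewrite (@ge0_integral_shift (- c)%R)//.
- by apply: eq_integral => x _; rewrite normrN1 mule1 mulN1r opprB.
- apply: emeasurable_funM => //; apply: (measurableT_comp mg).
  exact: measurable_funM.
- by move=> x; rewrite mule_ge0// lee_fin.
Qed.

Lemma ge0_integral_signed (g : R -> \bar R) :
  measurable_fun [set: R] g -> (forall x, 0 <= g x) ->
  \int[mu]_r (g r * `|r|%:E) =
  \int[mu]_r (g r * (pos r)%:E) + \int[mu]_r (g (- r)%R * (pos r)%:E).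
Proof.
move=> mg g0; have mp := measurable_pos.
have mgN : measurable_fun [set: R] (fun r => g (- r)%R) by exact: measurableT_comp.
have mN : measurable_fun [set: R] (fun r => pos (- r)%R) by exact: (measurableT_comp mp).
have -> : \int[mu]_r (g (- r)%R * (pos r)%:E) = \int[mu]_r (g r * (pos (- r))%:E).
  rewrite [RHS](@ge0_integral_scale R (-1)%R).
  - apply: eq_integral => r _.
    by rewrite !mulN1r opprK normrN1 mule1.
  - by [].
  - by apply: emeasurable_funM => //; exact/measurable_EFinP.
  - by move=> x; rewrite mule_ge0// lee_fin.
rewrite -ge0_integralD//.
- apply: eq_integral => r _; rewrite -ge0_muleDr ?lee_fin// -EFinD.
  congr (_ * _%:E); rewrite /pos oppr_gt0.
  by have [r0|r0|->] := ltgtP r 0%R; rewrite ?addr0 ?add0r ?normr0//;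
    [rewrite ltr0_norm|rewrite gtr0_norm].
- by move=> r _; rewrite mule_ge0// lee_fin.
- by apply: emeasurable_funM => //; exact/measurable_EFinP.
- by move=> r _; rewrite mule_ge0// lee_fin.
- by apply: emeasurable_funM => //; exact/measurable_EFinP.
Qed.

Let swap (z : plane R) : plane R := (z.2, z.1).

Lemma ge0_integral_plane_swap (f : plane R -> \bar R) :
  measurable_fun [set: plane R] f -> (forall z, 0 <= f z) ->
  \int[lebesgue_plane R]_z f z = \int[lebesgue_plane R]_z f (swap z).
Proof.
move=> mf f0; rewrite /lebesgue_plane (fubini_tonelli1 f)//.
rewrite (fubini_tonelli2 (fun z => f (swap z)))//.
exact: (measurableT_comp mf (measurable_fun_pair measurable_snd measurable_fst)).
Qed.

(** Swapping the coordinates turns the lines of ge0_integral_polar_half into those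
    of angle t in ]0, pi[. On such a line the points with r < 0 are those of
    radius -r and angle t - pi. *)
Lemma ge0_integral_polar (f : plane R -> \bar R) :
  measurable_fun [set: plane R] f -> (forall z, 0 <= f z) ->
  \int[lebesgue_plane R]_z f z =
  \int[lebesgue_plane R]_p (f (polar p) * (polar_weight p)%:E).
Proof.
move=> mf f0.
have mfs : measurable_fun [set: plane R] (fun z => f (swap z)).
  exact: (measurableT_comp mf (measurable_fun_pair measurable_snd measurable_fst)).
pose F p := f (polar p); have F0 p : 0 <= F p by exact: f0.
have mF : measurable_fun [set: plane R] F by exact: (measurableT_comp mf measurable_polar).
have mFr t : measurable_fun [set: R] (fun r => F (r, t)).
  exact: (measurableT_comp mF (measurable_pair2 t)).
pose Q t := \int[mu]_r (F (r, t) * (pos r)%:E).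
have Q0 t : 0 <= Q t by apply: integral_ge0 => r _; rewrite mule_ge0// lee_fin.
have mFp : measurable_fun [set: plane R] (fun p => F p * (pos p.1)%:E).
  apply: emeasurable_funM => //; apply/measurable_EFinP.
  exact: (measurableT_comp measurable_pos).
have mQ : measurable_fun [set: R] Q.
  apply: (measurable_fun_fubini_tonelli_G (fun p => F p * (pos p.1)%:E)) => //.
  by move=> p; rewrite mule_ge0// lee_fin.
have FN r t : F ((- r)%R, (t + pi)%R) = F (r, t).
  by rewrite /F /polar/= cosDpi sinDpi !mulrNN.
have step1 : \int[lebesgue_plane R]_z f z =
    \int[mu]_t ((upper_angle t)%:E * (Q t + Q (t - pi)%R)).
  rewrite ge0_integral_plane_swap// ge0_integral_polar_half//.
  have mG : measurable_fun [set: plane R] (fun p : plane R =>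
      f (swap (polar p)) * (if half_turn p.2 then `|p.1|%R else 0%R)%:E).
    apply: emeasurable_funM; first exact: (measurableT_comp mfs measurable_polar).
    apply/measurable_EFinP; apply: measurable_fun_ifT => //.
      exact: (measurableT_comp (@measurable_half_turn R)).
    exact: measurableT_comp.
  rewrite (@ge0_integral_reflect (pi / 2)%R); last 2 first.
  - apply: (measurable_fun_fubini_tonelli_G (fun p : plane R =>
      f (swap (polar p)) * (if half_turn p.2 then `|p.1|%R else 0%R)%:E)).
      exact: mG.
    by move=> p; rewrite mule_ge0// lee_fin; case: ifP.
  - move=> t; apply: integral_ge0 => r _; rewrite mule_ge0// lee_fin.
    by case: ifP.
  apply: eq_integral => t _.
  have -> : half_turn (pi / 2 - t)%R = (0 < t < pi)%R.
    by rewrite /half_turn; apply/idP/idP; lra.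
  rewrite /upper_angle; case: ifPn => _; last first.
    by rewrite mul0e integral0_eq// => r _; rewrite mule0.
  rewrite mul1e.
  transitivity (\int[mu]_r (F (r, t) * `|r|%:E)).
    apply: eq_integral => r _; congr (f _ * _); rewrite /swap /polar /=.
    rewrite sinB cosB cos_pihalf sin_pihalf.
    by congr pair; ring.
  rewrite ge0_integral_signed//; congr (_ + _).
  by apply: eq_integral => r _; rewrite -[in RHS](FN r (t - pi)%R) subrK.
rewrite step1 /lebesgue_plane (fubini_tonelli2 _)//; last 2 first.
- apply: emeasurable_funM => //; apply/measurable_EFinP.
  exact: measurable_polar_weight.
- by move=> p; rewrite mule_ge0// lee_fin polar_weight_ge0.
transitivity (\int[mu]_t ((angle t)%:E * Q t)); last first.
  apply: eq_integral => t _; rewrite /Q -ge0_integralZl//.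
  - by apply: eq_integral => r _; rewrite /polar_weight EFinM muleCA (muleC (angle t)%:E).
  - apply: emeasurable_funM; first exact: mFr.
    by apply/measurable_EFinP; exact: measurable_pos.
  - by move=> r _; rewrite mule_ge0// lee_fin.
  - by rewrite lee_fin addr_ge0.
have mQp : measurable_fun [set: R] (fun t => Q (t - pi)%R).
  exact: (measurableT_comp mQ (m_shift _)).
have mu1 : measurable_fun [set: R] (fun t => (upper_angle t)%:E).
  by apply/measurable_EFinP; exact: measurable_upper_angle.
have mu2 : measurable_fun [set: R] (fun t => (upper_angle (t + pi))%:E).
  apply/measurable_EFinP; exact: (measurableT_comp measurable_upper_angle (m_shift pi)).
under eq_integral do rewrite ge0_muleDr//.
rewrite ge0_integralD//; last 4 first.
- by move=> t _; rewrite mule_ge0// lee_fin.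
- exact: emeasurable_funM.
- by move=> t _; rewrite mule_ge0// lee_fin.
- exact: emeasurable_funM.
rewrite [X in _ + X](@ge0_integral_shift pi); last 2 first.
- exact: emeasurable_funM.
- by move=> t; rewrite mule_ge0// lee_fin.
rewrite -ge0_integralD//; last 4 first.
- by move=> t _; rewrite mule_ge0// lee_fin.
- exact: emeasurable_funM.
- by move=> t _; rewrite mule_ge0// lee_fin.
- by under eq_fun do rewrite addrK; exact: emeasurable_funM.
apply: eq_integral => t _.
by rewrite addrK -ge0_muleDl ?lee_fin.
Qed.

End polar_coordinates.

Section weighted_transfer.
Local Open Scope ereal_scope.
Context d1 d2 (T : measurableType d1) (S : measurableType d2) (R : realType).
Variables (m : {measure set T -> \bar R}) (l : {measure set S -> \bar R}).
Variables (phi : S -> T) (W : S -> R).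
Hypotheses (W0 : forall s, (0 <= W s)%R).
Hypothesis transfer : forall f : T -> \bar R, measurable_fun [set: T] f ->
  (forall t, 0 <= f t) -> \int[m]_t f t = \int[l]_s (f (phi s) * (W s)%:E).

(** Positive and negative parts extend the transfer from non-negative to integrable
    functions. *)
Lemma integrable_transfer (f : T -> R) : measurable_fun [set: T] f ->
  l.-integrable setT (fun s => (f (phi s) * W s)%:E) ->
  m.-integrable setT (EFin \o f) /\
  (\int[m]_t f t = \int[l]_s (f (phi s) * W s))%R.
Proof.
move=> mf /[dup] fi /integrableP[mfW foo].
have mEf : measurable_fun setT (EFin \o f) by exact/measurable_EFinP.
split.
  apply/integrableP; split => //.
  rewrite transfer//; last exact: measurableT_comp.
  apply: le_lt_trans foo; rewrite le_eqVlt; apply/orP; left; apply/eqP.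
  by apply: eq_integral => s _; rewrite -EFinM/= normrM (ger0_norm (W0 s)).
congr fine; rewrite integralE [RHS]integralE; congr (_ - _).
- rewrite transfer//; last exact: measurable_funepos.
  apply: eq_integral => s _; rewrite !funeposE /=.
  by rewrite -!EFin_max -EFinM maxr_pMl// mul0r.
- rewrite transfer//; last exact: measurable_funeneg.
  apply: eq_integral => s _; rewrite !funenegE /=.
  by rewrite -!EFin_max -EFinM maxr_pMl// mul0r mulNr.
Qed.

Lemma cintegrable_transfer (f : T -> R[i]) :
  measurable_fun [set: T] (fun t => complex.Re (f t)) ->
  measurable_fun [set: T] (fun t => complex.Im (f t)) ->
  cintegrable l (fun s => f (phi s) * (W s)%:C%C)%R ->
  cintegrable m f /\ cintegral m f = cintegral l (fun s => f (phi s) * (W s)%:C%C)%R.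
Proof.
have ReW s : complex.Re (f (phi s) * (W s)%:C%C)%R = (complex.Re (f (phi s)) * W s)%R.
  by rewrite complex_ReM /= mulr0 subr0.
have ImW s : complex.Im (f (phi s) * (W s)%:C%C)%R = (complex.Im (f (phi s)) * W s)%R.
  by rewrite complex_ImM /= mulr0 add0r.
move=> mr mi [lr li].
have [|mr' er] := integrable_transfer mr.
  by apply: eq_integrable lr => // s _; rewrite ReW.
have [|mi' ei] := integrable_transfer mi.
  by apply: eq_integrable li => // s _; rewrite ImW.
split; first by split.
apply: complexP; rewrite ?Re_cintegral ?Im_cintegral ?er ?ei.
  by apply: eq_Rintegral => s _; rewrite ReW.
by apply: eq_Rintegral => s _; rewrite ImW.
Qed.

End weighted_transfer.

Section gauss_polar.
Local Open Scope ereal_scope.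
Context {R : realType}.
Local Notation mu := (@lebesgue_measure R).
Variable N : nat.

Definition gauss_radial (r : R) : R :=
  (expR (- (N%:R * r ^+ 2)) * positive_part_weight r)%R.

Definition gauss_polar_weight (p : plane R) : R := (gauss_radial p.1 * angle p.2)%R.

Lemma gauss_radial_ge0 r : (0 <= gauss_radial r)%R.
Proof.
by rewrite mulr_ge0 ?expR_ge0// /positive_part_weight; case: ifP => // /ltW.
Qed.

Lemma angle_ge0 (t : R) : (0 <= angle t)%R.
Proof. by rewrite addr_ge0// /upper_angle; case: ifP. Qed.

Lemma gauss_polar_weight_ge0 p : (0 <= gauss_polar_weight p)%R.
Proof. by rewrite mulr_ge0 ?gauss_radial_ge0 ?angle_ge0. Qed.

Lemma cmod_polar (p : plane R) : (cmod (polar p) = `|p.1|)%R.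
Proof.
rewrite /cmod /polar /= !exprMn -mulrDr cos2Dsin2 mulr1.
by rewrite sqrtr_sqr.
Qed.

Lemma measurable_gauss_density : measurable_fun [set: plane R]
  (fun z : plane R => expR (- (N%:R * cmod z ^+ 2))%R).
Proof.
apply: measurableT_comp => //; apply: measurableT_comp => //.
by apply: measurable_funM => //; apply: measurable_funX; exact: measurable_cmod.
Qed.

Lemma ge0_gauss_integral (f : plane R -> \bar R) :
  measurable_fun [set: plane R] f -> (forall z, 0 <= f z) ->
  \int[gauss_weight N]_z f z =
  \int[lebesgue_plane R]_p (f (polar p) * (gauss_polar_weight p)%:E).
Proof.
move=> mf f0.
have md := measurable_gauss_density.
rewrite (@ge0_integral_density _ _ _ (lebesgue_plane R) (gauss_weight N)
  (fun z => expR (- (N%:R * cmod z ^+ 2)))%R)//.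
rewrite [LHS]ge0_integral_polar//.
- apply: eq_integral => p _; rewrite -muleA -EFinM; congr (_ * _%:E).
  rewrite /gauss_polar_weight /gauss_radial /polar_weight cmod_polar.
  by rewrite real_normK ?num_real// mulrA.
- by apply: emeasurable_funM => //; exact/measurable_EFinP.
- by move=> z; rewrite mule_ge0// lee_fin expR_ge0.
Qed.

Lemma gauss_cintegral (f : plane R -> R[i]) :
  measurable_fun [set: plane R] (fun t => complex.Re (f t)) ->
  measurable_fun [set: plane R] (fun t => complex.Im (f t)) ->
  cintegrable (lebesgue_plane R)
    (fun p => f (polar p) * (gauss_polar_weight p)%:C%C)%R ->
  cintegrable (gauss_weight N) f /\ cintegral (gauss_weight N) f =
  cintegral (lebesgue_plane R) (fun p => f (polar p) * (gauss_polar_weight p)%:C%C)%R.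
Proof.
apply: cintegrable_transfer; first exact: gauss_polar_weight_ge0.
exact: ge0_gauss_integral.
Qed.

End gauss_polar.

(** * Radial and angular integrals *)

Section radial_moments.
Context {R : realType}.
Local Notation mu := (@lebesgue_measure R).
Variable N : nat.
Hypothesis N0 : (0 < N)%N.
Let NR : 0 < N%:R :> R. Proof. by rewrite ltr0n. Qed.

Lemma measurable_gauss_radial : measurable_fun [set: R] (gauss_radial (R := R) N).
Proof.
apply: measurable_funM; last exact: measurable_pos.
apply: measurableT_comp => //; apply: measurableT_comp => //.
by apply: measurable_funM => //; exact: measurable_funX.
Qed.

(** A primitive of r^(2k+1) exp(-N r^2), by k integrations by parts. *)
Fixpoint radial_primitive k (r : R) : R :=
  if k is k'.+1 then
    - (r ^+ (2 * k'.+1) * expR (- (N%:R * r ^+ 2)) / (2 * N%:R))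
      + k'.+1%:R / N%:R * radial_primitive k' r
  else - (expR (- (N%:R * r ^+ 2)) / (2 * N%:R)).

Lemma is_derive_radial_primitive k (r : R) :
  is_derive r 1 (radial_primitive k) (r ^+ (2 * k).+1 * expR (- (N%:R * r ^+ 2))).
Proof.
have Nn : N%:R != 0 :> R by rewrite gt_eqF.
elim: k => [|k IH].
  rewrite /radial_primitive; derive_fun.
  by rewrite muln0 expr1; field.
have -> : radial_primitive k.+1 = fun r =>
  - (r ^+ (2 * k.+1) * expR (- (N%:R * r ^+ 2)) / (2 * N%:R))
  + k.+1%:R / N%:R * radial_primitive k r by [].
derive_fun.
have -> : (k + 1 * k.+1)%coq_nat = (2 * k).+1.
  by rewrite -[LHS]/((2 * k.+1).-1) mulnS.
rewrite mulnS natrD natrM -natr1 !exprS expr0.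
by field.
Qed.

Lemma radial_primitive0 k : radial_primitive k 0 = - (k`!%:R / (2 * N%:R ^+ k.+1)).
Proof.
have Nn : N%:R != 0 :> R by rewrite gt_eqF.
elim: k => [|k IH] /=; first by rewrite expr0n/= mulr0 oppr0 expR0 fact0 expr1.
rewrite IH mulnS expr0n/= !mul0r oppr0 add0r factS natrM !exprS.
by field; rewrite expf_neq0.
Qed.

(** exp x >= x^(k+1) / (k+1)! at x = N r^2 leaves a bound of order 1 / r^2. *)
Lemma cvg_gauss_power k :
  (r : R) ^+ (2 * k) * expR (- (N%:R * r ^+ 2)) @[r --> +oo] --> (0 : R).
Proof.
apply/cvgrPdist_le => e e0; near=> r.
have r0 : 0 < r by near: r; apply: nbhs_pinfty_gt; rewrite num_real.
have r1 : 1 <= r by near: r; apply: nbhs_pinfty_ge; rewrite num_real.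
have re : k.+1`!%:R / N%:R ^+ k.+1 / e <= r.
  by near: r; apply: nbhs_pinfty_ge; rewrite num_real.
rewrite sub0r normrN ger0_norm ?mulr_ge0 ?exprn_ge0 ?expR_ge0 ?(ltW r0)//.
have x0 : 0 <= N%:R * r ^+ 2 by rewrite mulr_ge0 ?sqr_ge0 ?ltW.
have h := @expR_ge1Dxn R (N%:R * r ^+ 2) k x0.
have {}h : (N%:R * r ^+ 2) ^+ k.+1 / k.+1`!%:R <= expR (N%:R * r ^+ 2).
  by apply: le_trans h; rewrite lerDr.
rewrite expRN ler_pdivrMr ?expR_gt0//.
apply: le_trans (ler_wpM2l (ltW e0) h).
have f0 : 0 < k.+1`!%:R :> R by rewrite ltr0n fact_gt0.
have Nk : 0 < N%:R ^+ k.+1 :> R by rewrite exprn_gt0.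
move: re; rewrite ler_pdivrMr// ler_pdivrMr// => re.
have B0 : 0 <= r ^+ (2 * k) by rewrite exprn_ge0// ltW.
have -> : (N%:R * r ^+ 2) ^+ k.+1 = N%:R ^+ k.+1 * (r ^+ 2 * r ^+ (2 * k)).
  by rewrite exprMn -exprM mulnS exprD.
rewrite [leRHS]mulrA ler_pdivlMr//.
have : k.+1`!%:R <= e * N%:R ^+ k.+1 * r ^+ 2.
  apply: (le_trans re); rewrite expr2 [leRHS]mulrA.
  have -> : r * e * N%:R ^+ k.+1 = e * N%:R ^+ k.+1 * r by ring.
  by rewrite ler_peMr// !mulr_ge0 ?ltW.
move=> /(ler_wpM2l B0) h2; apply: (le_trans h2).
by rewrite le_eqVlt; apply/orP; left; apply/eqP; ring.
Unshelve. all: by end_near.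
Qed.

Lemma cvg_radial_primitive k : radial_primitive k r @[r --> +oo] --> (0 : R).
Proof.
elim: k => [|k IH].
  rewrite -oppr0 -(mul0r (2 * N%:R)^-1); apply: cvgN; apply: cvgMl.
  by have := cvg_gauss_power 0; under eq_fun do rewrite muln0 expr0 mul1r.
rewrite -[0]addr0; apply: cvgD.
  rewrite -oppr0 -(mul0r (2 * N%:R)^-1); apply: cvgN; apply: cvgMl.
  exact: cvg_gauss_power.
by rewrite -(mulr0 (k.+1%:R / N%:R)); apply: cvgMr.
Qed.

Lemma ge0_integral_even_moment k :
  (\int[mu]_r (r ^+ (2 * k) * gauss_radial N r)%:E =
   (k`!%:R / (2 * N%:R ^+ k.+1))%:E)%E.
Proof.
have cf : continuous (fun r : R => r ^+ (2 * k).+1 * expR (- (N%:R * r ^+ 2))).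
  move=> r; apply: differentiable_continuous; apply/derivable1_diffP.
  have [l d] : exists l,
      is_derive r 1 (fun r : R => r ^+ (2 * k).+1 * expR (- (N%:R * r ^+ 2))) l.
    by eexists; derive_body.
  exact: (@ex_derive _ _ _ _ _ _ _ d).
transitivity (\int[mu]_(r in `[0%R, +oo[) (r ^+ (2 * k).+1 * expR (- (N%:R * r ^+ 2)))%:E)%E.
  rewrite [RHS]integral_mkcond; apply: eq_integral => r _.
  rewrite patchE; case: ifPn => [/set_mem|] /=.
    rewrite in_itv/= andbT le_eqVlt => /predU1P[<-|r0].
      by rewrite /gauss_radial /positive_part_weight ltxx !mulr0 exprS !mul0r.
    by rewrite /gauss_radial /positive_part_weight r0; congr (_%:E); rewrite (exprS r (2 * k)); ring.
  rewrite notin_setE/= in_itv/= andbT => /negP; rewrite -ltNge => r0.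
  by rewrite /gauss_radial /positive_part_weight ltNge (ltW r0) !mulr0.
rewrite (@ge0_continuous_FTC2y _ _ (radial_primitive k) 0 0).
- by rewrite radial_primitive0 -EFinB sub0r opprK.
- by move=> r r0; rewrite mulr_ge0 ?expR_ge0// exprn_ge0.
- exact: continuous_subspaceT.
- exact: cvg_radial_primitive.
- by move=> r _; have [] := is_derive_radial_primitive k r.
- apply: cvg_at_right_filter; apply: differentiable_continuous.
  by apply/derivable1_diffP; have [] := is_derive_radial_primitive k 0.
- by move=> r _; rewrite derive1E; have [_ ->] := is_derive_radial_primitive k r.
Qed.

End radial_moments.

Section radial_integrability.
Context {R : realType}.
Local Notation mu := (@lebesgue_measure R).
Variable N : nat.
Hypothesis N0 : (0 < N)%N.

Lemma integrable_even_moment k :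
  mu.-integrable setT (fun r : R => (r ^+ (2 * k) * gauss_radial N r)%:E).
Proof.
have m : measurable_fun [set: R] (fun r : R => r ^+ (2 * k) * gauss_radial N r).
  apply: measurable_funM; first exact: measurable_funX.
  exact: measurable_gauss_radial.
apply/integrableP; split; first exact/measurable_EFinP.
suff -> : (\int[mu]_r `|(r ^+ (2 * k) * gauss_radial N r)%:E| =
    \int[mu]_r (r ^+ (2 * k) * gauss_radial N r)%:E)%E.
  by rewrite ge0_integral_even_moment// ltry.
apply: eq_integral => r _; rewrite gee0_abs// lee_fin mulr_ge0 ?gauss_radial_ge0//.
by rewrite exprM exprn_ge0// sqr_ge0.
Qed.

(** |r|^n <= 1 + r^(2n): the moments of order 0 and 2n dominate. *)
Lemma integrable_radial n (chi : R -> R) :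
  measurable_fun setT chi -> (forall r, `|chi r| <= 1) ->
  mu.-integrable setT (fun r : R => (r ^+ n * chi r * gauss_radial N r)%:E).
Proof.
move=> mchi chi1.
have := integrableD measurableT (integrable_even_moment 0) (integrable_even_moment n).
apply: le_integrable => //.
  apply/measurable_EFinP; apply: measurable_funM; last exact: measurable_gauss_radial.
  by apply: measurable_funM => //; exact: measurable_funX.
move=> r _ /=; rewrite lee_fin muln0 expr0 mul1r.
have g0 := gauss_radial_ge0 N r.
rewrite [leRHS]ger0_norm; last first.
  by rewrite addr_ge0// mulr_ge0// exprM exprn_ge0// sqr_ge0.
rewrite -[X in X + _]mul1r -mulrDl normrM (ger0_norm g0) ler_wpM2r//.
rewrite normrM; apply: (@le_trans _ _ `|r ^+ n|); first by rewrite ler_piMr.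
rewrite (mulnC 2) exprM -[leRHS]addrC -(@real_normK _ (r ^+ n)) ?num_real//.
have := normr_ge0 (r ^+ n); move: `|r ^+ n| => x; nra.
Qed.

End radial_integrability.

Section angular_integral.
Context {R : realType}.
Local Notation mu := (@lebesgue_measure R).
Implicit Types (t c alpha : R).

Definition eit t : R[i] := Complex (cos t) (sin t).

Lemma eitD (s t : R) : eit (s + t) = eit s * eit t.
Proof.
apply: complexP; rewrite ?complex_ReM ?complex_ImM /= ?cosD ?sinD//.
by rewrite addrC.
Qed.

Lemma eitX t n : eit t ^+ n = eit (n%:R * t).
Proof.
elim: n => [|n IH].
  by rewrite mul0r expr0; apply: complexP; rewrite /= ?cos0 ?sin0.
by rewrite exprS IH -eitD -natr1 mulrDl mul1r addrC.
Qed.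

Lemma eit_conj t : (eit t)^*%C = eit (- t).
Proof. by apply: complexP; rewrite /= ?cosN ?sinN. Qed.

Lemma angleE t : angle t = ((- pi < t < pi) && (t != 0))%:R.
Proof.
rewrite /angle /upper_angle.
have p0 := pi_gt0 R.
have [h1|h1] := boolP (0 < t < pi); have [h2|h2] := boolP (0 < t + pi < pi).
- exfalso; lra.
- by rewrite addr0 (_ : _ && _ = true)//; apply/andP; split; [lra|apply/eqP; lra].
- by rewrite add0r (_ : _ && _ = true)//; apply/andP; split; [lra|apply/eqP; lra].
- rewrite addr0 (_ : _ && _ = false)//; apply/negbTE/negP => /andP[/andP[a b] c].
  move: h1 h2; rewrite !negb_and -!leNgt.
  by have [t0|t0|t0] := ltgtP t 0; [|lra..| by rewrite t0 eqxx in c]; lra.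
Qed.

Lemma integrable_angular (h : R -> R) : measurable_fun setT h ->
  (forall t, `|h t| <= 1) -> mu.-integrable setT (fun t => (h t * angle t)%:E).
Proof.
move=> mh h1.
have := @integrable_indic_itv R (- pi) pi true false.
apply: le_integrable => //.
  by apply/measurable_EFinP; apply: measurable_funM => //; exact: measurable_angle.
move=> t _ /=; rewrite lee_fin normrM angleE indicE.
have [/andP[/andP[a b] c]|_] := boolP (_ && _); last by rewrite normr0 mulr0.
rewrite mem_set/=; last by rewrite in_itv/= !ltW.
by rewrite normr1 mulr1.
Qed.

Lemma measurable_bool_itv (a b : R) :
  measurable_fun setT (fun t : R => (a <= t <= b)%R%:R : R).
Proof.
have -> : (fun t : R => (a <= t <= b)%R%:R : R) = \1_(`[a, b]%classic : set R).
  by apply/funext => t; rewrite indicE; congr ((nat_of_bool _)%:R);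
    apply/idP/idP => [h|/set_mem]; [apply/mem_set; rewrite /= in_itv|rewrite /= in_itv].
exact: measurable_indic.
Qed.

Lemma Rintegral_angle (f F : R -> R) alpha : 0 < alpha <= pi ->
  continuous f -> (forall t, is_derive t 1 F (f t)) ->
  \int[mu]_t (f t * (- alpha <= t <= alpha)%R%:R * angle t) = F alpha - F (- alpha).
Proof.
move=> /andP[a0 api] cf dF.
have e : (\int[mu]_t (f t * (- alpha <= t <= alpha)%R%:R * angle t)%:E =
    \int[mu]_(t in `[(- alpha)%R, alpha]) (f t)%:E)%E.
  rewrite [RHS]integral_mkcond.
  have mI := measurable_bool_itv (- alpha) alpha.
  apply: ae_eq_integral => //.
  - apply/measurable_EFinP; apply: measurable_funM; last exact: measurable_angle.
    by apply: measurable_funM => //; exact: continuous_measurable_fun.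
  - apply/(measurable_restrictT _ _).1 => //; apply/measurable_EFinP.
    by apply: measurable_funTS; exact: continuous_measurable_fun.
  (* the only points of [-alpha, alpha] at which angle can vanish *)
  exists [set - pi; 0; pi]; split.
  - by do 2 apply: measurableU => //.
  - apply: countable_lebesgue_measure0; apply: finite_set_countable.
    by rewrite !finite_setU; split; [split|]; exact: finite_set1.
  - move=> t /= H; apply: contrapT => nt; apply: H => _.
    have tn : [/\ t != - pi, t != 0 & t != pi].
      by split; apply/eqP => tE; apply: nt; rewrite tE; [left; left|left; right|right].
    have [tn1 tn2 tn3] := tn.
    rewrite patchE; case: ifPn => [/set_mem|] /=.
      rewrite in_itv/= => /andP[t1 t2]; rewrite t1 t2 mulr1 angleE tn2 andbT.
      rewrite (_ : _ < _ < _ = true) ?mulr1//; apply/andP; split.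
        by rewrite lt_neqAle eq_sym tn1/= (le_trans _ t1)// lerN2.
      by rewrite lt_neqAle tn3/= (le_trans t2).
    rewrite notin_setE/= in_itv/= => /negP /negbTE ->.
    by rewrite mulr0 mul0r.
rewrite /Rintegral e (@continuous_FTC2 _ f F)//.
- by rewrite gtrN.
- exact: continuous_subspaceT.
- split.
  + by move=> t _; have [] := dF t.
  + apply: cvg_at_right_filter; apply: differentiable_continuous.
    by apply/derivable1_diffP; have [] := dF (- alpha).
  + apply: cvg_at_left_filter; apply: differentiable_continuous.
    by apply/derivable1_diffP; have [] := dF alpha.
- by move=> t _; rewrite derive1E; have [_ ->] := dF t.
Qed.

(** Half the integral of exp(i c t) over [-alpha, alpha]. *)
Definition sector_coef c alpha : R := if c == 0 then alpha else sin (c * alpha) / c.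

Lemma continuous_cosM c : continuous (fun t => cos (c * t)).
Proof.
move=> t; apply: (@cvg_comp _ _ _ (fun t => c * t) (@cos R)).
  by apply: cvgM; [exact: cvg_cst|exact: cvg_id].
exact: continuous_cos.
Qed.

Lemma continuous_sinM c : continuous (fun t => sin (c * t)).
Proof.
move=> t; apply: (@cvg_comp _ _ _ (fun t => c * t) (@sin R)).
  by apply: cvgM; [exact: cvg_cst|exact: cvg_id].
exact: continuous_sin.
Qed.

Lemma cintegral_angle c alpha : 0 < alpha <= pi ->
  cintegral mu (fun t => eit (c * t) *
    ((- alpha <= t <= alpha)%R%:R * angle t)%:C%C) = (2 * sector_coef c alpha)%:C%C.
Proof.
move=> ha; apply: complexP; rewrite ?Re_cintegral ?Im_cintegral [RHS]/=.
- under eq_Rintegral do rewrite complex_ReM /= mulr0 subr0 mulrA.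
  rewrite /sector_coef; have [->|c0] := eqVneq c 0.
    have d t : is_derive t 1 (fun u : R => u) (cos (0 * t)).
      by rewrite mul0r cos0; exact: derive_rule_id.
    by rewrite (Rintegral_angle ha (@continuous_cosM 0) d); ring.
  have d t : is_derive t 1 (fun u : R => sin (c * u) / c) (cos (c * t)).
    by derive_fun; field.
  by rewrite (Rintegral_angle ha (@continuous_cosM c) d) mulrN sinN; field.
- under eq_Rintegral do rewrite complex_ImM /= mulr0 add0r mulrA.
  have [->|c0] := eqVneq c 0.
    have d t : is_derive t 1 (fun _ : R => 0 : R) (sin (0 * t)).
      by rewrite mul0r sin0; exact: derive_rule_cst.
    by rewrite (Rintegral_angle ha (@continuous_sinM 0) d) subrr.
  have d t : is_derive t 1 (fun u : R => - (cos (c * u) / c)) (sin (c * t)).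
    by derive_fun; field.
  by rewrite (Rintegral_angle ha (@continuous_sinM c) d) mulrN cosN subrr.
Qed.

End angular_integral.

Section complex_measurability.
Context d (T : measurableType d) (R : realType).
Implicit Types f g : T -> R[i].

Definition cmeasurable f :=
  measurable_fun [set: T] (fun x => complex.Re (f x)) /\
  measurable_fun [set: T] (fun x => complex.Im (f x)).

Lemma cmeasurableM f g : cmeasurable f -> cmeasurable g ->
  cmeasurable (fun x => f x * g x).
Proof.
move=> [fr fi] [gr gi]; split.
- under eq_fun do rewrite complex_ReM.
  by apply: measurable_funB; apply: measurable_funM.
- under eq_fun do rewrite complex_ImM.
  by apply: measurable_funD; apply: measurable_funM.
Qed.

Lemma cmeasurable_real (h : T -> R) : measurable_fun setT h ->
  cmeasurable (fun x => (h x)%:C%C).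
Proof. by move=> mh; split => //=; exact: measurable_cst. Qed.

Lemma cmeasurableX f n : cmeasurable f -> cmeasurable (fun x => f x ^+ n).
Proof.
move=> mf; elim: n => [|n IH].
  by under eq_fun do rewrite expr0; split; exact: measurable_cst.
by under eq_fun do rewrite exprS; exact: cmeasurableM.
Qed.

Lemma cmeasurable_conj f : cmeasurable f -> cmeasurable (fun x => (f x)^*%C).
Proof.
move=> [fr fi]; split.
- by rewrite (_ : (fun x => _) = (fun x => complex.Re (f x)))//;
    apply/funext => x; case: (f x).
- rewrite (_ : (fun x => _) = (fun x => - complex.Im (f x))).
    exact: measurableT_comp.
  by apply/funext => x; case: (f x).
Qed.

End complex_measurability.

(** * Gram matrices of the monomials *)

Section gram.
Context {R : realType}.
Local Notation mu := (@lebesgue_measure R).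
Implicit Types (z : plane R) (r t alpha : R).

Definition to_complex z : R[i] := Complex z.1 z.2.

Lemma to_complex_polar r t : to_complex (polar (r, t)) = r%:C%C * eit t.
Proof. by apply: complexP; rewrite ?complex_ReM ?complex_ImM /= ?mul0r ?subr0 ?addr0. Qed.

Lemma carg_polar r t : 0 < r -> - pi < t < pi -> t != 0 -> carg (polar (r, t)) = t.
Proof.
move=> r0 /andP[t1 t2] tn.
rewrite /carg cmod_polar /= gtr0_norm// mulrAC divff ?gt_eqF// mul1r.
rewrite pmulr_rge0//; have [t0|t0] := ltP 0 t.
  rewrite (ltW (sin_gt0_pi _)) ?t0//; apply: cosK.
  by rewrite in_itv/= !ltW.
have {tn}t0 : t < 0 by rewrite lt_neqAle tn.
rewrite leNgt -oppr_gt0 -sinN sin_gt0_pi ?oppr_gt0 ?t0//=; last by lra.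
by rewrite cosKN ?opprK// !ltW.
Qed.

Lemma cmeasurable_to_complex : cmeasurable to_complex.
Proof. by split => /=; [exact: measurable_fst|exact: measurable_snd]. Qed.

Variable N : nat.
Hypothesis N0 : (0 < N)%N.

Definition radial_moment (chi : R -> R) n : R :=
  \int[mu]_r (r ^+ n * chi r * gauss_radial N r).

Definition monomial_pairing j k (u : plane R -> R) z : R[i] :=
  to_complex z ^+ j * (to_complex z ^+ k)^*%C * (u z)%:C%C.

Lemma monomial_pairing_polar j k u r t :
  monomial_pairing j k u (polar (r, t)) =
  (r ^+ (j + k))%:C%C * eit ((j%:R - k%:R) * t) * (u (polar (r, t)))%:C%C.
Proof.
rewrite /monomial_pairing to_complex_polar; congr (_ * _).
have conjM (x y : R[i]) : conjc (x * y) = conjc x * conjc y by exact: rmorphM.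
have rX n : (r%:C%C : R[i]) ^+ n = (r ^+ n)%:C%C by rewrite rmorphXn.
rewrite !exprMn conjM !eitX eit_conj !rX conjc_real mulrACA -eitD.
by rewrite -rmorphM -exprD; congr (_ * eit _); ring.
Qed.

(** In polar coordinates the integrand is a function of r times a function of t. *)
Lemma gram_integral j k (chi : R -> R) alpha (u : plane R -> R) :
  measurable_fun setT chi -> (forall r, `|chi r| <= 1) -> 0 < alpha <= pi ->
  measurable_fun setT u ->
  (forall r t, 0 < r -> - pi < t < pi -> t != 0 ->
    u (polar (r, t)) = chi r * (- alpha <= t <= alpha)%R%:R) ->
  cintegrable (gauss_weight N) (monomial_pairing j k u) /\
  cintegral (gauss_weight N) (monomial_pairing j k u) =
    (radial_moment chi (j + k) * (2 * sector_coef (j%:R - k%:R) alpha))%:C%C.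
Proof.
move=> mchi chi1 ha mu_ hu.
pose A r : R[i] := (r ^+ (j + k) * chi r * gauss_radial N r)%:C%C.
pose B t : R[i] := eit ((j%:R - k%:R) * t) *
  ((- alpha <= t <= alpha)%R%:R * angle t)%:C%C.
have iA : cintegrable mu A by apply: cintegrable_real; exact: integrable_radial.
have mI : measurable_fun setT (fun t : R => (- alpha <= t <= alpha)%R%:R : R).
  exact: measurable_bool_itv.
have iB : cintegrable mu B.
  split.
  - rewrite (_ : (fun t => _) = fun t => (cos ((j%:R - k%:R) * t) *
      (- alpha <= t <= alpha)%R%:R * angle t)%:E).
      apply: integrable_angular.
        by apply: measurable_funM => //; apply: continuous_measurable_fun;
          exact: continuous_cosM.
      move=> t; rewrite normrM; case: (_ <= _ <= _); rewrite ?normr0 ?mulr0//.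
      by rewrite normr1 mulr1 cos_max.
    by apply/funext => t; rewrite /B complex_ReM /= mulr0 subr0 mulrA.
  - rewrite (_ : (fun t => _) = fun t => (sin ((j%:R - k%:R) * t) *
      (- alpha <= t <= alpha)%R%:R * angle t)%:E).
      apply: integrable_angular.
        by apply: measurable_funM => //; apply: continuous_measurable_fun;
          exact: continuous_sinM.
      move=> t; rewrite normrM; case: (_ <= _ <= _); rewrite ?normr0 ?mulr0//.
      by rewrite normr1 mulr1 sin_max.
    by apply/funext => t; rewrite /B complex_ImM /= mulr0 add0r mulrA.
have E : (fun p => monomial_pairing j k u (polar p) *
    (gauss_polar_weight N p)%:C%C) = (fun p => A p.1 * B p.2).
  apply/funext => -[r t]; rewrite monomial_pairing_polar /A /B.
  rewrite /gauss_polar_weight /=.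
  have [r0|r0] := ltP 0 r; last first.
    by rewrite /gauss_radial /positive_part_weight ltNge r0/= !(mulr0, mul0r).
  rewrite angleE; have [/andP[t1 t2]|_] := boolP (_ && _); last first.
    by rewrite !(mulr0, mul0r).
  rewrite hu// !rmorphM /=; ring.
have mm : cmeasurable (monomial_pairing j k u).
  apply: cmeasurableM; last exact: cmeasurable_real.
  apply: cmeasurableM; last apply: cmeasurable_conj;
    apply: cmeasurableX; exact: cmeasurable_to_complex.
have [mr mi] := mm.
have [|ii ->] := @gauss_cintegral R N (monomial_pairing j k u) mr mi.
  by rewrite E; exact: cintegrable_tensor.
split => //; rewrite E cintegral_tensor// cintegral_real cintegral_angle//.
by rewrite -rmorphM.
Qed.

End gram.

Section bounded_multiplier.
Context d (T : measurableType d) (R : realType).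
Variable m : {measure set T -> \bar R}.

Lemma cintegrable_bounded (f : T -> R[i]) (u : T -> R) :
  cintegrable m f -> measurable_fun setT u -> (forall z, `|u z| <= 1) ->
  cintegrable m (fun z => f z * (u z)%:C%C).
Proof.
move=> [fr fi] mu_ u1.
have aux (h : T -> R) : m.-integrable setT (fun z => (h z)%:E) ->
    m.-integrable setT (fun z => (h z * u z)%:E).
  move=> ih; apply: (le_integrable _ _ _ ih) => //.
    have /measurable_EFinP mh := measurable_int _ ih.
    by apply/measurable_EFinP; exact: measurable_funM.
  by move=> z _; rewrite /= lee_fin normrM ler_piMr.
split.
- by under eq_fun do rewrite complex_ReM /= mulr0 subr0; exact: aux.
- by under eq_fun do rewrite complex_ImM /= mulr0 add0r; exact: aux.
Qed.

End bounded_multiplier.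

Section vandermonde.
Context {R : realType}.

Lemma mul_conj_cmod (z : plane R) :
  to_complex z * (to_complex z)^*%C = (cmod z ^+ 2)%:C%C.
Proof.
rewrite /cmod sqr_sqrtr ?addr_ge0 ?sqr_ge0//.
by apply: complexP; rewrite ?complex_ReM ?complex_ImM /=; ring.
Qed.

Lemma to_complexB (z w : plane R) : to_complex (z - w) = to_complex z - to_complex w.
Proof. by []. Qed.

Lemma vandermonde_sqE N (c : 'I_N -> R) (z : N.-tuple (plane R)) :
  let D := \det (\matrix_(i < N, j < N) ((c j)%:C%C * to_complex (tnth z i) ^+ j)) in
  D * D^*%C = ((\prod_j c j) ^+ 2 * vandermonde_sq z)%:C%C.
Proof.
move=> D.
pose a : 'rV[R[i]]_N := \row_i to_complex (tnth z i).
have DE : D = \det (Vandermonde N a) * (\prod_j c j)%:C%C.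
  rewrite -det_tr rmorph_prod.
  have -> : \prod_j (c j)%:C%C = \det (diag_mx (\row_j (c j)%:C%C)).
    by rewrite det_diag; apply: eq_bigr => j _; rewrite mxE.
  rewrite -det_mulmx; congr (\det _); apply/matrixP => i j.
  rewrite !mxE (bigD1 j)//= !mxE eqxx mulr1n big1 ?addr0; first exact: mulrC.
  by move=> k kj; rewrite !mxE (negbTE kj) mulr0n mulr0.
have conjM (x y : R[i]) : conjc (x * y) = conjc x * conjc y by exact: rmorphM.
have conjP (I : finType) (P : pred I) (F : I -> R[i]) :
  conjc (\prod_(i | P i) F i) = \prod_(i | P i) conjc (F i) by exact: rmorph_prod.
rewrite DE conjM conjc_real mulrACA -rmorphM -expr2 mulrC [RHS]rmorphM.
congr (_ * _).
rewrite det_Vandermonde conjP -big_split /= /vandermonde_sq.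
transitivity (\prod_(i < N) \prod_(j < N | (i < j)%N)
    (cmod (tnth z i - tnth z j) ^+ 2)%:C%C).
  apply: eq_bigr => i _; rewrite conjP -big_split /=; apply: eq_bigr => j _.
  rewrite !mxE -mul_conj_cmod to_complexB -(opprB (to_complex (tnth z i))).
  have conjN (x : R[i]) : conjc (- x) = - conjc x by exact: rmorphN.
  by rewrite conjN mulrNN.
rewrite (exchange_big_dep predT)//= rmorph_prod; apply: eq_bigr => k _.
by rewrite rmorph_prod.
Qed.

End vandermonde.

Section orthonormal_monomials.
Context {R : realType}.
Variable N : nat.
Hypothesis N0 : (0 < N)%N.
Local Notation m := (gauss_weight (R := R) N).
Implicit Types (u : plane R -> R) (z : plane R).

Definition monomial_norm2 j : R :=
  radial_moment N (fun=> 1) (j + j) * (2 * pi).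

Lemma radial_moment_even k :
  radial_moment N (fun=> 1) (k + k) = k`!%:R / (2 * N%:R ^+ k.+1) :> R.
Proof.
have := @ge0_integral_even_moment R N N0 k => h.
rewrite /radial_moment /Rintegral; rewrite mul2n -addnn in h.
rewrite -[RHS]/(fine (_ %:E)) -h; congr fine.
by apply: eq_integral => r _; rewrite mulr1.
Qed.

Lemma monomial_norm2_gt0 j : 0 < monomial_norm2 j.
Proof.
rewrite /monomial_norm2 radial_moment_even mulr_gt0//.
  rewrite divr_gt0 ?ltr0n ?fact_gt0// mulr_gt0// exprn_gt0// ltr0n.
  exact: N0.
by rewrite mulr_gt0// pi_gt0.
Qed.

Definition monomial_scale j : R := (Num.sqrt (monomial_norm2 j))^-1.

Lemma monomial_scale_sq j : monomial_scale j ^+ 2 = (monomial_norm2 j)^-1.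
Proof. by rewrite /monomial_scale exprVn sqr_sqrtr// ltW// monomial_norm2_gt0. Qed.

Definition orthonormal_monomial j z : R[i] :=
  (monomial_scale j)%:C%C * to_complex z ^+ j.
Local Notation phi := orthonormal_monomial.

Definition gram_entry u j k : R[i] :=
  cintegral m (fun z => phi j z * (phi k z)^*%C * (u z)%:C%C).

Definition gram_matrix u : 'M[R[i]]_N := \matrix_(j < N, k < N) gram_entry u j k.

Lemma pairing_phi j k u z : phi j z * (phi k z)^*%C * (u z)%:C%C =
  (monomial_scale j * monomial_scale k)%:C%C * monomial_pairing j k u z.
Proof.
have conjM (x y : R[i]) : conjc (x * y) = conjc x * conjc y by exact: rmorphM.
rewrite /phi conjM conjc_real /monomial_pairing rmorphM; ring.
Qed.

Lemma gram_entryE j k (chi : R -> R) alpha u :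
  measurable_fun setT chi -> (forall r, `|chi r| <= 1) -> 0 < alpha <= pi ->
  measurable_fun setT u ->
  (forall r t, 0 < r -> - pi < t < pi -> t != 0 ->
    u (polar (r, t)) = chi r * (- alpha <= t <= alpha)%R%:R) ->
  gram_entry u j k = (monomial_scale j * monomial_scale k *
    (radial_moment N chi (j + k) * (2 * sector_coef (j%:R - k%:R) alpha)))%:C%C.
Proof.
move=> mchi chi1 ha mu_ hu.
have [ii e] := gram_integral N0 j k mchi chi1 ha mu_ hu.
rewrite /gram_entry; under [X in cintegral _ X]eq_fun do rewrite pairing_phi.
by rewrite cintegralZ// e -rmorphM.
Qed.

Let pi_itv : 0 < (pi : R) <= pi. Proof. by rewrite pi_gt0 lexx. Qed.

Lemma cintegrable_pairing j k :
  cintegrable m (fun z => phi j z * (phi k z)^*%C).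
Proof.
have [||||ii _] := @gram_integral R N N0 j k (fun=> 1) pi (fun=> 1) _ _ pi_itv.
- exact: measurable_cst.
- by move=> r; rewrite normr1.
- exact: measurable_cst.
- by move=> r t _ /andP[t1 t2] _; rewrite !ltW// mulr1.
have -> : (fun z => phi j z * (phi k z)^*%C) = (fun z =>
    (monomial_scale j * monomial_scale k)%:C%C * monomial_pairing j k (fun=> 1) z).
  by apply/funext => z; rewrite -pairing_phi mulr1.
exact: cintegrableZ.
Qed.

Definition bounded_weight u := measurable_fun setT u /\ (forall z, `|u z| <= 1).

Lemma cintegrable_gram j k u : bounded_weight u ->
  cintegrable m (fun z => phi j z * (phi k z)^*%C * (u z)%:C%C).
Proof. by move=> [mu_ u1]; apply: cintegrable_bounded => //; exact: cintegrable_pairing. Qed.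

Lemma sin_natpi (n : nat) : sin (n%:R * pi) = 0 :> R.
Proof.
elim: n => [|n IH]; first by rewrite mul0r sin0.
by rewrite -natr1 mulrDl mul1r sinDpi IH oppr0.
Qed.

Lemma gram_matrix1 : gram_matrix (fun=> 1) = 1%:M.
Proof.
apply/matrixP => j k; rewrite !mxE.
rewrite (@gram_entryE j k (fun=> 1) pi) //; last 2 first.
- by move=> r; rewrite normr1.
- by move=> r t _ /andP[t1 t2] _; rewrite !ltW// mulr1.
rewrite /sector_coef; have [->|jk] := eqVneq j k.
  rewrite subrr eqxx -expr2 monomial_scale_sq mulVf//.
  by rewrite gt_eqF// monomial_norm2_gt0.
rewrite subr_eq0 eqr_nat val_eqE (negbTE jk).
suff -> : sin ((j%:R - k%:R) * pi) = 0 :> R by rewrite mul0r !mulr0.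
by rewrite mulrBl sinB !sin_natpi mul0r mulr0 subrr.
Qed.

Lemma gram_matrixB u w : bounded_weight u -> bounded_weight w ->
  gram_matrix (fun z => u z - w z) = gram_matrix u - gram_matrix w.
Proof.
move=> bu bw; apply/matrixP => j k; rewrite !mxE /gram_entry.
rewrite -[X in _ = _ + X]mulN1r -cintegralZ; last exact: cintegrable_gram.
rewrite -cintegralD; [|exact: cintegrable_gram|
  apply: cintegrableZ; exact: cintegrable_gram].
congr cintegral; apply/funext => z; rewrite rmorphB; ring.
Qed.

Local Open Scope sesquilinear_scope.

Lemma gram_matrix_herm u : bounded_weight u -> (gram_matrix u) ^t* = gram_matrix u.
Proof.
move=> bu; apply/matrixP => j k; rewrite !mxE /gram_entry.
rewrite -[LHS]/(conjc _) -cintegral_conj; last exact: cintegrable_gram.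
have conjM (x y : R[i]) : conjc (x * y) = conjc x * conjc y by exact: rmorphM.
congr cintegral; apply/funext => z; rewrite conjM conjc_real.
by rewrite (conjM (phi k z)) conjcK; congr (_ * _); exact: mulrC.
Qed.

(** The quadratic form at v is the integral of u |sum_j v_j phi_j|^2. *)
Lemma gram_quadratic_ge0 u (v : 'rV[R[i]]_N) : bounded_weight u ->
  (forall z, 0 <= u z) -> 0 <= (v *m gram_matrix u *m v ^t*) 0 0.
Proof.
move=> bu u0.
pose S z := \sum_(j < N) v 0 j * phi j z.
have conjM (x y : R[i]) : conjc (x * y) = conjc x * conjc y by exact: rmorphM.
have conjS (F : 'I_N -> R[i]) : conjc (\sum_i F i) = \sum_i conjc (F i).
  by rewrite raddf_sum.
have SE z : S z * conjc (S z) * (u z)%:C%C = \sum_k \sum_j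
    v 0 j * conjc (v 0 k) * (phi j z * conjc (phi k z) * (u z)%:C%C).
  rewrite exchange_big /S conjS big_distrlr mulr_suml; apply: eq_bigr => j _.
  rewrite mulr_suml; apply: eq_bigr => k _; rewrite (conjM (v 0 k)).
  by rewrite mulrA; congr (_ * _); exact: mulrACA.
have -> : (v *m gram_matrix u *m v ^t*) 0 0 =
    cintegral m (fun z => S z * conjc (S z) * (u z)%:C%C).
  under [X in cintegral _ X]eq_fun do rewrite SE.
  rewrite cintegral_sum; last first.
    move=> k; apply: cintegrable_sum => j; apply: cintegrableZ.
    exact: cintegrable_gram.
  rewrite !mxE; apply: eq_bigr => k _; rewrite cintegral_sum; last first.
    by move=> j; apply: cintegrableZ; exact: cintegrable_gram.
  rewrite !mxE mulr_suml; apply: eq_bigr => j _.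
  rewrite cintegralZ; last exact: cintegrable_gram.
  by rewrite !mxE -[Num.conj _]/(conjc _) /gram_entry; ring.
rewrite lecE; apply/andP; split.
- rewrite Im_cintegral /= /Rintegral integral0_eq// => z _; congr (_%:E).
  rewrite complex_ImM /= mulr0 add0r.
  suff -> : complex.Im (S z * conjc (S z)) = 0 by rewrite mul0r.
  by rewrite complex_ImM; case: (S z) => a b /=; ring.
- rewrite Re_cintegral; apply: Rintegral_ge0 => z _.
  rewrite complex_ReM /= mulr0 subr0 mulr_ge0//.
  rewrite complex_ReM; case: (S z) => a b /=.
  by rewrite mulrN opprK addr_ge0// -expr2 sqr_ge0.
Qed.

End orthonormal_monomials.

(** * The generating function of a count of points *)

Lemma mnormalizeE d (T : measurableType d) (R : realType)
    (mu : {measure set T -> \bar R}) (P : probability T R) (Z : R) (A : set T) :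
  0 < Z -> mu setT = Z%:E -> mnormalize mu P A = (mu A * (Z^-1)%:E)%E.
Proof.
by move=> Z0 muT; rewrite /mnormalize muT eqe gt_eqF.
Qed.

Section ginibre_spectrum.
Context {R : realType}.
Variable N : nat.
Hypothesis N0 : (0 < N)%N.
Local Notation m := (gauss_weight (R := R) N).
Local Notation T := (tuple_measure (gauss_weight (R := R) N) (n := N)).
Variable p : pred (plane R).
Hypothesis mp : measurable_fun setT p.

Definition indicator_gram : 'M[R[i]]_N := gram_matrix N (fun z => (p z)%:R).
Local Notation M := indicator_gram.

Let b (z : plane R) : R := (p z)%:R.

Let bounded_b : bounded_weight b.
Proof.
split; last by move=> z; rewrite /b; case: (p z); rewrite ?normr1 ?normr0.
have -> : b = fun z => if p z then 1 else 0 by apply/funext => z; rewrite /b; case: (p z).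
exact: measurable_fun_ifT.
Qed.

Let bounded_1 : bounded_weight (fun _ : plane R => 1 : R).
Proof. by split => [|z]; [exact: measurable_cst|rewrite normr1]. Qed.

Local Open Scope sesquilinear_scope.

(** Both 1_p and 1 - 1_p are non-negative, and the Gram matrix of the weight 1 is
    the identity. *)
Lemma indicator_gram_contraction (v : 'rV[R[i]]_N) :
  0 <= (v *m M *m v ^t*) 0 0 <= (v *m v ^t*) 0 0.
Proof.
apply/andP; split.
  by apply: gram_quadratic_ge0 => // z; rewrite ler0n.
have := @gram_quadratic_ge0 R N N0 (fun z => 1 - b z) v.
rewrite gram_matrixB// gram_matrix1// mulmxBr mulmxBl mulmx1.
rewrite [X in _ -> _ -> 0 <= X]mxE [X in _ -> _ -> 0 <= _ + X]mxE subr_ge0; apply.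
- split; first by apply: measurable_funB => //; case: bounded_b.
  by move=> z; rewrite /b; case: (p z); rewrite ?subrr ?subr0 ?normr1 ?normr0.
- by move=> z; rewrite /b; case: (p z); rewrite ?subrr ?subr0.
Qed.

Let cnt (z : N.-tuple (plane R)) : nat := #|[pred k | p (tnth z k)]|.

Let prod_weight (x : R) (z : N.-tuple (plane R)) :
  \prod_i (1 + (x - 1) * b (tnth z i)) = x ^+ cnt z.
Proof.
rewrite /cnt -prodr_const [RHS]big_mkcond /=; apply: eq_bigr => i _.
by rewrite inE /b; case: (p _) => /=; ring.
Qed.

Let K : R := (\prod_(j < N) monomial_scale N j) ^+ 2.

Let K_gt0 : 0 < K.
Proof.
rewrite exprn_gt0// prodr_gt0// => j _.
by rewrite invr_gt0 sqrtr_gt0 monomial_norm2_gt0.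
Qed.

(** The identity of Andreief for the weight 1 + (x - 1) 1_p, whose product over the
    points is x to the power of the count. *)
Lemma ginibre_generating_integral (x : R) :
  cintegrable T (fun z => (K * vandermonde_sq z * x ^+ cnt z)%:C%C) /\
  cintegral T (fun z => (K * vandermonde_sq z * x ^+ cnt z)%:C%C) =
  N`!%:R * \det (1%:M + (x - 1)%:C%C *: M).
Proof.
pose u z : R[i] := (1 + (x - 1) * b z)%:C%C.
pose f (j : 'I_N) := orthonormal_monomial (R := R) N j.
have uE j k z : f j z * (f k z)^*%C * u z =
    f j z * (f k z)^*%C * (1 : R)%:C%C +
    (x - 1)%:C%C * (f j z * (f k z)^*%C * (b z)%:C%C).
  by rewrite /u rmorphD rmorphM; ring.
have fi j k : cintegrable m (fun z => f j z * (f k z)^*%C * u z).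
  under eq_fun do rewrite uE; apply: cintegrableD.
    exact: cintegrable_gram.
  by apply: cintegrableZ; exact: cintegrable_gram.
have [iF eF] := andreief fi.
have FE : (fun z : N.-tuple (plane R) => \det (\matrix_(i, j) f j (tnth z i)) *
    (\det (\matrix_(i, j) f j (tnth z i)))^*%C * \prod_i u (tnth z i)) =
    (fun z => (K * vandermonde_sq z * x ^+ cnt z)%:C%C).
  apply/funext => z; rewrite rmorphM -prod_weight rmorph_prod.
  congr (_ * _); exact: (vandermonde_sqE (fun j : 'I_N => monomial_scale N j) z).
rewrite -FE; split => //; rewrite eF; congr (_ * \det _).
apply/matrixP => j k; rewrite !mxE; under [X in cintegral _ X]eq_fun do rewrite uE.
rewrite cintegralD; [|exact: cintegrable_gram|
  by apply: cintegrableZ; exact: cintegrable_gram].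
rewrite cintegralZ; last exact: cintegrable_gram.
congr (_ + _).
by have /matrixP/(_ j k) := @gram_matrix1 R N N0; rewrite !mxE => <-.
Qed.

Let A k := @count_points R N p @^-1` [set k%:R].

Let mA k : measurable (A k).
Proof.
by rewrite -[A k]setTI; apply: (measurable_count_points mp).
Qed.

(** The integral at x = 1 is the normalizing constant; the expansion of x to the
    power of the count over the values of the count gives the probabilities. *)
Lemma ginibre_count_spectrum : exists s : seq R,
  [/\ size s = N, probabilities s,
    forall x : R, \sum_(k < N.+1) fine (ginibre R N
        (@count_points R N p @^-1` [set k%:R])) * x ^+ k =
      \prod_(l <- s) (1 - l + l * x) &
    (bernoulli_var s)%:C%C = \tr M - \tr (M *m M)].
Proof.
have [s [ss ps ds vs]] := contraction_spectrum
  (gram_matrix_herm N0 bounded_b) indicator_gram_contraction.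
exists s; split => // x.
have H y : T.-integrable setT (EFin \o fun z => K * vandermonde_sq z * y ^+ cnt z) /\
    \int[T]_z (K * vandermonde_sq z * y ^+ cnt z) =
    N`!%:R * \prod_(l <- s) (1 - l + l * y).
  have [[ir _] e] := ginibre_generating_integral y.
  split; first exact: ir.
  move: e; rewrite cintegral_real ds -[N`!%:R](rmorph_nat (real_complex R)).
  by rewrite -rmorphM => -[].
have Kn : K != 0 by rewrite gt_eqF.
have V y : T.-integrable setT (fun z => (vandermonde_sq z * y ^+ cnt z)%:E) /\
    \int[T]_z (vandermonde_sq z * y ^+ cnt z) =
    K^-1 * (N`!%:R * \prod_(l <- s) (1 - l + l * y)).
  have [iH eH] := H y.
  have E z : vandermonde_sq z * y ^+ cnt z = K^-1 * (K * vandermonde_sq z * y ^+ cnt z).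
    by rewrite -mulrA mulKf.
  split; last by rewrite -eH -RintegralZl//; apply: eq_Rintegral => z _; exact: E.
  apply: eq_integrable (integrableZl measurableT K^-1 iH) => // z _.
  by rewrite [in RHS]E EFinM.
have [iV eV] := V 1.
have {}iV : T.-integrable setT (EFin \o @vandermonde_sq R N).
  by apply: eq_integrable iV => // z _; rewrite expr1n mulr1.
have {}eV : \int[T]_z (vandermonde_sq z) = K^-1 * N`!%:R.
  transitivity (\int[T]_z (vandermonde_sq z * 1 ^+ cnt z)).
    by apply: eq_Rintegral => z _; rewrite expr1n mulr1.
  rewrite eV big1 ?mulr1// => l _; ring.
have Z0 : 0 < K^-1 * N`!%:R :> R by rewrite mulr_gt0 ?invr_gt0// ltr0n fact_gt0.
have ZE : ginibre_weight [set: N.-tuple (plane R)] = (K^-1 * N`!%:R)%:E.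
  by rewrite -eV /Rintegral fineK//; exact: (integrable_fin_num measurableT iV).
have wfin k : ginibre_weight (A k) \is a fin_num.
  have iA := integrableS measurableT (mA k) (@subsetT _ _) iV.
  exact: (integrable_fin_num (mA k) iA).
have PE k : fine (ginibre R N (A k)) =
    fine (ginibre_weight (A k)) / (K^-1 * N`!%:R).
  by rewrite [X in fine X](mnormalizeE _ _ Z0 ZE) fineM ?wfin.
transitivity ((\sum_(k < N.+1) fine (ginibre_weight (A k)) * x ^+ k) /
    (K^-1 * N`!%:R)).
  by rewrite mulr_suml; apply: eq_bigr => k _; rewrite PE mulrAC.
have -> : \sum_(k < N.+1) fine (ginibre_weight (A k)) * x ^+ k =
    K^-1 * (N`!%:R * \prod_(l <- s) (1 - l + l * x)).
  have [iVx <-] := V x.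
  apply: EFin_inj; rewrite /Rintegral [RHS]fineK ?(integrable_fin_num iVx)//.
  rewrite -sumEFin.
  transitivity (\int[T]_z (\sum_(k < N.+1) (x ^+ k)%:E *
      (vandermonde_sq z * \1_(A k) z)%:E))%E.
    have iVA k : T.-integrable setT (fun z => (vandermonde_sq z * \1_(A k) z)%:E).
      apply: (le_integrable _ _ _ iV) => //.
        have /measurable_EFinP mV := measurable_int _ iV.
        by apply/measurable_EFinP; apply: measurable_funM.
      move=> z _; rewrite /= lee_fin normrM ler_piMr// indicE.
      by case: (_ \in _); rewrite ?normr1 ?normr0.
    rewrite integral_sum//; last by move=> k; exact: integrableZl.
    apply: eq_bigr => k _; rewrite integralZl//.
    rewrite EFinM fineK// muleC; congr (_ * _)%E.
    rewrite /ginibre_weight [LHS]integral_mkcond; apply: eq_integral => z _.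
    by rewrite patchE indicE; case: ifP; rewrite ?mulr1 ?mulr0.
  apply: eq_integral => z _.
  have cN : (cnt z < N.+1)%N.
    by rewrite ltnS /cnt (leq_trans (max_card _))// card_ord.
  have cA k : (z \in A k) = (cnt z == k).
    apply/idP/eqP => [/set_mem /= /eqP|<-]; last exact/mem_set.
    by rewrite /count_points eqr_nat => /eqP.
  rewrite (bigD1 (Ordinal cN))//= big1 ?adde0.
    by rewrite indicE cA eqxx mulr1 -EFinM mulrC.
  move=> k kc; have kc' : (cnt z == k) = false.
    by apply/negbTE; move: kc; rewrite -val_eqE/= eq_sym.
  by rewrite indicE cA kc' mulr0 mule0.
  exact: (integrable_fin_num measurableT iVx).
by rewrite (mulrA K^-1) mulrAC divff ?mul1r// gt_eqF.
Qed.

End ginibre_spectrum.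

(** * Trigonometric sums *)

Section sector_sums.
Context {R : realType}.
Implicit Types (c x alpha : R) (K N L m : nat).

Lemma is_derive_sector_coef c x : is_derive x 1 (sector_coef c) (cos (c * x)).
Proof.
rewrite /sector_coef; have [->|c0] := eqVneq c 0.
  by rewrite mul0r cos0; exact: derive_rule_id.
by derive_fun; field.
Qed.

Lemma sector_coef_at0 c : sector_coef c 0 = 0 :> R.
Proof. by rewrite /sector_coef mulr0 sin0 mul0r; case: ifP. Qed.

Lemma sector_coefN c x : sector_coef (- c) x = sector_coef c x.
Proof.
by rewrite /sector_coef oppr_eq0 mulNr sinN invrN mulrNN.
Qed.

Lemma sector_coef_natpi (m n : nat) :
  sector_coef (m%:R - n%:R) pi = if m == n then pi else 0 :> R.
Proof.
rewrite /sector_coef subr_eq0 eqr_nat; case: eqVneq => // _.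
by rewrite mulrBl sinB !sin_natpi mul0r mulr0 subrr mul0r.
Qed.

(** With T the cosine sum of the Fourier coefficients of the indicator of
    [-alpha, alpha], integrate (1 - T)^2 over [0, alpha] and T^2 over [alpha, pi].
    Both are non-negative, and their sum is alpha - 2 U(alpha) + G(pi) for the
    primitives U of T and G of T^2 that vanish at 0. The orthogonality of the
    cosines makes U(alpha) and G(pi) equal to 1 / pi times the left-hand side. *)
Lemma sector_bessel K alpha : 0 < alpha <= pi ->
  alpha ^+ 2 + 2 * \sum_(m < K) sector_coef m.+1%:R alpha ^+ 2 <= pi * alpha.
Proof.
move=> /andP[alpha0 alphapi]; have pi0 : (pi : R) != 0 by rewrite gt_eqF// pi_gt0.
pose s m : R := sector_coef m%:R alpha.
(* the cosine coefficients of the indicator of [-alpha, alpha] *)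
pose a m : R := (if m == 0%N then 1 else 2) * s m / pi.
pose T x : R := \sum_(m < K.+1) a m * cos (m%:R * x).
pose U x : R := \sum_(m < K.+1) a m * sector_coef m%:R x.
pose G x : R := \sum_(m < K.+1) \sum_(n < K.+1) a m * a n / 2 *
  (sector_coef (m%:R + n%:R) x + sector_coef (m%:R - n%:R) x).
have dU x : is_derive x 1 U (T x).
  apply: derive_rule_sum => m; have d := is_derive_sector_coef m%:R x.
  apply: derive_rule_eq (derive_ruleM (derive_rule_cst (a m) x) d) _.
  by rewrite mulr0 addr0.
have dG x : is_derive x 1 G (T x ^+ 2).
  rewrite expr2 /T big_distrlr /G /=.
  apply: derive_rule_sum => m; apply: derive_rule_sum => n.
  have d1 := is_derive_sector_coef (m%:R + n%:R) x.
  have d2 := is_derive_sector_coef (m%:R - n%:R) x.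
  apply: derive_rule_eq (derive_ruleM (derive_rule_cst (a m * a n / 2) x)
    (derive_ruleD d1 d2)) _.
  by rewrite mulr0 addr0 mulrDl mulrBl cosD cosB; field.
have [c _ e1] := MVT_is_derive (ltW alpha0) (fun x _ =>
  derive_ruleD (derive_ruleD (derive_rule_id x)
    (derive_ruleM (derive_rule_cst (- 2) x) (dU x))) (dG x)).
have [c' _ e2] := MVT_is_derive alphapi (fun x _ => dG x).
have U0 : U 0 = 0 by rewrite /U big1// => m _; rewrite sector_coef_at0 mulr0.
have G0 : G 0 = 0.
  by rewrite /G big1// => m _; rewrite big1// => n _; rewrite !sector_coef_at0 addr0 mulr0.
have key : 0 <= alpha - 2 * U alpha + G pi.
  have h1 : 0 <= (1 + (- 2 * T c + U c * 0) + T c ^+ 2) * (alpha - 0).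
    rewrite subr0 mulr_ge0 ?(ltW alpha0)//.
    rewrite (_ : _ + _ = (1 - T c) ^+ 2) ?sqr_ge0//; ring.
  have h2 : 0 <= T c' ^+ 2 * (pi - alpha) by rewrite mulr_ge0 ?sqr_ge0// subr_ge0.
  move: h1 h2; rewrite -e1 -e2 U0 G0 => h1 h2.
  lra.
pose S : R := alpha ^+ 2 + 2 * \sum_(m < K) sector_coef m.+1%:R alpha ^+ 2.
have s0 : s 0%N = alpha by rewrite /s /sector_coef eqxx.
have UE : U alpha = S / pi.
  rewrite /U big_ord_recl /= {1}/a /= -/(s 0%N) s0 /S [RHS]mulrDl; congr (_ + _).
    by move: (pi : R) pi0 => q q0; field.
  rewrite mulr_sumr mulr_suml; apply: eq_bigr => m _.
  by rewrite /a /= /bump /= add1n -/(s m.+1); move: (pi : R) pi0 => q q0; field.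
have GE : G pi = S / pi.
  rewrite /G.
  have E (m : 'I_K.+1) : \sum_(n < K.+1) a m * a n / 2 *
      (sector_coef (m%:R + n%:R) pi + sector_coef (m%:R - n%:R) pi) =
      (if (m : nat) == 0%N then 2 else 1) * a m ^+ 2 / 2 * pi.
    rewrite (bigD1 m)//= big1 ?addr0.
      rewrite sector_coef_natpi eqxx -natrD -[X in sector_coef X](subr0 _).
      rewrite (sector_coef_natpi _ 0) addn_eq0 andbb.
      by case: ifP => _; ring.
    move=> n nm; rewrite sector_coef_natpi eq_sym.
    have -> : ((n : nat) == m) = false by apply/negbTE.
    rewrite -natrD -[X in sector_coef X](subr0 _).
    rewrite (sector_coef_natpi _ 0) addn_eq0.
    have -> : ((m : nat) == 0%N) && ((n : nat) == 0%N) = false.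
      by apply/negbTE/negP => /andP[/eqP m0 /eqP n0]; move: nm; rewrite -val_eqE/= m0 n0.
    by rewrite addr0 mulr0.
  under eq_bigr do rewrite E.
  rewrite big_ord_recl /= {1}/a /= s0 /S [RHS]mulrDl; congr (_ + _).
    by move: (pi : R) pi0 => q q0; field.
  rewrite mulr_sumr mulr_suml; apply: eq_bigr => m _.
  by rewrite /a /= /bump /= add1n -/(s m.+1); move: (pi : R) pi0 => q q0; field.
move: key; rewrite UE GE -/S => key.
rewrite -ler_pdivrMl ?pi_gt0// mulrC; lra.
Qed.

(** A square of side N has N - m entries on each of the two diagonals at distance
    m > 0 from the main one. *)
Lemma sum_toeplitz (f : nat -> R) (g : nat -> nat -> R) N :
  (forall j, g j j = f 0%N) -> (forall j m, g j (j + m.+1)%N = f m.+1) ->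
  (forall j m, g (j + m.+1)%N j = f m.+1) ->
  N%:R * (f 0%N + 2 * \sum_(m < N) f m.+1) - \sum_(j < N) \sum_(k < N) g j k =
  2 * \sum_(m < N) m.+1%:R * f m.+1.
Proof.
move=> g0 gr gl; elim: N => [|N IH]; first by rewrite !big_ord0 mul0r mulr0 subrr.
have -> : \sum_(j < N.+1) \sum_(k < N.+1) g j k =
    \sum_(j < N) \sum_(k < N) g j k + (f 0%N + 2 * \sum_(m < N) f m.+1).
  rewrite big_ord_recr /= big_ord_recr /= g0.
  under eq_bigr do rewrite big_ord_recr /=.
  rewrite big_split /=.
  have refl (h : nat -> R) (hh : forall i, (i < N)%N -> h i = f (N - i)%N) :
      \sum_(i < N) h i = \sum_(m < N) f m.+1.
    rewrite [RHS](reindex_inj rev_ord_inj) /=; apply: eq_bigr => i _.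
    by rewrite hh// subnSK.
  rewrite (refl (fun j => g j N)); last first.
    by move=> i iN; rewrite -{1}(subnKC (ltnW iN)) -(subnSK iN) gr.
  rewrite (refl (fun k => g N k)); last first.
    by move=> i iN; rewrite -{1}(subnKC (ltnW iN)) -(subnSK iN) gl.
  ring.
rewrite !big_ord_recr /= [RHS]mulrDr -IH -natr1; ring.
Qed.

Lemma ln_le_harmonic L N : (L <= N)%N ->
  ln (N.+1%:R / L.+1%:R) <= \sum_(L <= m < N) m.+1%:R^-1 :> R.
Proof.
elim: N => [|N IH]; first by rewrite leqn0 => /eqP->; rewrite big_geq// divff// ln1.
rewrite leq_eqVlt => /orP[/eqP->|LN].
  by rewrite big_geq// divff ?ln1.
rewrite big_nat_recr//= (_ : _ / _ = N.+1%:R / L.+1%:R * (N.+2%:R / N.+1%:R)); last first.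
  have [a0 b0] : N.+1%:R != 0 :> R /\ L.+1%:R != 0 :> R by rewrite !pnatr_eq0.
  by move: (N.+1%:R : R) (N.+2%:R : R) (L.+1%:R : R) a0 b0 => x y z x0 z0; field; rewrite x0 z0.
rewrite lnM ?posrE ?divr_gt0//; apply: lerD; first exact: IH.
rewrite (_ : _ / _ = 1 + N.+1%:R^-1).
  by apply: le_ln1Dx; rewrite (lt_trans (ltrN10 _)).
by rewrite -[N.+2]addn1 natrD mulrDl divff// mul1r.
Qed.

(** sin(x)^2 + sin(x + y)^2 >= 1 - |cos y|: pairing the terms m and m + L, at angles
    L alpha apart, leaves a part of the harmonic series. *)
Lemma sector_sum_lower L N alpha : (0 < L)%N ->
  (1 - `|cos (L%:R * alpha)|) * ln (N.+1%:R / L.+1%:R) <=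
  2 * \sum_(m < N) sin (m.+1%:R * alpha) ^+ 2 / m.+1%:R.
Proof.
move=> L0; set f := fun m : nat => sin (m.+1%:R * alpha) ^+ 2 / m.+1%:R.
have f0 m : 0 <= f m by rewrite divr_ge0 ?sqr_ge0.
have kappa0 : 0 <= 1 - `|cos (L%:R * alpha)|.
  by rewrite subr_ge0 cos_max.
have [NL|LN] := ltnP N L.
  apply: (@le_trans _ _ 0); last first.
    by rewrite mulr_ge0// sumr_ge0// => m _; exact: f0.
  rewrite mulr_ge0_le0// ln_le0// ler_pdivrMr// mul1r ler_nat ltnS.
  exact: ltnW.
apply: (le_trans (ler_wpM2l kappa0 (ln_le_harmonic LN))).
rewrite mulr_sumr mulr2n mulrDl mul1r.
have -> : \sum_(L <= m < N) (1 - `|cos (L%:R * alpha)|) * m.+1%:R^-1 =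
   \sum_(m < N - L) (1 - `|cos (L%:R * alpha)|) * (m + L).+1%:R^-1.
  by rewrite -{1}(add0n L) big_addn big_mkord.
apply: (@le_trans _ _ (\sum_(m < N - L) f m + \sum_(m < N - L) f (m + L)%N)).
  rewrite -big_split /=; apply: ler_sum => m _; rewrite /f.
  apply: (@le_trans _ _ ((sin (m.+1%:R * alpha) ^+ 2 +
      sin ((m + L).+1%:R * alpha) ^+ 2) / (m + L).+1%:R)); last first.
    rewrite mulrDl lerD2r ler_wpM2l ?sqr_ge0// lef_pV2 ?posrE// ler_nat ltnS.
    exact: leq_addr.
  rewrite ler_wpM2r//; rewrite -addSn natrD mulrDl sinD.
  set x := m.+1%:R * alpha; set y := L%:R * alpha.
  have := cos2Dsin2 x; have := cos2Dsin2 y.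
  move: (cos x) (sin x) (cos y) (sin y) => cx sx cy sy hy hx.
  (* sin(x)^2 + sin(x + y)^2 = 1 - cos y cos(2 x + y) *)
  have -> : sx ^+ 2 + (sx * cy + cx * sy) ^+ 2 =
      1 - cy * ((cx ^+ 2 - sx ^+ 2) * cy - 2 * sx * cx * sy).
    have h2 : sx ^+ 2 = 1 - cx ^+ 2 by lra.
    have h1 : sy ^+ 2 = 1 - cy ^+ 2 by lra.
    ring: h1 h2.
  rewrite lerD2l lerN2 (le_trans (ler_norm _))// normrM ler_piMr//.
  rewrite -(@ler_pXn2r _ 2)// ?nnegrE// expr1n real_normK ?num_real//.
  have e1 : (cx ^+ 2 + sx ^+ 2) ^+ 2 * (cy ^+ 2 + sy ^+ 2) = 1.
    by rewrite hx hy expr1n mulr1.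
  rewrite -[leRHS]e1.
  rewrite -subr_ge0 (_ : _ - _ = ((cx ^+ 2 - sx ^+ 2) * sy + 2 * sx * cx * cy) ^+ 2).
    exact: sqr_ge0.
  ring.
apply: lerD.
  rewrite -!(big_mkord xpredT f) [leRHS](@big_cat_nat _ _ _ (N - L))//= ?leq_subr//.
  by rewrite lerDl sumr_ge0// => m _; exact: f0.
rewrite -(big_mkord xpredT f) (@big_cat_nat _ _ _ L)//=.
have -> : \sum_(L <= i < N) f i = \sum_(m < N - L) f (m + L)%N.
  by rewrite -{1}(add0n L) big_addn big_mkord.
rewrite lerDr sumr_ge0// => m _; exact: f0.
Qed.

End sector_sums.

(** * Variance of the count in a sector *)

Section gram_variance.
Context {R : realType}.
Variable N : nat.

Lemma gram_variance (M : 'M[R[i]]_N) (r : nat -> nat -> R) (v : R) :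
  (forall j k, M j k = (r j k)%:C%C) -> v%:C%C = \tr M - \tr (M *m M) ->
  v = \sum_(j < N) (r j j - \sum_(k < N) r j k * r k j).
Proof.
move=> Mr; have -> : \tr M - \tr (M *m M) =
    (\sum_(j < N) (r j j - \sum_(k < N) r j k * r k j))%:C%C.
  rewrite /mxtrace -sumrB rmorph_sum; apply: eq_bigr => j _.
  rewrite rmorphB Mr mxE rmorph_sum; congr (_ - _); apply: eq_bigr => k _.
  by rewrite !Mr rmorphM.
by case.
Qed.

Hypothesis N0 : (0 < N)%N.
Local Notation moment := (radial_moment (R := R) N (fun=> 1)).

Lemma monomial_scale_gt0 j : 0 < monomial_scale N j :> R.
Proof. by rewrite invr_gt0 sqrtr_gt0 monomial_norm2_gt0. Qed.

Lemma radial_moment_ge0 n : 0 <= moment n.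
Proof.
rewrite /radial_moment; apply: Rintegral_ge0 => r _; rewrite mulr1.
rewrite /gauss_radial /positive_part_weight; case: ltP => [r0|_].
  by rewrite !mulr_ge0 ?expR_ge0 ?exprn_ge0// ltW.
by rewrite !mulr0.
Qed.

(** Cauchy-Schwarz for the normalized monomials, in the pointwise form
    2 A B r^(j+k) <= (A r^j)^2 + (B r^k)^2. *)
Lemma normalized_moment_le1 j k :
  monomial_scale N j * monomial_scale N k * moment (j + k) * (2 * pi) <= 1.
Proof.
have m1 : measurable_fun setT (fun _ : R => 1 : R) by exact: measurable_cst.
have b1 (r : R) : `|1 : R| <= 1 by rewrite normr1.
have ii n := integrable_radial N0 n m1 b1.
have iZ c n : (@lebesgue_measure R).-integrable setT
    (EFin \o (fun r => c * (r ^+ n * 1 * gauss_radial N r))).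
  rewrite (_ : _ \o _ = fun r => (c%:E * (r ^+ n * 1 * gauss_radial N r)%:E)%E).
    by apply: integrableZl => //; exact: ii.
  by apply/funext => r; rewrite /= EFinM.
pose A : R := monomial_scale N j; pose B : R := monomial_scale N k.
have h : A * B * moment (j + k) <=
    A ^+ 2 / 2 * moment (j + j) + B ^+ 2 / 2 * moment (k + k).
  rewrite /radial_moment -!RintegralZl//; try exact: ii.
  rewrite -RintegralD//.
  apply: le_Rintegral => //; first exact: (integrableD _ (iZ _ _) (iZ _ _)).
  move=> r _; rewrite !mulr1 -subr_ge0.
  rewrite (_ : _ - _ = (A * r ^+ j - B * r ^+ k) ^+ 2 / 2 * gauss_radial N r).
    by apply: mulr_ge0 (gauss_radial_ge0 _ _); rewrite divr_ge0 ?sqr_ge0.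
  by rewrite !exprD; field.
have e l : monomial_scale N l ^+ 2 * moment (l + l) * (2 * pi) = 1.
  rewrite (monomial_scale_sq N0) -mulrA -/(monomial_norm2 N l) mulVf// gt_eqF//; exact: monomial_norm2_gt0.
have q0 : 0 <= 2 * pi :> R by rewrite mulr_ge0 ?pi_ge0.
apply: (le_trans (ler_wpM2r q0 h)).
rewrite mulrDl.
have e' l : monomial_scale N l ^+ 2 / 2 * moment (l + l) * (2 * pi) = 2^-1.
  by rewrite -[RHS]mulr1 -[X in _ = _ * X](e l); ring.
by rewrite /A /B !e' [leRHS]splitr div1r.
Qed.

End gram_variance.

Section sector_variance.
Context {R : realType}.
Variables (N : nat) (alpha : R).
Hypotheses (N0 : (0 < N)%N) (alpha_itv : 0 < alpha <= pi).

Definition in_sector (z : plane R) := carg z \in `[- alpha, alpha].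

Lemma measurable_in_sector : measurable_fun setT in_sector.
Proof.
rewrite /in_sector; under eq_fun do rewrite in_itv/=.
by apply: measurable_and; apply: measurable_fun_ler => //; exact: measurable_carg.
Qed.

(** The j-th term of tr(M - M^2) is alpha / pi minus the squared norm of row j, and
    alpha / pi is bounded from below by sector_bessel. Summed over the rows, the
    difference is the right-hand side of sum_toeplitz. *)
Lemma sector_variance_lower (v : R) L : (0 < L)%N ->
  v%:C%C = \tr (indicator_gram N in_sector) -
    \tr (indicator_gram N in_sector *m indicator_gram N in_sector) ->
  (1 - `|cos (L%:R * alpha)|) * ln (N.+1%:R / L.+1%:R) / pi ^+ 2 <= v.
Proof.
move=> L0 hv; have [alpha0 alphapi] := andP alpha_itv.
have pi0 : 0 < pi :> R by exact: pi_gt0.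
have m1 : measurable_fun setT (fun _ : R => 1 : R) by exact: measurable_cst.
have b1 (r : R) : `|1 : R| <= 1 by rewrite normr1.
have mb : measurable_fun setT (fun z => (in_sector z)%:R : R).
  rewrite (_ : (fun z => _) = fun z => if in_sector z then 1 else 0); last first.
    by apply/funext => z; case: ifP.
  by apply: measurable_fun_ifT => //; exact: measurable_in_sector.
have hu r t : 0 < r -> - pi < t < pi -> t != 0 ->
    (in_sector (polar (r, t)))%:R = 1 * (- alpha <= t <= alpha)%R%:R :> R.
  by move=> r0 tpi t0; rewrite /in_sector carg_polar// in_itv/= mul1r.
pose g j k : R := monomial_scale N j * monomial_scale N k *
  radial_moment N (fun=> 1) (j + k) * (2 * pi).
pose sg j k : R := sector_coef (j%:R - k%:R) alpha.
have ME j k : indicator_gram N in_sector j k = (g j k * sg j k / pi)%:C%C.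
  rewrite mxE (gram_entryE N0 _ _ m1 b1 alpha_itv mb hu); congr (_%:C%C).
  rewrite /g /sg; move: (sector_coef _ _) (radial_moment _ _ _) => x y.
  by move: (pi : R) (lt0r_neq0 pi0) => q q0; field.
have gE j : g j j = 1.
  rewrite /g -expr2 (monomial_scale_sq N0) -mulrA -/(monomial_norm2 N j) mulVf//.
  by rewrite gt_eqF// monomial_norm2_gt0.
have gC j k : g j k = g k j.
  by rewrite /g addnC (mulrC (monomial_scale N j)).
have sgC j k : sg j k = sg k j by rewrite /sg -opprB sector_coefN.
have g0 j k : 0 <= g j k.
  apply: mulr_ge0; last by rewrite mulr_ge0// pi_ge0.
  apply: mulr_ge0 (radial_moment_ge0 _ _).
  by apply: mulr_ge0; apply: ltW; exact: monomial_scale_gt0.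
have g1 j k : g j k ^+ 2 <= 1.
  by rewrite expr_le1 ?g0//; exact: normalized_moment_le1.
pose f (m : nat) : R := sector_coef m%:R alpha ^+ 2.
have f0 : f 0%N = alpha ^+ 2 by rewrite /f /sector_coef eqxx.
have toep : N%:R * (f 0%N + 2 * \sum_(m < N) f m.+1) -
    \sum_(j < N) \sum_(k < N) sg j k ^+ 2 = 2 * \sum_(m < N) m.+1%:R * f m.+1.
  apply: (sum_toeplitz (g := fun j k => sg j k ^+ 2)) => [j|j m|j m].
  - by rewrite /sg subrr.
  - by rewrite sgC /sg natrD addrAC subrr add0r.
  - by rewrite /sg natrD addrAC subrr add0r.
rewrite ler_pdivrMr ?exprn_gt0//.
apply: (le_trans (sector_sum_lower N alpha L0)).
have -> : \sum_(m < N) sin (m.+1%:R * alpha) ^+ 2 / m.+1%:R =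
    \sum_(m < N) m.+1%:R * f m.+1.
  apply: eq_bigr => m _; rewrite /f /sector_coef pnatr_eq0 /=.
  have : m.+1%:R != 0 :> R by rewrite pnatr_eq0.
  by move: (m.+1%:R : R) (sin _) => x y x0; field.
rewrite -toep (gram_variance (r := fun j k => g j k * sg j k / pi) ME hv) big_split /= sumrN mulrBl.
have -> : \sum_(j < N) g j j * sg j j / pi = N%:R * (alpha / pi).
  rewrite (eq_bigr (fun=> alpha / pi)).
    by rewrite sumr_const card_ord [RHS]mulr_natl.
  by move=> j _; rewrite gE mul1r /sg subrr /sector_coef eqxx.
apply: lerD.
  rewrite -mulrA ler_wpM2l//.
  have -> : alpha / pi * pi ^+ 2 = pi * alpha.
    by move: (pi : R) (lt0r_neq0 pi0) => q q0; field.
  by rewrite f0; exact: sector_bessel.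
rewrite lerN2 mulr_suml; apply: ler_sum => j _.
rewrite mulr_suml; apply: ler_sum => k _.
rewrite (gC k) (sgC k) (_ : _ * _ * pi ^+ 2 = g j k ^+ 2 * sg j k ^+ 2).
  by rewrite ler_piMl ?sqr_ge0.
by move: (pi : R) (lt0r_neq0 pi0) => q q0; field.
Qed.

End sector_variance.

(** * The bound of Stirling and the Poisson weights *)

Section stirling.
Context {R : realType}.
Implicit Types (x y : R) (k : nat).

(** The derivative of the difference of the two sides is c^2 / ((1 + c) (2 + c)^2). *)
Lemma ln_ge_pade x : 0 <= x -> 2 * x / (2 + x) <= ln (1 + x).
Proof.
move=> x0.
have D y : y \in `[0, x] -> is_derive y 1 (fun y => ln (1 + y) - 2 * y / (2 + y))
    ((1 + y)^-1 - 4 / (2 + y) ^+ 2).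
  rewrite in_itv /= => /andP[y0 _].
  have d1 : is_derive y 1 (fun y => ln (1 + y)) ((1 + y)^-1 * (0 + 1)).
    have h : 0 < 1 + y by lra.
    have d : is_derive y 1 (fun y => 1 + y) (0 + 1) by derive_body.
    exact: (@derive_rule_comp _ (@ln R) _ _ _ _ (is_derive1_ln h) d).
  have n2 : 2 + y != 0 by rewrite gt_eqF//; lra.
  have d2 : is_derive y 1 (fun y => 2 * y / (2 + y)) (4 / (2 + y) ^+ 2).
    derive_fun; first exact: n2.
    by field.
  by apply: derive_rule_eq (derive_ruleD d1 (derive_ruleN d2)) _; rewrite add0r mulr1.
have [c /andP[c0 _]] := MVT_is_derive x0 D.
rewrite addr0 ln1 mulr0 mul0r subrr !subr0 -subr_ge0 => ->.
rewrite mulr_ge0// (_ : _ - _ = c ^+ 2 / ((1 + c) * (2 + c) ^+ 2)); last first.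
  field.
  by rewrite !gt_eqF//; lra.
by rewrite divr_ge0 ?sqr_ge0// mulr_ge0 ?sqr_ge0//; lra.
Qed.

(** The induction step is (k + 1/2) ln(1 + 1/k) >= 1, which is ln_ge_pade at 1/k. *)
Lemma ln_fact_le k : (0 < k)%N ->
  ln k`!%:R <= 1 + (k%:R + 2^-1) * ln k%:R - k%:R :> R.
Proof.
case: k => // k _; elim: k => [|k IH]; first by rewrite ln1; lra.
rewrite factS natrM lnM ?posrE ?ltr0n ?fact_gt0//.
apply: (le_trans (lerD (lexx _) IH)).
have k0 : 0 < k.+1%:R :> R by rewrite ltr0n.
have := @ln_ge_pade (k.+1%:R^-1).
rewrite invr_ge0 ltW// => /(_ isT).
have -> : ln (1 + k.+1%:R^-1) = ln k.+2%:R - ln k.+1%:R :> R.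
  rewrite -ln_div ?posrE ?ltr0n//; congr ln.
  by rewrite -[k.+2%:R]natr1 mulrDl divff ?gt_eqF// mul1r.
have -> : 2 * k.+1%:R^-1 / (2 + k.+1%:R^-1) = (k.+1%:R + 2^-1)^-1 :> R.
  move: (k.+1%:R : R) k0 => x x0; field.
  by rewrite !gt_eqF//; lra.
rewrite -[k.+2%:R]natr1.
have p0 : 0 < k.+1%:R + 2^-1 :> R by lra.
rewrite -[X in X <= _ -> _]mulr1 (ler_pdivrMl _ _ p0).
set u := ln (k.+1%:R + 1); set w := ln k.+1%:R; set x := k.+1%:R => h; nra.
Qed.

Lemma ln_ge_1B x y : 0 < x -> 0 < y -> 1 - y / x <= ln x - ln y.
Proof.
move=> x0 y0; rewrite -ln_div ?posrE// -[x / y]invrK lnV ?posrE ?invr_gt0 ?divr_gt0//.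
rewrite invf_div lerNr opprB -[y / x in leLHS](subrK 1) addrC.
apply: le_ln1Dx; rewrite -subr_gt0 opprK subrK divr_gt0//.
Qed.

(** The bound of Stirling for k! and ln(x / k) >= 1 - k / x; S stands for an upper
    bound of the square root of k. *)
Lemma poisson_lower (S x : R) k : 0 < S -> 0 < x -> (0 < k)%N -> k%:R <= S ^+ 2 ->
  k`!%:R * expR (- ((x - k%:R) ^+ 2 / x) - 1) / S <= x ^+ k * expR (- x).
Proof.
move=> S0 x0 k0 kS; have kR : 0 < k%:R :> R by rewrite ltr0n.
have -> : k`!%:R = expR (ln k`!%:R) :> R by rewrite lnK// posrE ltr0n fact_gt0.
have -> : x ^+ k = expR (k%:R * ln x) by rewrite expRM_natl lnK.
have -> : S^-1 = expR (- ln S) by rewrite expRN lnK.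
rewrite -!expRD ler_expR.
have h1 := ln_fact_le k0.
have h2 : k%:R * (1 - k%:R / x) <= k%:R * (ln x - ln k%:R).
  by rewrite ler_wpM2l ?ln_ge_1B// ltW.
have h3 : ln k%:R <= 2 * ln S.
  rewrite mulr_natl -lnXn//.
  by rewrite ler_ln ?posrE ?exprn_gt0.
have e : (x - k%:R) ^+ 2 / x = x - 2 * k%:R + k%:R * (k%:R / x).
  by field; rewrite gt_eqF.
rewrite e; move: h1 h2 h3; move: (ln _) (ln x) (ln k%:R) (ln S) (k%:R / x) => a b c d f.
move: (k%:R : R) => q; lra.
Qed.

End stirling.

(** * Variance of the count in an annulus *)

Section annulus_variance.
Context {R : realType}.
Variable N : nat.
Hypothesis N0 : (0 < N)%N.
Local Notation mu := (@lebesgue_measure R).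
Local Notation moment := (radial_moment (R := R) N).

Lemma radial_moment_lower (chi : R -> R) (c d C : R) k :
  measurable_fun setT chi -> (forall r, 0 <= chi r <= 1) -> c <= d -> 0 <= C ->
  (forall r, c < r < d -> chi r = 1 /\ C <= r ^+ (k + k) * gauss_radial N r) ->
  C * (d - c) <= moment chi (k + k).
Proof.
move=> mchi chi01 cd C0 h.
have chi1 r : `|chi r| <= 1 by have /andP[? ?] := chi01 r; rewrite ger0_norm.
have f0 r : 0 <= r ^+ (k + k) * chi r * gauss_radial N r.
  have /andP[? _] := chi01 r.
  by rewrite mulr_ge0 ?gauss_radial_ge0// mulr_ge0// exprD -expr2 sqr_ge0.
have ii := integrable_radial N0 (k + k) mchi chi1.
have mI : measurable (`]c, d[ : set R) by exact: measurable_itv.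
rewrite -lee_fin /radial_moment fineK; last exact: (integrable_fin_num measurableT ii).
have mf := measurable_int _ ii.
apply: (@le_trans _ _ (\int[mu]_(r in `]c, d[) (r ^+ (k + k) * chi r * gauss_radial N r)%:E)%E).
  apply: (@le_trans _ _ (\int[mu]_(r in `]c, d[) C%:E)%E).
    rewrite integral_cst//= [X in (_ * X)%E]lebesgue_measure_itv /= lte_fin.
    case: ltP => [_|dc]; first by rewrite -EFinD -EFinM.
    by rewrite (le_anti (_ : c <= d <= c)) ?subrr ?mulr0 ?mule0// cd.
  apply: ge0_le_integral => //=.
  - exact: measurable_funTS.
  - move=> r; rewrite in_itv/= => /h[-> rC].
    by rewrite lee_fin mulr1.
apply: ge0_subset_integral => //= r _.
by rewrite lee_fin.
Qed.

Variables (a b : R).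

Definition in_annulus (z : plane R) := cmod z \in `[a, b].

Lemma measurable_in_annulus : measurable_fun setT in_annulus.
Proof.
rewrite /in_annulus; under eq_fun do rewrite in_itv/=.
by apply: measurable_and; apply: measurable_fun_ler => //; exact: measurable_cmod.
Qed.

Let chi (r : R) : R := (a <= r <= b)%R%:R.

(** For X of law Gamma(k + 1), the probability that N a^2 <= X <= N b^2. *)
Definition annulus_probability k : R := moment chi (k + k) / moment (fun=> 1) (k + k).
Local Notation lam := annulus_probability.

Let chi01 r : 0 <= chi r <= 1.
Proof. by rewrite /chi; case: (a <= r <= b); rewrite ?lexx ?ler01. Qed.

Let mchi : measurable_fun setT chi.
Proof. exact: measurable_bool_itv. Qed.

(** The non-zero integer frequencies j - k integrate to 0 over the whole circle, so
    the Gram matrix is diagonal. *)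
Lemma annulus_variance_eq (v : R) :
  v%:C%C = \tr (indicator_gram N in_annulus) -
    \tr (indicator_gram N in_annulus *m indicator_gram N in_annulus) ->
  v = \sum_(k < N) lam k * (1 - lam k).
Proof.
move=> hv; have pi0 : 0 < pi :> R by exact: pi_gt0.
have b1 (r : R) : `|chi r| <= 1 by have /andP[? ?] := chi01 r; rewrite ger0_norm.
have mb : measurable_fun setT (fun z => (in_annulus z)%:R : R).
  rewrite (_ : (fun z => _) = fun z => if in_annulus z then 1 else 0); last first.
    by apply/funext => z; case: ifP.
  by apply: measurable_fun_ifT => //; exact: measurable_in_annulus.
have pipi : 0 < (pi : R) <= pi by rewrite pi0 lexx.
have hu r t : 0 < r -> - pi < t < pi -> t != 0 ->
    (in_annulus (polar (r, t)))%:R = chi r * (- pi <= t <= pi)%R%:R :> R.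
  move=> r0 /andP[t1 t2] t0; rewrite /in_annulus cmod_polar/= gtr0_norm//.
  by rewrite in_itv/= (ltW t1) (ltW t2) mulr1.
pose r (j k : nat) : R := if j == k then lam j else 0.
have ME j k : indicator_gram N in_annulus j k = (r j k)%:C%C.
  rewrite mxE (gram_entryE N0 _ _ mchi b1 pipi mb hu); congr (_%:C%C).
  rewrite /r; have [->|jk] := eqVneq (j : nat) k; last first.
    have -> : sector_coef (j%:R - k%:R) pi = 0 :> R by rewrite sector_coef_natpi (negbTE jk).
    by rewrite !mulr0.
  rewrite sector_coef_natpi eqxx -expr2 (monomial_scale_sq N0) /monomial_norm2.
  rewrite /lam radial_moment_even//.
  have m0 : (k : nat)`!%:R / (2 * N%:R ^+ k.+1) != 0 :> R.
    by rewrite gt_eqF// divr_gt0 ?ltr0n ?fact_gt0// mulr_gt0// exprn_gt0// ltr0n.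
  move: (_`!%:R / _) m0 (radial_moment _ _ _) => x x0 y.
  by move: (pi : R) (lt0r_neq0 pi0) => q q0; field; rewrite q0 x0.
rewrite (gram_variance (r := r) ME hv); apply: eq_bigr => j _.
rewrite (bigD1 j)//= big1 ?addr0; first by rewrite /r eqxx mulrBr mulr1.
move=> k kj; rewrite /r (_ : (j : nat) == k = false) ?mul0r//.
by rewrite eq_sym; apply/negbTE.
Qed.

Lemma annulus_probability_compl k :
  1 - lam k = moment (fun r => 1 - chi r) (k + k) / moment (fun=> 1) (k + k).
Proof.
have m1 : measurable_fun setT (fun _ : R => 1 : R) by exact: measurable_cst.
have b1 (r : R) : `|chi r| <= 1 by have /andP[? ?] := chi01 r; rewrite ger0_norm.
have n1 (r : R) : `|1 : R| <= 1 by rewrite normr1.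
have -> : moment (fun r => 1 - chi r) (k + k) =
    moment (fun=> 1) (k + k) - moment chi (k + k).
  rewrite /radial_moment -RintegralB//; [|exact: (integrable_radial N0 _ m1 n1)
    |exact: (integrable_radial N0 _ mchi b1)].
  by apply: eq_Rintegral => r _; ring.
rewrite mulrBl divff// radial_moment_even// gt_eqF//.
by rewrite divr_gt0 ?ltr0n ?fact_gt0// mulr_gt0// exprn_gt0// ltr0n.
Qed.

Lemma radial_ratio_lower (psi : R -> R) (c d C : R) k :
  measurable_fun setT psi -> (forall r, 0 <= psi r <= 1) -> c <= d -> 0 <= C ->
  (forall r, c < r < d -> psi r = 1 /\
    C * (k`!%:R / (2 * N%:R ^+ k.+1)) <= r ^+ (k + k) * gauss_radial N r) ->
  C * (d - c) <= moment psi (k + k) / moment (fun=> 1) (k + k).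
Proof.
move=> mpsi psi01 cd C0 h; have p0 : 0 < k`!%:R / (2 * N%:R ^+ k.+1) :> R.
  by rewrite divr_gt0 ?ltr0n ?fact_gt0// mulr_gt0// exprn_gt0// ltr0n.
rewrite radial_moment_even// ler_pdivlMr// mulrAC.
by apply: radial_moment_lower => //; rewrite mulr_ge0// ltW.
Qed.

Lemma annulus_probability_itv k : 0 <= lam k <= 1.
Proof.
have h (psi : R -> R) (m : measurable_fun setT psi) (p : forall r, 0 <= psi r <= 1) :
    0 <= moment psi (k + k) / moment (fun=> 1) (k + k).
  have := @radial_ratio_lower psi 0 0 0 k m p (lexx _) (lexx _).
  by rewrite subrr mulr0; apply => r /andP[r0 /(lt_trans r0)]; rewrite ltxx.
rewrite h//= -subr_ge0 annulus_probability_compl h//.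
  exact: measurable_funB.
by move=> r; have /andP[? ?] := chi01 r; rewrite subr_ge0 lerBlDr lerDl; apply/andP.
Qed.

Let C1 : R := a * expR (- (36 / a ^+ 2) - 1).

(** S is the square root of N. At distance at most 1 / S from a, x = N r^2 is within
    2 S of N a^2, hence within 3 S of k, and x >= N a^2 / 4: this is the constant
    36 / a^2 in C1. *)
Lemma radial_density_lower (S r : R) k : 0 < a < 1 -> S ^+ 2 = N%:R -> 2 <= a * S ->
  1 <= (1 - a) * S -> (0 < k <= N)%N -> S ^+ 2 * a ^+ 2 <= k%:R <= S ^+ 2 * a ^+ 2 + S ->
  a - S^-1 < r < a + S^-1 ->
  S * C1 * (k`!%:R / (2 * N%:R ^+ k.+1)) <= r ^+ (k + k) * gauss_radial N r.
Proof.
move=> /andP[a0 a1] SN aS a1S /andP[k0 kN] /andP[k1 k2] /andP[r1 r2].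
have S0 : 0 < S by rewrite -(pmulr_rgt0 _ a0); lra.
have SV : S * S^-1 = 1 by rewrite divff// gt_eqF.
have SV0 : 0 < S^-1 by rewrite invr_gt0.
have ra : a / 2 < r by nra.
have r0 : 0 < r by lra.
have rle : r < 1 by nra.
have x0 : 0 < S ^+ 2 * r ^+ 2 by rewrite mulr_gt0// exprn_gt0.
have kS : k%:R <= S ^+ 2 by rewrite SN ler_nat.
have P := poisson_lower S0 x0 k0 kS.
rewrite /gauss_radial /positive_part_weight r0.
have gap : (S ^+ 2 * r ^+ 2 - k%:R) ^+ 2 / (S ^+ 2 * r ^+ 2) <= 36 / a ^+ 2.
  rewrite ler_pdivrMr// [leRHS]mulrAC ler_pdivlMr ?exprn_gt0//.
  have d1 : S * `|r - a| <= 1.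
    rewrite -[leRHS]SV (ler_wpM2l (ltW S0))// ler_norml; lra.
  have d2 : `|S ^+ 2 * r ^+ 2 - k%:R| <= 3 * S.
    have -> : S ^+ 2 * r ^+ 2 - k%:R = S * ((S * (r - a)) * (r + a)) +
        (S ^+ 2 * a ^+ 2 - k%:R) by ring.
    apply: (le_trans (ler_normD _ _)).
    have : `|S * (S * (r - a) * (r + a))| <= S * 2.
      rewrite !normrM (gtr0_norm S0) (ler_wpM2l (ltW S0))//.
      rewrite (@ger0_norm _ (r + a)); last lra.
      have := normr_ge0 (r - a); nra.
    have : `|S ^+ 2 * a ^+ 2 - k%:R| <= S by rewrite ler_norml; lra.
    lra.
  have d3 : (S ^+ 2 * r ^+ 2 - k%:R) ^+ 2 <= 9 * S ^+ 2.
    rewrite -real_normK ?num_real// (_ : 9 * S ^+ 2 = (3 * S) ^+ 2); last ring.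
    by rewrite ler_pXn2r// nnegrE; lra.
  have d4 : a ^+ 2 <= 4 * r ^+ 2 by nra.
  apply: (@le_trans _ _ (9 * S ^+ 2 * a ^+ 2)).
    by rewrite ler_wpM2r ?sqr_ge0.
  have -> : 36 * (S ^+ 2 * r ^+ 2) = 9 * S ^+ 2 * (4 * r ^+ 2) by ring.
  by rewrite ler_wpM2l// mulr_ge0// sqr_ge0.
have E1 : expR (- (36 / a ^+ 2) - 1) <=
    expR (- ((S ^+ 2 * r ^+ 2 - k%:R) ^+ 2 / (S ^+ 2 * r ^+ 2)) - 1).
  by rewrite ler_expR lerD2r lerN2.
have NS : N%:R ^+ k.+1 = S ^+ 2 * (S ^+ 2) ^+ k by rewrite SN exprS.
have Sk0 : 0 < (S ^+ 2) ^+ k by rewrite !exprn_gt0.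
rewrite NS -SN [leLHS]mulrA ler_pdivrMr; last by rewrite !mulr_gt0// exprn_gt0.
have -> : r ^+ (k + k) * (expR (- (S ^+ 2 * r ^+ 2)) * r) *
    (2 * (S ^+ 2 * (S ^+ 2) ^+ k)) =
    2 * S ^+ 2 * r * ((S ^+ 2 * r ^+ 2) ^+ k * expR (- (S ^+ 2 * r ^+ 2))).
  rewrite addnn -mul2n exprM [in RHS]exprMn.
  by move: ((r ^+ 2) ^+ k) ((S ^+ 2) ^+ k) => u w; ring.
apply: (@le_trans _ _ (S ^+ 2 * a * (k`!%:R * expR (- (36 / a ^+ 2) - 1) / S))).
  rewrite /C1 le_eqVlt; apply/orP; left; apply/eqP.
  by field; rewrite gt_eqF.
have h : k`!%:R * expR (- (36 / a ^+ 2) - 1) / S <=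
    (S ^+ 2 * r ^+ 2) ^+ k * expR (- (S ^+ 2 * r ^+ 2)).
  apply: le_trans P; by rewrite ler_wpM2r ?(ltW SV0)// ler_wpM2l.
have h0 : 0 <= k`!%:R * expR (- (36 / a ^+ 2) - 1) / S.
  by rewrite mulr_ge0 ?(ltW SV0)// mulr_ge0// expR_ge0.
apply: (@ler_pM _ _ _ _ _) => //; first by rewrite mulr_ge0 ?sqr_ge0// (ltW a0).
have -> : 2 * S ^+ 2 * r = S ^+ 2 * (2 * r) by ring.
rewrite (ler_wpM2l (sqr_ge0 S))//; lra.
Qed.

End annulus_variance.

Section annulus_variance_bound.
Context {R : realType}.
Implicit Types (a b e S v : R).

Definition annulus_constant a : R := a * expR (- (36 / a ^+ 2) - 1).

Lemma annulus_constant_gt0 a : 0 < a -> 0 < annulus_constant a.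
Proof. by move=> a0; rewrite mulr_gt0// expR_gt0. Qed.

(** The interval ]a, a + e[ lies in the annulus and ]a - 1 / S, a[ outside it; on
    both the radial density is at least of order S. *)
Lemma annulus_probability_window (N k : nat) a b e S : (0 < N)%N -> 0 < a < 1 ->
  S ^+ 2 = N%:R -> 2 <= a * S -> 1 <= (1 - a) * S -> 0 < e -> a + e <= b ->
  e * S <= 1 -> (0 < k <= N)%N ->
  S ^+ 2 * a ^+ 2 <= k%:R <= S ^+ 2 * a ^+ 2 + S ->
  annulus_constant a * S * e * annulus_constant a <=
  annulus_probability N a b k * (1 - annulus_probability N a b k).
Proof.
move=> N0 a01 SN aS a1S e0 aeb eS kN kS; have /andP[a0 a1] := a01.
have S0 : 0 < S by rewrite -(pmulr_rgt0 _ a0); lra.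
have SV : S * S^-1 = 1 by rewrite divff// gt_eqF.
have SV0 : 0 < S^-1 by rewrite invr_gt0.
have C0 := annulus_constant_gt0 a0.
have SC0 : 0 <= S * annulus_constant a by rewrite mulr_ge0// ltW.
have eSV : e <= S^-1 by rewrite -[e]mulr1 -SV mulrA ler_piMl// ltW.
have D := radial_density_lower a01 SN aS a1S kN kS.
apply: ler_pM.
- by rewrite !mulr_ge0// ltW.
- exact: ltW.
- rewrite (_ : _ * e = S * annulus_constant a * (a + e - a)); last by ring.
  apply: (radial_ratio_lower N0) => //.
  + exact: measurable_bool_itv.
  + by move=> r; case: (a <= r <= b); rewrite ?lexx ?ler01.
  + by rewrite lerDl ltW.
  + move=> r /andP[r1 r2]; split.
      by rewrite (ltW r1) (le_trans (ltW r2)).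
    by apply: D; apply/andP; split; lra.
- rewrite (annulus_probability_compl N0).
  rewrite [leLHS](_ : _ = S * annulus_constant a * (a - (a - S^-1))); last first.
    by rewrite opprB addrCA subrr addr0 mulrAC SV mul1r.
  apply: (radial_ratio_lower N0) => //.
  + by apply: measurable_funB => //; exact: measurable_bool_itv.
  + by move=> r; case: (a <= r <= b); rewrite ?subrr ?subr0 ?lexx ?ler01.
  + by rewrite lerBlDr lerDl ltW.
  + move=> r /andP[r1 r2]; split; first by rewrite leNgt r2 subr0.
    by apply: D; apply/andP; split; lra.
Qed.

(** The integers between N a^2 and N a^2 + S are at least S / 2 in number and below
    N, and each contributes as in annulus_probability_window. *)
Lemma annulus_variance_lower (N : nat) a b e S v : (0 < N)%N -> 0 < a < 1 ->
  S ^+ 2 = N%:R -> 2 <= a * S -> 1 <= (1 - a) * S -> 0 < e -> a + e <= b ->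
  e * S <= 1 ->
  v%:C%C = \tr (indicator_gram N (in_annulus a b)) -
    \tr (indicator_gram N (in_annulus a b) *m indicator_gram N (in_annulus a b)) ->
  annulus_constant a ^+ 2 / 2 * (N%:R * e) <= v.
Proof.
move=> N0 a01 SN aS a1S e0 aeb eS /(annulus_variance_eq N0)->.
have /andP[a0 a1] := a01; have C0 := annulus_constant_gt0 a0.
have S0 : 0 < S by rewrite -(pmulr_rgt0 _ a0); lra.
have S2 : 2 <= S by nra.
pose f k := annulus_probability N a b k * (1 - annulus_probability N a b k).
have f0 k : 0 <= f k.
  have /andP[? ?] := annulus_probability_itv N0 a b k.
  by rewrite mulr_ge0// subr_ge0.
pose n := Num.truncn S; pose t := Num.truncn (S ^+ 2 * a ^+ 2).
have /andP[n1 n2] : n%:R <= S < n.+1%:R by rewrite truncn_itv// ltW.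
have /andP[t1 t2] : t%:R <= S ^+ 2 * a ^+ 2 < t.+1%:R.
  by rewrite truncn_itv// mulr_ge0 ?sqr_ge0.
have tnN : (t.+1 + n <= N)%N.
  rewrite -(ler_nat R) -SN natrD -natr1.
  have h : (1 + a) * S <= (1 - a) * S * ((1 + a) * S).
    by rewrite ler_peMl// mulr_ge0 ?(ltW S0)//; lra.
  have h2 : (1 - a) * S * ((1 + a) * S) = S ^+ 2 - S ^+ 2 * a ^+ 2 by ring.
  by move: h; rewrite h2; move: (S ^+ 2) (S ^+ 2 * a ^+ 2) t1 => x y t1; lra.
rewrite -(big_mkord xpredT f) (@big_cat_nat _ _ _ t.+1) ?(leq_trans _ tnN) ?leq_addr//=.
rewrite (@big_cat_nat _ _ _ (t.+1 + n) t.+1 N) ?leq_addr//=.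
set q := annulus_constant a * S * e * annulus_constant a.
have W : \sum_(t.+1 <= k < t.+1 + n) q <= \sum_(t.+1 <= k < t.+1 + n) f k.
  apply: ler_sum_nat => k /andP[k1 k2]; apply: annulus_probability_window => //.
    by rewrite (leq_ltn_trans (leq0n t) k1) (leq_trans (ltnW k2)).
  rewrite (le_trans (ltW t2)) ?ler_nat//=.
  have : k%:R <= t%:R + n%:R :> R by rewrite -natrD ler_nat -ltnS -addSn.
  lra.
rewrite sumr_const_nat addKn in W.
have s1 : 0 <= \sum_(0 <= k < t.+1) f k by apply: sumr_ge0.
have s2 : 0 <= \sum_(t.+1 + n <= k < N) f k by apply: sumr_ge0.
have W2 : S / 2 * q <= q *+ n.
  rewrite -[q *+ n]mulr_natl ler_wpM2r//; last first.
    by rewrite -natr1 in n2; lra.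
  by rewrite !mulr_ge0// ltW.
have -> : annulus_constant a ^+ 2 / 2 * (N%:R * e) = S / 2 * q.
  by rewrite -SN /q; ring.
lra.
Qed.

End annulus_variance_bound.

(** * Central limit theorems *)

Section ginibre_clt.
Context {R : realType}.

Definition gram_trace_variance N (p : pred (plane R)) : R[i] :=
  \tr (indicator_gram N p) - \tr (indicator_gram N p *m indicator_gram N p).

(** A lower bound of tr(M - M^2) for large N is all that the central limit theorem
    asks for. *)
Lemma ginibre_count_clt (p : forall N : nat, pred (plane R))
    (X : forall N, {RV (ginibre R N) >-> R}) :
  (forall N, measurable_fun setT (p N)) ->
  (forall N z, X N z = count_points (p N) z) ->
  (forall A : R, \forall N \near \oo, (0 < N)%N -> forall v : R,
    v%:C%C = gram_trace_variance N (p N) -> A <= v) ->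
  cvg_in_distribution (ginibre R)
    (fun N => standardized (ginibre R N) (X N)) (normal_prob 0 1).
Proof.
move=> mp XE var_oo.
have XA N (k : R) : X N @^-1` [set k] = @count_points R N (p N) @^-1` [set k].
  by apply/seteqP; split => z /=; rewrite XE.
have spec N : exists s : seq R, [/\ size s = N, probabilities s,
    forall x : R, \sum_(k < N.+1) pmf (X N) k%:R * x ^+ k =
      \prod_(l <- s) (1 - l + l * x) &
    (0 < N)%N -> (bernoulli_var s)%:C%C = gram_trace_variance N (p N)].
  case: N => [|N].
    exists [::]; split => // x; rewrite big_nil big_ord1 expr0 mulr1 /pmf.
    rewrite (_ : _ @^-1` _ = setT) ?probability_setT//.
    by apply/seteqP; split => // z _; rewrite /= XE /count_points eq_card0// => -[].
  have [//|s [ss ps gs vs]] := @ginibre_count_spectrum R N.+1 _ (p N.+1) (mp N.+1).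
  exists s; split => // x; rewrite -gs; apply: eq_bigr => k _.
  by rewrite /pmf XA.
have [s hs] := choice spec.
apply: (@counting_variable_clt R _ _ _ X s).
- move=> N z; exists #|[pred k | p N (tnth z k)]|; last by rewrite XE.
  by rewrite (leq_trans (max_card _))// card_ord.
- by move=> N; have [] := hs N.
- by move=> N; have [] := hs N.
- by move=> N; have [] := hs N.
apply/cvgryPge => A; near=> N.
have N0 : (0 < N)%N by near: N; exact: nbhs_infty_gt.
have [_ _ _ /(_ N0)] := hs N.
by move: N0 (bernoulli_var _); near: N; exact: var_oo.
Unshelve. all: by end_near. Qed.

(** The lag L N has to keep L N * alpha N away from the multiples of pi while
    staying small compared with N. *)
Lemma sector_count_clt (alpha : nat -> R) (L : nat -> nat) (kappa : R) :
  0 < kappa ->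
  (\forall N \near \oo, [/\ 0 < alpha N <= pi, (0 < L N)%N &
    kappa <= 1 - `|cos ((L N)%:R * alpha N)|]) ->
  (forall B : R, \forall N \near \oo, B <= N.+1%:R / (L N).+1%:R) ->
  cvg_in_distribution (ginibre R)
    (fun N => standardized (ginibre R N) (count_sector (alpha N)))
    (normal_prob 0 1).
Proof.
move=> k0 hL hB.
apply: (@ginibre_count_clt (fun N => in_sector (alpha N))) => //.
  by move=> N; exact: measurable_in_sector.
move=> A; have pi2 : 0 < pi ^+ 2 :> R by rewrite exprn_gt0 ?pi_gt0.
near=> N => N0 v hv.
have [ha L0 hk] : [/\ 0 < alpha N <= pi, (0 < L N)%N &
    kappa <= 1 - `|cos ((L N)%:R * alpha N)|] by near: N.
have y1 : expR (Num.max 0 (A * pi ^+ 2 / kappa)) <= N.+1%:R / (L N).+1%:R.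
  by near: N; exact: hB.
apply: le_trans (sector_variance_lower N0 ha L0 hv).
rewrite ler_pdivlMr//.
have lny : Num.max 0 (A * pi ^+ 2 / kappa) <= ln (N.+1%:R / (L N).+1%:R).
  by rewrite -[leLHS]expRK ler_ln ?posrE ?expR_gt0// divr_gt0.
move: lny; rewrite ge_max => /andP[ln0 lnA].
apply: (@le_trans _ _ (kappa * ln (N.+1%:R / (L N).+1%:R))).
  by rewrite [leRHS]mulrC -ler_pdivrMr.
by rewrite ler_wpM2r.
Unshelve. all: by end_near. Qed.

Lemma fixed_sector_clt (alpha : nat -> R) alpha0 : 0 < alpha0 < pi ->
  (forall N, alpha N = alpha0) ->
  cvg_in_distribution (ginibre R)
    (fun N => standardized (ginibre R N) (count_sector (alpha N)))
    (normal_prob 0 1).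
Proof.
move=> /andP[a0 api] aE.
apply: (@sector_count_clt alpha (fun=> 1%N) (1 - `|cos alpha0|)).
- rewrite subr_gt0 -(@ltr_pXn2r _ 2)// ?nnegrE// expr1n real_normK ?num_real//.
  by rewrite -(cos2Dsin2 alpha0) ltrDl exprn_gt0// sin_gt0_pi// a0 api.
- by apply: nearW => N; rewrite aE a0 (ltW api) mul1r.
- move=> B; near=> N; rewrite ler_pdivlMr//.
  have : B * 2 <= N%:R by near: N; exact: nbhs_infty_ger.
  by move=> /le_trans; apply; rewrite ler_nat.
Unshelve. all: by end_near. Qed.

(** The integer part L of pi / (2 alpha) satisfies pi / 4 <= L alpha <= pi / 2, and
    N / L is of order N alpha. *)
Lemma shrinking_sector_clt (alpha : nat -> R) :
  (forall N, (0 < N)%N -> 0 < alpha N) ->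
  alpha N @[N --> \oo] --> (0 : R) ->
  N%:R * alpha N @[N --> \oo] --> +oo ->
  cvg_in_distribution (ginibre R)
    (fun N => standardized (ginibre R N) (count_sector (alpha N)))
    (normal_prob 0 1).
Proof.
move=> a0 acvg Na; have pi0 : 0 < pi :> R by exact: pi_gt0.
pose L N := Num.truncn (pi / (2 * alpha N)).
have pi4 : 0 <= (pi : R) / 4 <= pi by lra.
have small : \forall N \near \oo, [/\ 0 < alpha N, alpha N < pi / 2 &
    (L N)%:R * (2 * alpha N) <= pi < (L N).+1%:R * (2 * alpha N)].
  near=> N.
  have N0 : (0 < N)%N by near: N; exact: nbhs_infty_gt.
  have aN := a0 _ N0; split => //.
    near: N; apply: (cvgr_lt _ acvg); lra.
  have d0 : 0 < 2 * alpha N by rewrite mulr_gt0.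
  by rewrite -ler_pdivlMr// -ltr_pdivrMr// truncn_itv// divr_ge0// ltW.
have L_gt0 N : 0 < alpha N -> alpha N < pi / 2 -> (0 < L N)%N.
  move=> aN ap; rewrite truncn_gt0 ler_pdivlMr ?mulr_gt0//; lra.
apply: (@sector_count_clt alpha L (1 - cos (pi / 4))).
- rewrite subr_gt0 -[ltRHS]cos0 ltr_cos ?in_itv/= ?lexx ?(ltW pi0)//; lra.
- near=> N.
  have [aN ap /andP[l1 l2]] : [/\ 0 < alpha N, alpha N < pi / 2 &
    (L N)%:R * (2 * alpha N) <= pi < (L N).+1%:R * (2 * alpha N)] by near: N.
  have L0 := L_gt0 _ aN ap.
  have L1 : 1 <= (L N)%:R :> R by rewrite ler1n.
  split => //; first by rewrite aN; lra.
  have x1 : (L N)%:R * alpha N <= pi / 2 by lra.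
  have x2 : pi / 4 <= (L N)%:R * alpha N.
    by rewrite -natr1 in l2; nra.
  rewrite ger0_norm; last first.
    by apply: cos_ge0_pihalf; rewrite x1 andbT; lra.
  rewrite lerD2l lerN2 leNgt ltr_cos ?in_itv/= -?leNgt; lra.
- move=> B; near=> N.
  have [aN ap /andP[l1 l2]] : [/\ 0 < alpha N, alpha N < pi / 2 &
    (L N)%:R * (2 * alpha N) <= pi < (L N).+1%:R * (2 * alpha N)] by near: N.
  have L0 := L_gt0 _ aN ap.
  have L1 : 1 <= (L N)%:R :> R by rewrite ler1n.
  have h : `|B| * pi <= N%:R * alpha N.
    by near: N; move/cvgryPge: Na; exact.
  rewrite ler_pdivlMr//; apply: (le_trans (ler_wpM2r _ (ler_norm B))) => //.
  rewrite -(ler_pM2r aN).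
  have h1 : `|B| * (L N).+1%:R * alpha N <= `|B| * pi.
    rewrite -mulrA ler_wpM2l// -natr1; nra.
  apply: (le_trans h1); apply: (le_trans h).
  by rewrite ler_wpM2r ?(ltW aN)// ler_nat.
Unshelve. all: by end_near. Qed.

(** The width e = min(b - a, 1 / sqrt N) makes N e the minimum of N (b - a) and
    sqrt N, both of which tend to infinity. *)
Lemma annulus_count_clt (a : R) (b : nat -> R) : 0 < a < 1 ->
  (forall N, (0 < N)%N -> a < b N) ->
  N%:R * (b N - a) @[N --> \oo] --> +oo ->
  cvg_in_distribution (ginibre R)
    (fun N => standardized (ginibre R N) (count_annulus a (b N)))
    (normal_prob 0 1).
Proof.
move=> a01 ab Nb; have /andP[a0 a1] := a01.
apply: (@ginibre_count_clt (fun N => in_annulus a (b N))) => //.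
  by move=> N; exact: measurable_in_annulus.
move=> A; have C0 := annulus_constant_gt0 a0.
set c := annulus_constant a ^+ 2 / 2.
have c0 : 0 < c by rewrite divr_gt0// exprn_gt0.
have sq (B : R) : \forall N \near \oo, B <= Num.sqrt N%:R.
  near=> N; apply: (le_trans (ler_norm B)).
  rewrite -sqrtr_sqr ler_wsqrtr//; near: N; exact: nbhs_infty_ger.
near=> N => N0 v hv.
have S1 : 2 / a <= Num.sqrt N%:R by near: N; exact: sq.
have S2 : (1 - a)^-1 <= Num.sqrt N%:R by near: N; exact: sq.
have S3 : A / c <= Num.sqrt N%:R by near: N; exact: sq.
have B3 : A / c <= N%:R * (b N - a) by near: N; move/cvgryPge: Nb; exact.
have SN : Num.sqrt N%:R ^+ 2 = N%:R :> R by rewrite sqr_sqrtr.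
set S := Num.sqrt N%:R in S1 S2 S3 SN *.
have S0 : 0 < S by rewrite sqrtr_gt0 ltr0n.
pose e := Num.min (b N - a) S^-1.
have := @annulus_variance_lower R N a (b N) e S v N0 a01 SN.
have -> : 2 <= a * S by rewrite [leRHS]mulrC -ler_pdivrMr.
have -> : 1 <= (1 - a) * S.
  by rewrite [leRHS]mulrC -ler_pdivrMr ?div1r// subr_gt0.
have -> : 0 < e by rewrite lt_min subr_gt0 ab//= invr_gt0.
have -> : a + e <= b N by rewrite addrC -lerBrDr ge_min lexx.
have -> : e * S <= 1 by rewrite -ler_pdivlMr// div1r ge_min lexx orbT.
move=> /(_ isT isT isT isT isT hv); apply: le_trans.
rewrite [leRHS]mulrC -ler_pdivrMr// /e minr_pMr// le_min B3.
by rewrite -SN expr2 mulfK ?gt_eqF.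
Unshelve. all: by end_near. Qed.

End ginibre_clt.

Theorem mainTheorem8 (R : realType) :
  (forall alpha : nat -> R,
     (exists2 alpha0 : R, 0 < alpha0 < pi & forall N, alpha N = alpha0) \/
     [/\ forall N, (0 < N)%N -> 0 < alpha N,
         alpha N @[N --> \oo] --> (0 : R) &
         N%:R * alpha N @[N --> \oo] --> +oo] ->
   cvg_in_distribution (ginibre R)
     (fun N => standardized (ginibre R N) (count_sector (alpha N)))
     (normal_prob 0 1)) /\
  (forall (a : R) (b : nat -> R),
     (exists b0 : R, [/\ a < b0, `[a, b0] `<=` `]0, 1[ &
                         forall N, b N = b0]) \/
     [/\ 0 < a < 1,
         forall N, (0 < N)%N -> a < b N,
         b N - a @[N --> \oo] --> (0 : R) &
         N%:R * (b N - a) @[N --> \oo] --> +oo] ->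
   cvg_in_distribution (ginibre R)
     (fun N => standardized (ginibre R N) (count_annulus a (b N)))
     (normal_prob 0 1)).
Proof.
split=> [alpha [[alpha0 a0 aE]|[a0 acvg Na]]|a b [[b0 [ab sub bE]]|[a01 ab _ Nb]]].
- exact: fixed_sector_clt a0 aE.
- exact: shrinking_sector_clt a0 acvg Na.
- have a01 : 0 < a < 1.
    have := sub a; rewrite /= !in_itv/= lexx (ltW ab); exact.
  apply: annulus_count_clt => //; first by move=> N _; rewrite bE.
  apply/cvgryPge => A; near=> N.
  rewrite bE -ler_pdivrMr ?subr_gt0//; near: N; exact: nbhs_infty_ger.
- exact: annulus_count_clt.
Unshelve. all: by end_near. Qed.
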